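(* Let $k,n$ be positive integers with $n>2k$ and let $q>k$. Let $\rho\in C^2(0,\infty)\cap C[0,\infty)$ with $\rho(r)>0$ for $r>0$, put $R(r)=r\rho'(r)/\rho(r)$, and assume: (a) the finite limit $l_0=\lim_{r\to 0}R(r)$ exists, and either [$l_0>R(r)$ for all $r>0$ and $q\ge q^*(k,l_0)$] or [$l_0\ge R(r)$ for all $r>0$ and $q>q^*(k,l_0)$]; (b) there is a constant $L>0$ such that $0<r^{-l_0}\rho(r)<L$ for all $r>0$. Assume moreover that $l_0>2k$. Then there exists $\lambda^*>0$ such that for each $\lambda\in(0,\lambda^* )$ the problem $(P_\lambda)$ admits a maximal bounded solution. Moreover, there is at least one integral solution of $(P_\lambda)$ for $\lambda=\lambda^*$, possibly unbounded, and there are no classical solutions of $(P_\lambda)$ for all $\lambda>\lambda^*$. Furthermore, $$\lambda^*\ \ge\ C^{-1}\binom{n}{k}\left(\frac{q-k}{q}\right)^q\left(\frac{2k}{q-k}\right)^k,\qquad C=\max_{r\in[0,1]}\rho(r)>0 .$$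
   Context: Notation: $q^*(k,\sigma)=\frac{(n+2)k+\sigma(k+1)}{n-2k}$ for $\sigma\ge 0$, and $c_{n,k}=\binom nk/n$. $B$ is the unit ball of $\mathbb R^n$. $S_i(D^2u)$ is the $i$-th elementary symmetric function of the eigenvalues of the Hessian $D^2u$. Problem $(P_\lambda)$, $\lambda>0$: $c_{n,k}r^{1-n}\left(r^{n-k}(u')^k\right)'=\lambda\rho(r)(1-u)^q$ for $0<r<1$, $u(r)<0$ for $0\le r<1$, $u(1)=0$. It is the radial form of Problem $(P)$: $S_k(D^2u)=\lambda\rho(|x|)(1-u)^q$ in $B$, $u=0$ on $\partial B$, for negative radial $u$. Let $I=(0,1)$ and $\Phi_0^k=\{u\in C^2(I)\cap C^1(\bar I): (r^{n-i}(u')^i)'\ge 0 \text{ in } I,\ i=1,\dots,k,\ u'(0)=u(1)=0\}$. A classical solution of $(P_\lambda)$ is a $u\in\Phi_0^k$ satisfying the equation of $(P_\lambda)$. An integral solution of $(P_\lambda)$ is a function $u$, absolutely continuous on $(0,1]$, with $\int_0^1 s^{n-1}\rho(s)(1-u(s))^q\,ds<\infty$, $u(1)=0$ and $c_{n,k}r^{n-k}(u'(r))^k=\lambda\int_0^r s^{n-1}\rho(s)(1-u(s))^q\,ds$ for all $r\in I$. A subsolution of $(P)$ is a function $u\in C^2(B)\cap C(\overline B)$ with $S_i(D^2u)\ge 0$ in $B$ for $i=1,\dots,k$, such that $S_k(D^2u)\ge\lambda\rho(|x|)(1-u)^q$ in $B$ and $u\le 0$ on $\partial B$. A solution $v$ of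 $(P)$ is maximal if $u\le v$ for every subsolution $u$ of $(P)$. A solution $u$ of $(P_\lambda)$ is maximal if $v(x)=u(|x|)$ is a maximal solution of $(P)$. *)

(* Defs.v *)
From HB Require Import structures.
From mathcomp Require Import all_boot all_order all_algebra.
From mathcomp Require Import all_classical all_reals all_analysis.
Import Order.TTheory GRing.Theory Num.Theory.
Import numFieldNormedType.Exports.

Set Implicit Arguments.
Unset Strict Implicit.
Unset Printing Implicit Defensive.

Local Open Scope ring_scope.
Local Open Scope classical_set_scope.

Section RealLine.
Context {R : realType}.
Implicit Types (f u : R -> R) (D A : set R).

(* Only meant for open D. *)
Definition C2_on D f : Prop :=
  forall x, D x ->
    [/\ derivable f x 1, derivable (derive1 f) x 1
      & {for x, continuous (derive1 (derive1 f))}].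

(* At an endpoint of an interval A this is the one-sided derivative. *)
Definition has_deriv_within A f (x d : R) : Prop :=
  (f y - f x) / (y - x) @[y --> within A x^'] --> d.

Definition C1_within A f : Prop :=
  exists2 df : R -> R, {within A, continuous df} &
    forall x, A x -> has_deriv_within A f x (df x).

Definition abs_continuous (a b : R) f : Prop :=
  forall e : R, 0 < e -> exists2 d : R, 0 < d &
    forall (N : nat) (x y : nat -> R),
      (forall i, (i < N)%N -> [/\ a <= x i, x i <= y i & y i <= b]) ->
      trivIset [set i | (i < N)%N] (fun i => `]x i, y i[) ->
      \sum_(i < N) (y i - x i) < d ->
      \sum_(i < N) `|f (y i) - f (x i)| < e.

(* Absolute continuity on every compact subinterval of (0,1]; f may be
   unbounded near 0. *)
Definition abs_continuous_01 f : Prop :=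
  forall a : R, 0 < a -> a < 1 -> abs_continuous a 1 f.

End RealLine.

Section Euclidean.
Context {R : realType} {n : nat}.
Implicit Types (u : 'rV[R]_n -> R) (x : 'rV[R]_n) (A : 'M[R]_n).

(* The library norm on 'rV[R]_n is the sup norm, hence the explicit
   Euclidean one; both induce the same topology. *)
Definition enorm x : R := Num.sqrt (\sum_i x 0 i ^+ 2).

Definition unit_ball : set 'rV[R]_n := [set x | enorm x < 1].
Definition closed_unit_ball : set 'rV[R]_n := [set x | enorm x <= 1].
Definition unit_sphere : set 'rV[R]_n := [set x | enorm x = 1].

Definition basis_vec (i : 'I_n) : 'rV[R]_n := delta_mx 0 i.

(* Only meant for open D. *)
Definition C2_on_rV (D : set 'rV[R]_n) u : Prop :=
  forall x, D x -> {for x, continuous u} /\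
    forall i : 'I_n,
      [/\ derivable u x (basis_vec i),
          {for x, continuous ('D_(basis_vec i) u)}
        & forall j : 'I_n,
            derivable ('D_(basis_vec i) u) x (basis_vec j) /\
            {for x, continuous ('D_(basis_vec j) ('D_(basis_vec i) u))}].

Definition hessian u x : 'M[R]_n :=
  \matrix_(i, j) 'D_(basis_vec j) ('D_(basis_vec i) u) x.

(* The n eigenvalues with algebraic multiplicity, in an arbitrary order; the
   default value 0 is only taken when the characteristic polynomial does not
   split over R, hence never for a symmetric matrix. *)
Definition eigenvalues A : 'rV[R]_n :=
  xget 0 [set s : 'rV[R]_n | char_poly A = \prod_(j < n) ('X - (s 0 j)%:P)].

Definition elem_sym (i : nat) (s : 'rV[R]_n) : R :=
  \sum_(J : {set 'I_n} | #|J| == i) \prod_(j in J) s 0 j.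

Definition hessian_S (i : nat) u x : R :=
  elem_sym i (eigenvalues (hessian u x)).

End Euclidean.

Section Problems.
Context {R : realType}.
Variables (n k : nat) (q : R) (rho : R -> R).

Definition q_star (sigma : R) : R :=
  ((n%:R + 2) * k%:R + sigma * (k%:R + 1)) / (n%:R - 2 * k%:R).

Definition c_nk : R := 'C(n, k)%:R / n%:R.

Definition Phi0 (u : R -> R) : Prop :=
  [/\ C2_on `]0, 1[ u /\ C1_within `[0, 1] u,
      forall i : nat, (1 <= i <= k)%N -> forall r : R, 0 < r < 1 ->
        0 <= derive1 (fun s : R => s ^+ (n - i) * derive1 u s ^+ i) r,
      has_deriv_within `[0, 1] u 0 0
    & u 1 = 0].

(* The left-hand side is S_k(D^2 v) for the radial function v(x) = u(|x|). *)
Definition classical_solution (lambda : R) (u : R -> R) : Prop :=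
  Phi0 u /\
  forall r : R, 0 < r < 1 ->
    c_nk * r ^- (n - 1) *
        derive1 (fun s : R => s ^+ (n - k) * derive1 u s ^+ k) r
      = lambda * rho r * (1 - u r) `^ q.

(* u(0) is not prescribed: u may tend to -oo at 0.  Negativity on (0,1) keeps
   the base 1 - u of the real power positive. *)
Definition integral_solution (lambda : R) (u : R -> R) : Prop :=
  let F (r : R) : \bar R :=
    (\int[lebesgue_measure]_(s in `]0%R, r[)
        (s ^+ (n - 1) * rho s * (1 - u s) `^ q)%:E)%E in
  [/\ abs_continuous_01 u,
      (F 1%R < +oo)%E,
      forall r : R, 0 < r < 1 -> u r < 0,
      u 1 = 0
    & forall r : R, 0 < r < 1 ->
        derivable u r 1 /\
        ((c_nk * r ^+ (n - k) * derive1 u r ^+ k)%:E = lambda%:E * F r)%E].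

Definition k_admissible (u : 'rV[R]_n -> R) : Prop :=
  [/\ C2_on_rV unit_ball u,
      {within closed_unit_ball, continuous u}
    & forall i : nat, (1 <= i <= k)%N ->
        forall x, unit_ball x -> 0 <= hessian_S i u x].

Definition subsolution_P (lambda : R) (u : 'rV[R]_n -> R) : Prop :=
  [/\ k_admissible u,
      forall x, unit_ball x ->
        lambda * rho (enorm x) * (1 - u x) `^ q <= hessian_S k u x
    & forall x, unit_sphere x -> u x <= 0].

Definition solution_P (lambda : R) (v : 'rV[R]_n -> R) : Prop :=
  [/\ k_admissible v,
      forall x, unit_ball x -> v x < 0,
      forall x, unit_ball x ->
        hessian_S k v x = lambda * rho (enorm x) * (1 - v x) `^ q
    & forall x, unit_sphere x -> v x = 0].

Definition maximal_solution_P (lambda : R) (v : 'rV[R]_n -> R) : Prop :=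
  solution_P lambda v /\
  forall u, subsolution_P lambda u ->
    forall x, closed_unit_ball x -> u x <= v x.

Definition maximal_bounded_solution (lambda : R) (u : R -> R) : Prop :=
  [/\ classical_solution lambda u,
      forall r : R, 0 <= r < 1 -> u r < 0,
      [bounded u r | r in `[0, 1]]
    & maximal_solution_P lambda (fun x => u (enorm x))].

End Problems.

(* Main.v *)
Require Import Defs.
From mathcomp Require Import all_boot all_order all_algebra.
From mathcomp Require Import all_classical all_reals all_analysis.
From mathcomp Require Import measurable_realfun complex sesquilinear spectral ring lra.
Import Order.TTheory GRing.Theory Num.Theory.
Import numFieldNormedType.Exports.

(** With [w = 1 - u] the radial problem becomes the fixed point equation
    [w = Phi lam w] for the increasing operator
      [Phi lam w r = 1 + int_r^1 slope lam w],
      [slope lam w r = (lam / c r^(k-n) int_0^r s^(n-1) rho w^q)^(1/k)],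
    and [lambda_star] is the supremum of the parameters for which a classical
    solution exists.

    Existence. If a supersolution, called a barrier, is available, the iterates
    of [Phi lam] from the constant [1] increase to a bounded fixed point below
    it ([barrier_maximal_solution]). A classical solution for some parameter is
    a barrier for every smaller one ([sol_maximal_le]). The parabola
    [1 + a (1 - r^2) / 2], [a = 2k / (q - k)], is a barrier up to the explicit
    parameter of the last claim ([explicit_maximal_solution]).

    Regularity. Since [l0 > 2k], the weight is [O(r^(2k))] on [0,1], so the
    slope is [O(r^3)] and its derivative [O(r^2)]. This makes [u(|x|)] of class
    [C^2] at the origin ([radial_C2]). The weight cannot drop too fast because
    [r^(-l0) rho] is nonincreasing ([weight_doubling]).

    Maximality. A subsolution stays below [1 - w_j(|x|)] for every iterate
    [w_j], by induction on [j] and the comparison principle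
    ([comparison_principle]). At a positive maximum of
    [v - w + e/2 (|x|^2 - 1)] one has [D^2 w >= D^2 v + e I], and [S_k] is
    strictly increasing there: adding a rank-one positive matrix changes [S_k]
    by a positive combination of elementary symmetric functions of all but one
    eigenvalue ([minor_poly_rank1]), and these are positive on the Garding cone
    by Newton inequalities ([garding_cone_cons]).

    The extremal parameter. Superlinearity, [q > k], gives
    [- w' >= A w^(q/k)], hence an upper bound for [lam] and a bound for [w(r)]
    uniform for [lam] away from [0] ([sol_lambda_bounded], [sol_bounded]). For
    parameters increasing to [lambda_star] the maximal solutions are therefore
    monotone and bounded on compact subsets of (0,1]; monotone convergence of
    the fluxes and a squeeze of secant slopes give the integral equation in the
    limit ([limit_integral_solution]). *)

Set Implicit Arguments.
Unset Strict Implicit.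
Unset Printing Implicit Defensive.

Local Open Scope ring_scope.
Local Open Scope classical_set_scope.


(** * Real-rooted polynomials and Newton inequalities *)

Section RealRooted.
Context {R : rcfType}.
Implicit Types (p : {poly R}) (s : seq R).

(** A real polynomial that splits over [R]; constants, zero included, are
    allowed. *)
Definition real_rooted p :=
  exists c s, p = c *: \prod_(r <- s) ('X - r%:P).

Local Notation toC := (real_complex R).

(** Off the real axis the imaginary part of [P' / P = sum_r 1 / (z - r)] has the
    sign opposite to that of [Im z], so [P'] has no root there
    unless [s] is empty. *)
Lemma Im_logderiv (s : seq R) (z : R[i]) :
  let P := \prod_(r <- s) ('X - (toC r)%:P) in
  complex.Im z != 0 -> P.[z] != 0 /\
   exists2 t : R, (0 <= t) && ((s != [::]) ==> (0 < t)) &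
     complex.Im (P^`().[z] / P.[z]) = - complex.Im z * t.
Proof.
move=> P z0; rewrite {}/P; elim: s => [|r s [Pz [t tge IH]]].
  rewrite !big_nil derivC horner0 hornerC mul0r oner_neq0; split => //.
  by exists 0; rewrite ?lexx // mulr0.
rewrite !big_cons derivM derivXsubC mul1r !(hornerM, hornerXsubC, hornerD).
have zr : z - toC r != 0.
  by apply: contra z0; rewrite subr_eq0 => /eqP ->.
split; first by rewrite mulf_neq0.
have nr : 0 < (complex.Re z - r)^+2 + complex.Im z^+2.
  by apply: ltr_wpDl; rewrite ?sqr_ge0 // lt_neqAle sqr_ge0 eq_sym expf_neq0.
exists (((complex.Re z - r)^+2 + complex.Im z^+2)^-1 + t).
  have ir : 0 < ((complex.Re z - r)^+2 + complex.Im z^+2)^-1 by rewrite invr_gt0.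
  case/andP: tge => t0 _; apply/andP; split; first by rewrite addr_ge0 // ltW.
  by rewrite /= ltr_wpDr.
set a := (\prod_(j <- s) _).[z] in Pz IH *; set d := _^`().[z] in IH *.
have -> : (a + (z - toC r) * d) / ((z - toC r) * a) = (z - toC r)^-1 + d / a.
  by field; rewrite Pz zr.
rewrite raddfD /= IH mulrDr; congr (_ + _).
case: z {IH a d Pz} z0 zr nr => x y /= z0 zr nr.
rewrite subr0; field; exact: lt0r_neq0.
Qed.

Lemma deriv_real_rooted p : real_rooted p -> real_rooted p^`().
Proof.
move=> [c [s ->]]; have [->|c0] := eqVneq c 0.
  by exists 0, [::]; rewrite !scale0r deriv0.
case: s => [|r0 s0].
  by exists 0, [::]; rewrite big_nil scale0r alg_polyC derivC.
set s := r0 :: s0.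
rewrite derivZ; set P := \prod_(r <- s) _.
have [rs Ers] := closed_field_poly_normal (map_poly toC P^`()).
have lc : lead_coef (map_poly toC P^`()) = toC (lead_coef P^`()) by rewrite lead_coef_map.
have lc0 : lead_coef P^`() != 0.
  rewrite lead_coef_eq0 -size_poly_eq0.
  have sP : size P = (size s0).+2 by rewrite size_prod_XsubC.
  have : P^`()`_(size s0) != 0.
    rewrite coef_deriv -[(size s0).+1]/((size s0).+2.-1) -sP -/(lead_coef P).
    by rewrite lead_coef_prod_XsubC sP pnatr_eq0.
  by apply: contra; rewrite size_poly_eq0 => /eqP ->; rewrite coef0.
have rsR z : z \in rs -> complex.Im z = 0.
  move=> zrs; apply/eqP; apply: contraT => z0.
  have [Pz [t tge]] := Im_logderiv s z0.
  have EP : \prod_(r <- s) ('X - (toC r)%:P) = map_poly toC P.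
    by rewrite map_prod_XsubC.
  rewrite EP in Pz *; rewrite deriv_map.
  have : root (map_poly toC P^`()) z.
    by rewrite Ers rootZ ?root_prod_XsubC// lc fmorph_eq0.
  move=> /rootP ->; rewrite mul0r => /esym/eqP; rewrite mulf_eq0 oppr_eq0 (negPf z0) /=.
  by case/andP: tge => _ /= /lt0r_neq0/negPf ->.
exists (c * lead_coef P^`()), (map (@complex.Re R) rs).
rewrite -scalerA; congr (_ *: _); apply: (map_poly_inj toC).
rewrite map_polyZ /= map_prod_XsubC big_map {1}Ers lc; congr (_ *: _).
apply: eq_big_seq => z zrs; congr ('X - _%:P).
by case: z zrs (rsR z) => x y /= zrs /(_ zrs) ->.
Qed.

Lemma derivn_real_rooted p m : real_rooted p -> real_rooted p^`(m).
Proof.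
by move=> rp; elim: m => [|m IH]; rewrite ?derivn0 // derivnS; exact: deriv_real_rooted.
Qed.

Lemma laguerre p (x : R) : real_rooted p ->
  p.[x] * p^`(2).[x] <= p^`().[x] ^+ 2.
Proof.
move=> [c [s ->]]; rewrite derivnS derivn1 !derivZ !hornerZ.
suff : (\prod_(r <- s) ('X - r%:P)).[x] * (\prod_(r <- s) ('X - r%:P))^`()^`().[x] <= (\prod_(r <- s) ('X - r%:P))^`().[x] ^+ 2.
  move=> h; have := ler_wpM2l (sqr_ge0 c) h.
  set a := (_.[x]); set b := (_.[x]); set d := (_.[x]); nra.
elim: s => [|r s IH]; first by rewrite !big_nil !derivC !horner0 mulr0 expr0n.
rewrite big_cons !derivM derivXsubC derivD mul1r derivM derivXsubC mul1r.
rewrite !(hornerM, hornerXsubC, hornerD).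
set a := (\prod_(j <- s) _).[x] in IH *.
set b := (\prod_(j <- s) _)^`().[x] in IH *.
set d := (\prod_(j <- s) _)^`()^`().[x] in IH *.
have := ler_wpM2l (sqr_ge0 (x - r)) IH; have := sqr_ge0 a; nra.
Qed.

(** Laguerre inequality at [0] for the derivative of order [m]. *)
Lemma newton_real_rooted p m : real_rooted p ->
  m.+2%:R * (p`_m * p`_m.+2) <= m.+1%:R * p`_m.+1 ^+ 2.
Proof.
move=> rp; have := laguerre 0 (derivn_real_rooted m rp).
rewrite 2!derivnS derivn0 -!derivnS !horner_coef0 !coef_derivn !addn0 !ffactnn.
rewrite !factS -(mulr_natr p`_m) -(mulr_natr p`_m.+1) -(mulr_natr p`_m.+2) !natrM.
have f0 : (0:R) < m`!%:R by rewrite ltr0n fact_gt0.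
move: (p`_m) (p`_m.+1) (p`_m.+2) (m`!%:R) f0 => a b d f f0.
have m0 : (0 : R) < m.+1%:R by [].
move: (m.+1%:R) (m.+2%:R) m0 => m1 m2 m0 h.
rewrite -subr_ge0 -(pmulr_rge0 _ (mulr_gt0 (exprn_gt0 2 f0) m0)).
by rewrite -subr_ge0 in h; apply: le_trans h _; rewrite le_eqVlt; apply/orP; left; apply/eqP; ring.
Qed.

End RealRooted.


(** * The Garding cone of a finite sequence *)

Section Garding.
Context {R : rcfType}.
Implicit Types (s : seq R).

Lemma real_rooted_mul (p q : {poly R}) :
  real_rooted p -> real_rooted q -> real_rooted (p * q).
Proof.
move=> [c [s ->]] [d [t ->]]; exists (c * d), (s ++ t).
by rewrite big_cat /= -scalerAl -scalerAr scalerA.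
Qed.

(** Generating polynomial of the elementary symmetric functions of [s]. *)
Definition esym_poly s : {poly R} := \prod_(r <- s) (1 + r *: 'X).

Lemma esym_poly_cons x s j : (esym_poly (x :: s))`_j.+1 =
  (esym_poly s)`_j.+1 + x * (esym_poly s)`_j.
Proof.
by rewrite /esym_poly big_cons mulrDl mul1r coefD -scalerAl coefZ coefXM.
Qed.

Lemma esym_poly0 s : (esym_poly s)`_0 = 1.
Proof.
rewrite /esym_poly -horner_coef0 horner_prod big1 // => r _.
by rewrite !hornerE ?mulr0 ?addr0.
Qed.

Lemma real_rooted_esym_poly s : real_rooted (esym_poly s).
Proof.
elim: s => [|x s IH].
  by exists 1, [::]; rewrite /esym_poly !big_nil scale1r.
rewrite /esym_poly big_cons; apply: real_rooted_mul => //.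
have [->|x0] := eqVneq x 0.
  by exists 1, [::]; rewrite big_nil scale0r addr0 scale1r.
exists x, [:: - x^-1]; rewrite big_seq1 polyCN opprK scalerDr addrC; congr (_ + _).
by rewrite -mul_polyC -polyCM divff.
Qed.

(** Arithmetic of the induction step below: [a], [b], [c] are consecutive
    elementary symmetric functions of the sequence without the entry [x]. *)
Lemma newton_gap (a b c x m : R) : 0 < m -> 0 < a ->
  (m + 1) * (a * c) <= m * b ^+ 2 -> 0 < b + x * a -> 0 < c + x * b -> 0 < b.
Proof.
move=> m0 a0 N h2 h1; rewrite ltNge; apply/negP => b0.
have xa : - b < x * a by lra.
have x0 : 0 < x by rewrite -(pmulr_lgt0 _ a0); lra.
have xb : x * b <= 0 by rewrite pmulr_rle0.
have c0 : - (x * b) < c by lra.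
have ac : a * - (x * b) < a * c by rewrite ltr_pM2l.
have bb : (- b) * (- b) <= (x * a) * (- b) by rewrite ler_wpM2r ?oppr_ge0 // ltW.
have acb : b ^+ 2 < a * c by nra.
have : m * b ^+ 2 < m * (a * c) by rewrite ltr_pM2l.
have : 0 <= b ^+ 2 by exact: sqr_ge0.
by move: (a * c) (b ^+ 2) acb N => u v *; nra.
Qed.

(** Removing one entry from a sequence of the k-th cone leaves a sequence of
    the (k-1)-st cone: the partial derivatives of the k-th elementary symmetric
    function are positive. *)
Lemma garding_cone_cons k x s :
  (forall j, (j <= k)%N -> 0 < (esym_poly (x :: s))`_j) ->
  forall j, (j < k)%N -> 0 < (esym_poly s)`_j.
Proof.
move=> H; elim=> [|j IH] jk; first by rewrite esym_poly0.
have {IH} := IH (ltnW jk).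
have := H j.+1 (ltnW jk); have := H j.+2 jk; rewrite !esym_poly_cons.
have := newton_real_rooted j (real_rooted_esym_poly s).
move: (_`_j) (_`_j.+1) (_`_j.+2) => a b c.
rewrite -[j.+2]addn1 natrD => N h1 h2 a0.
exact: (newton_gap (ltr0Sn R j) a0 N h2 h1).
Qed.

End Garding.


(** * Principal minors and rank-one perturbations *)

Section MatrixDeterminantLemma.

Lemma det_block_rank1 (K : comNzRingType) n (M : 'M[K]_n) (u : 'cV[K]_n) (v : 'rV[K]_n) :
  \det (M + u *m v) = \det (block_mx M (- u) v 1%:M).
Proof.
have -> : block_mx M (- u) v (1%:M : 'M[_]_1) =
    block_mx 1%:M (- u) 0 1%:M *m block_mx (M + u *m v) 0 v 1%:M.
  rewrite mulmx_block !mul1mx !mul0mx !mulmx1 !add0r.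
  by rewrite mulNmx addrK.
by rewrite det_mulmx det_ublock det_lblock !det1 !mul1r mulr1.
Qed.

Lemma det_diag_rank1_field (K : fieldType) n (d : 'rV[K]_n) (u : 'cV[K]_n) (v : 'rV[K]_n) :
  (forall i, d 0 i != 0) ->
  \det (diag_mx d + u *m v) =
  \prod_i d 0 i + \sum_i u i 0 * v 0 i * \prod_(j | j != i) d 0 j.
Proof.
move=> d0.
pose e : 'rV[K]_n := \row_i (d 0 i)^-1.
have de : diag_mx d *m diag_mx e = 1%:M.
  rewrite -diag_const_mx mulmx_diag; congr diag_mx.
  by apply/rowP => i; rewrite !mxE divff.
have -> : diag_mx d + u *m v = diag_mx d *m (1%:M + (diag_mx e *m u) *m v).
  by rewrite mulmxDr mulmx1 !mulmxA de mul1mx.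
rewrite det_mulmx det_diag det_block_rank1.
set w := diag_mx e *m u.
have -> : block_mx (1%:M : 'M[K]_n) (- w) v (1%:M : 'M[_]_1) =
    block_mx 1%:M 0 v 1%:M *m block_mx 1%:M (- w) 0 (1%:M + v *m w).
  rewrite mulmx_block !mul1mx ?mul0mx ?mulmx1 ?mulmx0 ?addr0.
  by rewrite mulmxN addrCA addNr addr0.
rewrite det_mulmx det_ublock det_lblock !det1 !mul1r det_mx11 !mxE eqxx mulrDr mulr1.
congr (_ + _); rewrite mulr_sumr; apply: eq_bigr => i _.
rewrite /w mul_diag_mx !mxE (bigD1 i) //=.
by move: (d0 i); move: (\prod_(_ < n | _) _) => D di; field.
Qed.

(** Transferred from the fraction field, since it is applied over polynomials. *)
Lemma det_diag_rank1 (K : idomainType) n (d : 'rV[K]_n) (u : 'cV[K]_n) (v : 'rV[K]_n) :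
  (forall i, d 0 i != 0) ->
  \det (diag_mx d + u *m v) =
  \prod_i d 0 i + \sum_i u i 0 * v 0 i * \prod_(j | j != i) d 0 j.
Proof.
move=> d0; apply/eqP; rewrite -tofrac_eq; apply/eqP.
rewrite -det_map_mx map_mxD map_diag_mx map_mxM det_diag_rank1_field; last first.
  by move=> i; rewrite mxE tofrac_eq0.
rewrite rmorphD rmorph_prod rmorph_sum; congr (_ + _).
  by apply: eq_bigr => i _; rewrite mxE.
apply: eq_bigr => i _; rewrite !rmorphM rmorph_prod !mxE; congr (_ * _).
by apply: eq_bigr => j _; rewrite mxE.
Qed.

End MatrixDeterminantLemma.

Section HermitianCone.
Context {R : rcfType}.
Local Notation C := R[i].
Local Notation toC := (real_complex R).
Local Open Scope sesquilinear_scope.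

(** Its coefficient of degree [i] is the sum of the principal minors of order
    [i] of [A], that is [S_i(A)]. *)
Definition minor_poly (K : comNzRingType) n (A : 'M[K]_n) : {poly K} :=
  \det (1%:M + 'X *: map_mx polyC A).

(** The polynomial [esym_poly] for a row vector. *)
Definition esym_row n (d : 'rV[R]_n) : {poly R} := \prod_j (1 + d 0 j *: 'X).

Lemma garding_cone_drop n (d : 'rV[R]_n) i k :
  (forall j, (j <= k)%N -> 0 < (esym_row d)`_j) ->
  forall j, (j < k)%N -> 0 < (\prod_(l | l != i) (1 + d 0 l *: 'X))`_j.
Proof.
move=> H j jk.
have -> : \prod_(l | l != i) (1 + d 0 l *: 'X) =
   esym_poly [seq d 0 l | l <- index_enum 'I_n & l != i].
  by rewrite /esym_poly big_map big_filter.
apply: (@garding_cone_cons _ k (d 0 i)) => // m mk.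
have := H m mk; rewrite /esym_row (bigD1 i) //=.
by rewrite /esym_poly big_cons big_map big_filter.
Qed.

Lemma minor_poly_conj (K : fieldType) n (P A : 'M[K]_n) : P \in unitmx ->
  minor_poly (invmx P *m A *m P) = minor_poly A.
Proof.
move=> uP; rewrite /minor_poly.
have mP : map_mx polyC (invmx P) *m map_mx polyC P = 1%:M.
  by rewrite -map_mxM mulVmx // map_mx1.
have -> : 1%:M + 'X *: map_mx polyC (invmx P *m A *m P) =
  map_mx polyC (invmx P) *m (1%:M + 'X *: map_mx polyC A) *m map_mx polyC P.
  by rewrite mulmxDr mulmxDl mulmx1 mP !map_mxM -scalemxAr -scalemxAl.
by rewrite !det_mulmx mulrAC -det_mulmx mP det1 mul1r.
Qed.

Lemma one_addX_neq0 (K : fieldType) (c : K) : 1 + c *: 'X != 0 :> {poly K}.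
Proof.
apply/eqP => /(congr1 (fun p : {poly K} => p`_0)) /eqP.
by rewrite coefD coef1 coefZ coefX mulr0 addr0 coef0 oner_eq0.
Qed.

Lemma minor_poly_diag_rank1 (K : fieldType) n (d : 'rV[K]_n) (u : 'cV[K]_n) (v : 'rV[K]_n) :
  minor_poly (diag_mx d + u *m v) =
  \prod_i (1 + d 0 i *: 'X) +
    'X * \sum_i (u i 0 * v 0 i) *: \prod_(j | j != i) (1 + d 0 j *: 'X).
Proof.
rewrite /minor_poly.
have -> : 1%:M + 'X *: map_mx polyC (diag_mx d + u *m v) =
   diag_mx (\row_i (1 + d 0 i *: 'X)) + ('X *: map_mx polyC u) *m map_mx polyC v.
  rewrite map_mxD map_mxM scalerDr addrA -scalemxAl; congr (_ + _).
  apply/matrixP => i j; rewrite !mxE.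
  case: (i == j); rewrite /= ?mulr1n ?mulr0n ?polyC0 ?mulr0 ?addr0 //.
  by rewrite mulrC mul_polyC.
rewrite det_diag_rank1; last by move=> i; rewrite mxE one_addX_neq0.
congr (_ + _); first by apply: eq_bigr => i _; rewrite mxE.
rewrite mulr_sumr; apply: eq_bigr => i _; rewrite !mxE -!mulrA; congr ('X * _).
rewrite mulrA -polyCM mul_polyC; congr (_ *: _).
by apply: eq_bigr => j _; rewrite mxE.
Qed.

Lemma minor_poly_diag (K : fieldType) n (d : 'rV[K]_n) :
  minor_poly (diag_mx d) = \prod_i (1 + d 0 i *: 'X).
Proof.
have := minor_poly_diag_rank1 d 0 0; rewrite mul0mx addr0 => ->.
by rewrite [X in 'X * X]big1 ?mulr0 ?addr0 // => i _; rewrite mxE mul0r scale0r.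
Qed.

Lemma minor_poly_similar_rank1 (K : fieldType) n (U : 'M[K]_n) (d : 'rV[K]_n)
    (u : 'cV[K]_n) (v : 'rV[K]_n) : U \in unitmx ->
  minor_poly (invmx U *m (diag_mx d + u *m v) *m U) =
  minor_poly (invmx U *m diag_mx d *m U) +
    'X * \sum_i (u i 0 * v 0 i) *: \prod_(j | j != i) (1 + d 0 j *: 'X).
Proof.
by move=> uU; rewrite !minor_poly_conj // minor_poly_diag_rank1 minor_poly_diag.
Qed.

Lemma similar_rank1 (K : fieldType) n (U D : 'M[K]_n) (p : 'cV[K]_n) (q : 'rV[K]_n) (c : K) :
  U \in unitmx ->
  invmx U *m D *m U + c *: (p *m q) =
  invmx U *m (D + (c *: (U *m p)) *m (q *m invmx U)) *m U.
Proof.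
move=> uU; rewrite mulmxDr mulmxDl; congr (_ + _).
rewrite -scalemxAl -scalemxAr -scalemxAl; congr (_ *: _).
by rewrite !mulmxA mulVmx // mul1mx -!mulmxA mulVmx // mulmx1.
Qed.

Lemma minor_poly_rank1 (K : fieldType) n (A U : 'M[K]_n) (d : 'rV[K]_n)
    (p : 'cV[K]_n) (q : 'rV[K]_n) (c : K) : U \in unitmx ->
  A = invmx U *m diag_mx d *m U ->
  minor_poly (A + c *: (p *m q)) = minor_poly A +
    'X * \sum_i (c * ((U *m p) i 0 * (q *m invmx U) 0 i)) *:
      \prod_(j | j != i) (1 + d 0 j *: 'X).
Proof.
move=> uU ->; rewrite similar_rank1 // minor_poly_similar_rank1 //.
by congr (_ + 'X * _); apply: eq_bigr => i _; rewrite !mxE mulrA.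
Qed.

(** The eigenvalues are given as a real row vector. *)
Lemma hermitian_diag n (A : 'M[C]_n) : A \is hermsymmx ->
  exists U (d : 'rV[R]_n), [/\ U \is unitarymx, U \in unitmx & A = invmx U *m diag_mx (map_mx toC d) *m U].
Proof.
move=> hA; have /hermitian_normalmx /orthomx_spectralP E := hA.
have rd := hermitian_spectral_diag_real hA.
exists (spectralmx A), (map_mx (@complex.Re R) (spectral_diag A)).
split; [exact: spectral_unitarymx|exact: spectral_unit|].
suff <- : spectral_diag A = map_mx toC (map_mx (@complex.Re R) (spectral_diag A)) by [].
apply/rowP => i; rewrite !mxE; have /mxOverP/(_ 0 i) := rd.
by case: (spectral_diag A 0 i) => x y; rewrite complex_real /= => /eqP ->.
Qed.

Lemma minor_poly_hermitian n (A U : 'M[C]_n) (d : 'rV[R]_n) : U \in unitmx ->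
  A = invmx U *m diag_mx (map_mx toC d) *m U ->
  minor_poly A = map_poly toC (esym_row d).
Proof.
move=> uU ->; rewrite minor_poly_conj // minor_poly_diag /esym_row rmorph_prod.
apply: eq_bigr => i _.
by rewrite rmorphD rmorph1 /= map_polyZ map_polyX mxE.
Qed.

Lemma hermsymmxE n (A : 'M[C]_n) : (A \is hermsymmx) <-> A^t* = A.
Proof.
split; first by move/is_hermitianmxP; rewrite expr0 scale1r => <-.
by move=> h; apply/is_hermitianmxP; rewrite expr0 scale1r h.
Qed.

(** Positive semidefinite complex matrices. *)
Definition psdmx n (P : 'M[C]_n) := forall x : 'cV[C]_n, 0 <= (x^t* *m P *m x) 0 0.

Lemma minor_poly_rank1_ge n (A : 'M[C]_n) (p : 'cV[C]_n) (c : C) k :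
  A \is hermsymmx -> 0 <= c ->
  (forall j, (j <= k)%N -> 0 < (minor_poly A)`_j) ->
  forall j, (j <= k)%N ->
    (minor_poly A)`_j <= (minor_poly (A + c *: (p *m p^t* )))`_j.
Proof.
move=> hA c0 H j jk.
have [U [d [unU uU E]]] := hermitian_diag hA.
have EA := minor_poly_hermitian uU E.
have Hd m : (m <= k)%N -> 0 < (esym_row d)`_m.
  by move=> /H; rewrite EA coef_map /= (ltcR 0).
have := @minor_poly_rank1 C n A U _ p (p^t* ) c uU E.
have -> : p^t* *m invmx U = (U *m p)^t*.
  by rewrite trmx_mul map_mxM (invmx_unitary unU).
move: (U *m p) => q ->.
rewrite coefD lerDl coefXM; case: j jk => [//|j] jk /=.
rewrite coef_sum; apply: sumr_ge0 => i _; rewrite coefZ; apply: mulr_ge0.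
  by apply: mulr_ge0 => //; rewrite !mxE; exact: mul_conjC_ge0.
have -> : \prod_(l | l != i) (1 + (map_mx toC d) 0 l *: 'X) =
   map_poly toC (\prod_(l | l != i) (1 + d 0 l *: 'X)).
  rewrite rmorph_prod; apply: eq_bigr => l _.
  by rewrite rmorphD rmorph1 /= map_polyZ map_polyX mxE.
rewrite coef_map /= (lecR 0); apply: ltW.
exact: (@garding_cone_drop _ _ _ k).
Qed.

(** [S_k] is monotone on the k-th Garding cone: a positive semidefinite matrix
    is a sum of rank-one ones, and adding these one at a time stays in the cone. *)
Lemma minor_poly_psd_ge n (A P : 'M[C]_n) k :
  A \is hermsymmx -> P \is hermsymmx -> psdmx P ->
  (forall j, (j <= k)%N -> 0 < (minor_poly A)`_j) ->
  (minor_poly A)`_k <= (minor_poly (A + P))`_k.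
Proof.
move=> hA hP psdP HA.
have [U [d [unU uU E]]] := hermitian_diag hP.
pose p i : 'cV[C]_n := col i (U^t* ).
have EP : P = \sum_i toC (d 0 i) *: (p i *m (p i)^t* ).
  rewrite E (invmx_unitary unU); apply/matrixP => a b.
  rewrite summxE !mxE; apply: eq_bigr => i _.
  rewrite mul_mx_diag !mxE big_ord1 !mxE conjCK.
  by rewrite mulrAC mulrC.
have d0 i : 0 <= toC (d 0 i).
  have := psdP (p i); rewrite E.
  have Up : U *m p i = delta_mx i 0.
    by rewrite /p colE mulmxA -(invmx_unitary unU) mulmxV // mul1mx.
  rewrite -!mulmxA Up !mulmxA.
  have -> : (p i)^t* *m invmx U = delta_mx 0 i.
    have := congr1 (fun M : 'cV_n => M^t* ) Up.
    by rewrite trmx_mul map_mxM -(invmx_unitary unU) trmx_delta map_delta_mx.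
  by rewrite -rowE -colE !mxE eqxx mulr1n.
rewrite EP.
suff : A + \sum_i toC (d 0 i) *: (p i *m (p i)^t* ) \is hermsymmx /\
    forall j, (j <= k)%N -> (minor_poly A)`_j <=
      (minor_poly (A + \sum_i toC (d 0 i) *: (p i *m (p i)^t* )))`_j.
  by case=> _ /(_ k (leqnn k)).
elim: (index_enum _) => [|i r [hS IH]].
  by rewrite big_nil addr0; split.
rewrite big_cons addrCA addrC.
move: (A + \sum_(i <- r) _) hS IH => B hB IH.
have HB m (mk : (m <= k)%N) := lt_le_trans (HA m mk) (IH m mk).
split; last first.
  move=> j jk; apply: le_trans (IH j jk) _.
  exact: (@minor_poly_rank1_ge n B (p i) (toC (d 0 i)) k hB (d0 i) HB j jk).
apply/hermsymmxE; move/hermsymmxE: hB => hB.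
rewrite linearD /= map_mxD hB; congr (_ + _).
rewrite linearZ /= map_mxZ trmx_mul map_mxM trmxCK; congr (_ *: _).
by apply/CrealP/complex_realP; exists (d 0 i).
Qed.

End HermitianCone.


(** * Elementary symmetric functions of real symmetric matrices *)

Section RealSymmetric.
Context {R : realType}.
Local Notation toC := (real_complex R).
Local Open Scope sesquilinear_scope.

Lemma coef_esym_row n (d : 'rV[R]_n) i : (esym_row d)`_i = elem_sym i d.
Proof.
rewrite /esym_row /elem_sym.
under eq_bigr do rewrite addrC.
rewrite bigA_distr coef_sum [RHS]big_mkcond; apply: eq_bigr => J _.
rewrite -big_mkcond /=.
have -> : \prod_(j in J) (d 0 j *: 'X) = (\prod_(j in J) d 0 j) *: 'X^#|J| :> {poly R}.
  by rewrite scaler_prod prodr_const.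
by rewrite coefZ coefXn eq_sym; case: eqP; rewrite ?mulr1 ?mulr0.
Qed.

Lemma size_esym_poly (s : seq R) : (size (esym_poly s) <= (size s).+1)%N.
Proof.
elim: s => [|y t IHt]; first by rewrite /esym_poly big_nil size_poly1.
rewrite /esym_poly big_cons mulrDl mul1r -scalerAl.
apply: leq_trans (size_polyD _ _) _; rewrite geq_max (leq_trans IHt) //=.
apply: leq_trans (size_scale_leq _ _) _.
by apply: leq_trans (size_polyMleq _ _) _; rewrite size_polyX.
Qed.

(** Each elementary symmetric function of [s + e] expands in those of [s] with
    nonnegative coefficients, when [e >= 0]. *)
Lemma esym_poly_shift (s : seq R) e i :
  (esym_poly [seq x + e | x <- s])`_i =
  \sum_(j < i.+1) 'C(size s - j, i - j)%:R * e ^+ (i - j) * (esym_poly s)`_j.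
Proof.
elim: s i => [|x s IH] i.
  rewrite big_ord_recl big1 ?addr0; last first.
    by move=> j _; rewrite /esym_poly !big_nil coef1 mulr0.
  rewrite /= /esym_poly !big_nil !subn0 !coef1; case: i => [|i].
    by rewrite bin0 expr0 !mulr1.
  by rewrite bin_small ?mul0r.
case: i => [|i] /=.
  by rewrite big_ord1 /= !esym_poly0 !subn0 bin0 expr0 !mulr1.
rewrite esym_poly_cons !IH mulr_sumr.
rewrite [RHS]big_ord_recl /= esym_poly0 mulr1 !subn0.
under [in RHS]eq_bigr do rewrite /bump add1n esym_poly_cons !subSS mulrDr.
rewrite big_split /= addrA.
have <- : \sum_(j < i.+2) 'C((size s).+1 - j, i.+1 - j)%:R * e ^+ (i.+1 - j) * (esym_poly s)`_j =
   'C((size s).+1, i.+1)%:R * e ^+ i.+1 +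
    \sum_(j < i.+1) 'C(size s - j, i - j)%:R * e ^+ (i - j) * (esym_poly s)`_j.+1.
  by rewrite big_ord_recl /= esym_poly0 mulr1 !subn0.
rewrite big_ord_recr [in RHS]big_ord_recr /= !subnn !bin0 !expr0 !mulr1 !mul1r.
rewrite [RHS]addrAC [LHS]addrAC; congr (_ + _); rewrite -!big_split /=.
apply: eq_bigr => j _; have jle : (j <= i)%N by rewrite -ltnS.
have [js|sj] := leqP j (size s); last first.
  rewrite [(esym_poly s)`_j]nth_default ?(leq_trans (size_esym_poly s)) //.
  by rewrite !mulr0 addr0.
rewrite !subSn // binS natrD exprS; ring.
Qed.

Lemma esym_row_shift n (d : 'rV[R]_n) e i :
  (esym_row (d + const_mx e))`_i =
  \sum_(j < i.+1) 'C(n - j, i - j)%:R * e ^+ (i - j) * (esym_row d)`_j.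
Proof.
have E (f : 'rV[R]_n) : esym_row f = esym_poly [seq f 0 j | j <- index_enum 'I_n].
  by rewrite /esym_poly big_map.
have -> : esym_row (d + const_mx e) = esym_poly [seq x + e | x <- [seq d 0 j | j <- index_enum 'I_n]].
  by rewrite -map_comp E; congr esym_poly; apply: eq_map => j; rewrite /= !mxE.
rewrite E; set s := map _ (index_enum _).
have -> : n = size s by rewrite size_map /index_enum -enumT size_enum_ord.
exact: esym_poly_shift.
Qed.

Lemma char_poly_similar (K : fieldType) n (U A : 'M[K]_n) : U \in unitmx ->
  char_poly (invmx U *m A *m U) = char_poly A.
Proof.
move=> uU; rewrite /char_poly /char_poly_mx.
have mU : map_mx polyC (invmx U) *m map_mx polyC U = 1%:M.
  by rewrite -map_mxM mulVmx // map_mx1.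
have -> : 'X%:M - map_mx polyC (invmx U *m A *m U) =
  map_mx polyC (invmx U) *m ('X%:M - map_mx polyC A) *m map_mx polyC U.
  rewrite mulmxBr mulmxBl !map_mxM; congr (_ - _).
  by rewrite scalar_mxC -mulmxA mU mulmx1.
by rewrite !det_mulmx mulrAC -det_mulmx mU det1 mul1r.
Qed.

Lemma char_poly_diag (K : fieldType) n (d : 'rV[K]_n) :
  char_poly (diag_mx d) = \prod_i ('X - (d 0 i)%:P).
Proof.
rewrite char_poly_trig ?diag_mx_is_trig //.
by apply: eq_bigr => i _; rewrite mxE eqxx.
Qed.

Lemma real_symmetric_herm n (A : 'M[R]_n) : A^T = A -> map_mx toC A \is hermsymmx.
Proof.
move=> sA; apply/hermsymmxE; rewrite map_trmx sA -map_mx_comp.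
apply: eq_map_mx => x; rewrite /=; apply/CrealP/complex_realP; by exists x.
Qed.

Lemma map_minor_poly n (A : 'M[R]_n) :
  minor_poly (map_mx toC A) = map_poly toC (minor_poly A).
Proof.
rewrite /minor_poly -det_map_mx; congr (\det _); apply/matrixP => i j.
by rewrite !mxE rmorphD rmorphM /= map_polyX map_polyC rmorph_nat.
Qed.

Lemma conj_diagD (K : fieldType) n (U : 'M[K]_n) (a b : 'rV[K]_n) :
  invmx U *m diag_mx a *m U + invmx U *m diag_mx b *m U =
  invmx U *m diag_mx (a + b) *m U.
Proof. by rewrite -mulmxDl -mulmxDr -linearD. Qed.

Lemma real_symmetric_spectral n (A : 'M[R]_n) : A^T = A ->
  exists d : 'rV[R]_n, char_poly A = \prod_j ('X - (d 0 j)%:P) /\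
    forall e, minor_poly (A + e%:M) = esym_row (d + const_mx e).
Proof.
move=> /real_symmetric_herm/hermitian_diag[U [d [_ uU E]]]; exists d; split.
  apply: (map_poly_inj toC); rewrite map_char_poly E char_poly_similar // char_poly_diag.
  rewrite map_prod_XsubC; apply: eq_bigr => i _; by rewrite mxE.
move=> e; apply: (map_poly_inj toC); rewrite -map_minor_poly map_mxD E.
have -> : map_mx toC e%:M = invmx U *m diag_mx (map_mx toC (const_mx e)) *m U.
  have -> : map_mx toC (const_mx e) = const_mx (toC e) by move=> ? ?; apply/matrixP => i j; rewrite !mxE.
  by rewrite diag_const_mx map_scalar_mx scalar_mxC -mulmxA mulVmx // mulmx1.
apply: (@minor_poly_hermitian R n _ U (d + const_mx e) uU).
rewrite map_mxD.
have H := @conj_diagD R[i] n U (map_mx toC d) (map_mx toC (const_mx e)).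
exact: H.
Qed.

Lemma esym_poly_perm (s t : seq R) : perm_eq s t -> esym_poly s = esym_poly t.
Proof. by move=> st; rewrite /esym_poly (perm_big _ st). Qed.

Lemma eigenvalues_symmetric n (A : 'M[R]_n) i : A^T = A ->
  elem_sym i (eigenvalues A) = (minor_poly A)`_i.
Proof.
move=> /real_symmetric_spectral[d [cA mA]].
have := mA 0; rewrite raddf0 addr0 => ->.
have -> : d + const_mx 0 = d by apply/rowP => j; rewrite !mxE addr0.
rewrite /eigenvalues; case: xgetP => [s _ /= cs|/(_ d)/=]; last by move=> /(_ cA).
rewrite -!coef_esym_row; suff -> : esym_row s = esym_row d by [].
have : perm_eq [seq s 0 j | j <- index_enum 'I_n] [seq d 0 j | j <- index_enum 'I_n].
  by apply: prod_XsubC_eq; rewrite !big_map -cs -cA.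
have E (f : 'rV[R]_n) : esym_row f = esym_poly [seq f 0 j | j <- index_enum 'I_n].
  by rewrite /esym_poly big_map.
by rewrite (E s) (E d); exact: esym_poly_perm.
Qed.

(** Shifting by a positive multiple of the identity moves the closed cone into
    the open one and strictly increases the [S_j]. *)
Lemma symmetric_shift_gt n (A : 'M[R]_n) k e : A^T = A -> 0 < e -> (k <= n)%N ->
  (forall j, (1 <= j <= k)%N -> 0 <= (minor_poly A)`_j) ->
  forall j, (j <= k)%N ->
   [/\ 0 < (minor_poly (A + e%:M))`_j & (0 < j)%N ->
   (minor_poly A)`_j < (minor_poly (A + e%:M))`_j].
Proof.
move=> /real_symmetric_spectral[d [_ mA]] e0 kn H j jk.
have mA0 : minor_poly A = esym_row d.
  have := mA 0; rewrite raddf0 addr0 => ->; congr esym_row.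
  by apply/rowP => l; rewrite !mxE addr0.
have A0 : (esym_row d)`_0 = 1.
  by have := esym_poly0 [seq d 0 l | l <- index_enum 'I_n]; rewrite /esym_poly big_map.
rewrite mA esym_row_shift big_ord_recl /= A0 subn0 mulr1.
have c0 : 0 < 'C(n - 0, j)%:R * e ^+ j.
  by rewrite mulr_gt0 ?exprn_gt0 // ltr0n bin_gt0 subn0 (leq_trans jk).
have ge0 m : (m <= k)%N -> 0 <= (esym_row d)`_m.
  by case: m => [|m] mk; [rewrite A0|rewrite -mA0 H].
have t0 (m : 'I_j) : 0 <= 'C(n - bump 0 m, j - bump 0 m)%:R * e ^+ (j - bump 0 m) * (esym_row d)`_(bump 0 m).
  apply: mulr_ge0; first by rewrite mulr_ge0 ?exprn_ge0 ?ler0n // ltW.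
  apply: ge0.
  by rewrite /bump add1n (leq_trans (ltn_ord m)).
rewrite !subn0 in c0 *.
split; first by apply: ltr_wpDr => //; exact: sumr_ge0.
case: j jk c0 t0 => // j jk c0 t0 _.
rewrite big_ord_recr /= {3 4 5}/bump add1n subnn bin0 expr0 !mul1r mA0 addrA ltrDr.
apply: ltr_wpDr => //; apply: sumr_ge0 => m _; exact: (t0 (widen_ord (leqnSn j) m)).
Qed.

(** For a real symmetric form, the value at [Y + iZ] splits: this reduces the
    complex notion of semidefiniteness to the real one. *)
Lemma quad_form_complex (K : comNzRingType) (j : K) n (P : 'M[K]_n) (Y Z : 'cV[K]_n) :
  j * j = -1 -> P^T = P ->
  (Y^T - j *: Z^T) *m P *m (Y + j *: Z) = Y^T *m P *m Y + Z^T *m P *m Z.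
Proof.
move=> jj sP; rewrite mulmxDr !mulmxBl -!scalemxAl -!scalemxAr.
have -> : Z^T *m P *m Y = Y^T *m P *m Z.
  have tr1 (M : 'M[K]_1) : M^T = M by apply/matrixP => a b; rewrite mxE !ord1.
  by rewrite -[LHS]tr1 !trmx_mul trmxK sP mulmxA.
by rewrite scalerA jj scaleN1r opprK addrA subrK.
Qed.

Lemma symmetric_psd_ge n (A P : 'M[R]_n) k : A^T = A -> P^T = P ->
  (forall y : 'cV[R]_n, 0 <= (y^T *m P *m y) 0 0) ->
  (forall j, (j <= k)%N -> 0 < (minor_poly A)`_j) ->
  (minor_poly A)`_k <= (minor_poly (A + P))`_k.
Proof.
move=> sA sP pP HA.
rewrite -(lecR _ (_`_k)) -!coef_map /= -!map_minor_poly map_mxD.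
apply: minor_poly_psd_ge; [exact: real_symmetric_herm|exact: real_symmetric_herm| |].
  move=> x.
  have [y [z [xE xtE]]] : exists y z : 'cV[R]_n, x = map_mx toC y + 'i%C *: map_mx toC z /\
      x^t* = (map_mx toC y)^T - 'i%C *: (map_mx toC z)^T.
    exists (map_mx (@complex.Re R) x), (map_mx (@complex.Im R) x); split.
      by apply/matrixP => i j; rewrite !mxE [LHS]complexE.
    apply/matrixP => i j; rewrite !mxE; case: (x j i) => a b.
    have -> : Num.conj (a +i* b)%C = (a -i* b)%C by [].
    by rewrite /=; simpc.
  have -> : (x^t* *m map_mx toC P *m x) 0 0 = toC ((y^T *m P *m y) 0 0 + (z^T *m P *m z) 0 0).
    have jj : 'i%C * 'i%C = -1 :> R[i] by rewrite -expr2 sqr_i.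
    have sPC : (map_mx toC P)^T = map_mx toC P by rewrite map_trmx sP.
    have H := @quad_form_complex R[i] 'i%C n (map_mx toC P) (map_mx toC y) (map_mx toC z) jj sPC.
    rewrite xtE xE H rmorphD mxE; congr (_ + _).
      by rewrite map_trmx -!map_mxM mxE.
    by rewrite map_trmx -!map_mxM mxE.
  by rewrite (lecR 0) addr_ge0.
by move=> j jk; rewrite map_minor_poly coef_map /= (ltcR 0) HA.
Qed.

End RealSymmetric.


(** * One-variable calculus *)

Section OneVariable.
Context {R : realType}.

Lemma eq_imply_le (a b : R) : a = b -> a <= b.
Proof. by move=> ->. Qed.

Lemma MVT_point (f df : R -> R) (a b : R) : a < b ->
  (forall x : R, a <= x <= b -> is_derive x 1 f (df x)) ->
  exists c, [/\ a < c, c < b & f b - f a = df c * (b - a)].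
Proof.
move=> ab H.
have [c] : exists2 c, c \in `]a, b[%R & f b - f a = df c * (b - a).
  apply: MVT => //.
    by move=> x /itvP xab; apply: H; rewrite !xab.
  apply: derivable_within_continuous => x /itvP xab.
  by have [] := H x _; rewrite ?xab.
by move=> /itvP cab ->; exists c; rewrite !cab.
Qed.

(** Mean value theorem on the segment between [0] and [h], for either sign of
    [h]. *)
Lemma MVT_abs (f df : R -> R) (h : R) :
  (forall x : R, `|x| <= `|h| -> is_derive x 1 f (df x)) ->
  exists c, `|c| <= `|h| /\ f h - f 0 = df c * h.
Proof.
move=> H; have [h0|h0|<-] := ltgtP 0 h.
- have [|c [c0 ch E]] := @MVT_point f df 0 h h0.
    by move=> x /andP[x0 xh]; apply: H; rewrite !ger0_norm // (le_trans x0).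
  by exists c; rewrite E subr0 !gtr0_norm // ltW.
- have [|c [c0 ch E]] := @MVT_point f df h 0 h0.
    by move=> x /andP[x0 xh]; apply: H; rewrite !ler0_norm ?lerN2 // (le_trans _ xh).
  exists c; rewrite !ltr0_norm // lerN2 ltW //; split => //.
  by rewrite -opprB E sub0r mulrN opprK.
- by exists 0; rewrite normr0 lexx subrr mulr0.
Qed.

(** Differentiability along [v] in epsilon-delta form, the quotient being
    cleared; [is_derive_epsP] is the converse. *)
Lemma is_derive_eps (V : normedModType R) (f : V -> R) (x v : V) (d : R) :
  (forall e : R, 0 < e -> exists2 de : R, 0 < de & forall h : R, `|h| < de ->
     `|f (x + h *: v) - f x - d * h| <= e * `|h|) -> is_derive x v f d.
Proof.
move=> H.
have C : h^-1 *: ((f \o shift x) (h *: v) - f x) @[h --> 0^'] --> (d : R).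
  apply/cvgrPdist_le => e e0; have [de de0 Hd] := H e e0.
  near=> h.
  have h0 : h != 0 by near: h; exact: nbhs_dnbhs_neq.
  have hd : `|h| < de.
    near: h; apply: dnbhs0_lt => //.
  have := Hd h hd; rewrite /= [x + _]addrC => h1.
  rewrite -(ler_pM2r (_ : 0 < `|h|)) ?normr_gt0 //; apply: le_trans h1.
  rewrite -normrM -normrN; apply: eq_imply_le; congr `|_|; rewrite /GRing.scale /=.
  by field.
by split; [apply/cvg_ex; exists d|exact/cvg_lim].
Unshelve. all: by end_near. Qed.

Lemma is_derive_epsP (V : normedModType R) (f : V -> R) (x v : V) (d : R) :
  is_derive x v f d ->
  (forall e : R, 0 < e -> exists2 de : R, 0 < de & forall h : R, `|h| < de ->
     `|f (x + h *: v) - f x - d * h| <= e * `|h|).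
Proof.
move=> [df E] e e0.
have C : h^-1 *: ((f \o shift x) (h *: v) - f x) @[h --> 0^'] --> (d : R).
  by rewrite -E; exact: df.
move/cvgrPdist_le : C => /(_ e e0) [de /= de0 Hd]; exists de => // h hd.
have [->|h0] := eqVneq h 0; first by rewrite scale0r addr0 subrr mulr0 subrr !normr0 mulr0.
have := Hd h; rewrite /= sub0r normrN [_ + x]addrC => /(_ hd h0) h1.
have {}h1 := ler_wpM2r (normr_ge0 h) h1; apply: le_trans h1.
rewrite -normrM -normrN; apply: eq_imply_le; congr `|_|; rewrite /GRing.scale /=.
by field.
Qed.

Lemma is_derive_line (V : normedModType R) (f : V -> R) (x v : V) (s d : R) :
  is_derive (x + s *: v) v f d -> is_derive s 1 (fun t => f (x + t *: v)) d.
Proof.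
move=> /is_derive_epsP H; apply: is_derive_eps => e e0.
have [de de0 Hd] := H e e0; exists de => // h hd.
by have := Hd h hd; rewrite [_%:A]mulr1 scalerDl addrA.
Qed.

End OneVariable.


(** * Second derivatives in several variables *)

Lemma continuous_eps {R : realType} {V : normedModType R} (f : V -> R) (x : V) (e : R) :
  {for x, continuous f} -> 0 < e ->
  exists2 d : R, 0 < d & forall y, `|y - x| < d -> `|f y - f x| <= e.
Proof.
move=> /cvgrPdist_le cf e0; have /nbhs_ballP[d /= d0 K] := cf _ e0.
by exists d => // y yd; rewrite distrC; apply: K; rewrite -ball_normE /= distrC.
Qed.

Lemma second_derivative_at_max {R : realType} (f f1 : R -> R) (d de : R) :
  0 < de -> (forall s : R, `|s| < de -> is_derive s 1 f (f1 s)) ->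
  is_derive (0 : R) 1 f1 d -> (forall s : R, `|s| < de -> f s <= f 0) -> d <= 0.
Proof.
move=> de0 Hf Hf1 Hmax.
have f10 : f1 0 = 0.
  apply/eqP; apply: contraT => n0.
  have e0 : 0 < `|f1 0| / 2 by rewrite divr_gt0 ?normr_gt0.
  have H0 : is_derive (0 : R) 1 f (f1 0) by apply: Hf; rewrite normr0.
  have [d1 d10 H1] := is_derive_epsP H0 e0.
  pose s := Num.sg (f1 0) * (Num.min d1 de / 2).
  have m0 : 0 < Num.min d1 de / 2 by rewrite divr_gt0 // lt_min d10.
  have ns : `|s| = Num.min d1 de / 2 by rewrite normrM normr_sg n0 mul1r gtr0_norm.
  have mlt : Num.min d1 de / 2 < Num.min d1 de by rewrite ltr_pdivrMr // ltr_pMr ?ltr1n // lt_min d10.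
  have sd1 : `|s| < d1 by rewrite ns (lt_le_trans mlt) // ge_min lexx.
  have sde : `|s| < de by rewrite ns (lt_le_trans mlt) // ge_min lexx orbT.
  have := H1 s sd1; rewrite add0r [_%:A]mulr1 ler_norml => /andP[+ _].
  have := Hmax s sde.
  have -> : f1 0 * s = `|f1 0| * `|s| by rewrite ns normrEsg /s; ring.
  have p0 : 0 < `|f1 0| * `|s| by rewrite mulr_gt0 ?normr_gt0 // -normr_gt0 ns.
  rewrite mulrAC; move: (`|f1 0| * `|s|) p0 => p; move: (f s) (f 0) => a b; lra.
rewrite leNgt; apply/negP => d0.
have [d1 d10 H1] := is_derive_epsP Hf1 (divr_gt0 d0 (ltr0Sn R 1)).
pose m := Num.min d1 de / 2.
have m0 : 0 < m by rewrite divr_gt0 // lt_min d10.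
have mlt : m < Num.min d1 de by rewrite ltr_pdivrMr // ltr_pMr ?ltr1n // lt_min d10.
have [|c [c0 cm E]] := @MVT_point R f f1 0 m m0.
  move=> x /andP[x0 xm]; apply: Hf; rewrite ger0_norm // (le_lt_trans xm) // (lt_le_trans mlt) //.
  by rewrite ge_min lexx orbT.
have := Hmax m; rewrite gtr0_norm // (lt_le_trans mlt) ?ge_min ?lexx ?orbT // => /(_ isT).
apply/negP; rewrite -ltNge -subr_gt0 E subr0 mulr_gt0 //.
have := H1 c; rewrite gtr0_norm // (lt_trans cm) ?(lt_le_trans mlt) ?ge_min ?lexx // => /(_ isT).
rewrite f10 add0r [_%:A]mulr1 subr0 ler_norml => /andP[+ _].
have : 0 < d * c by rewrite mulr_gt0.
rewrite mulrAC; move: (d * c) (f1 c) => a b; lra.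
Qed.

Section DoubleDifference.
Context {R : realType} {V : normedModType R}.

(** The second difference along [u] and [w] is a mixed second derivative at a
    nearby point: two mean value theorems. *)
Lemma double_difference (f : V -> R) (x u w : V) (de h : R) :
  (forall y, `|y - x| < de -> derivable f y u) ->
  (forall y, `|y - x| < de -> derivable ('D_u f) y w) ->
  `|h| * (`|u| + `|w|) < de ->
  exists y, `|y - x| <= `|h| * (`|u| + `|w|) /\
    f (x + h *: u + h *: w) - f (x + h *: u) - f (x + h *: w) + f x =
      h ^+ 2 * 'D_w ('D_u f) y.
Proof.
move=> H1 H2 hde.
pose phi s := f (x + h *: w + s *: u) - f (x + s *: u).
have bnd (a b : R) : `|a| <= `|h| -> `|b| <= `|h| ->
    `|x + b *: w + a *: u - x| <= `|h| * (`|u| + `|w|).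
  move=> ah bh.
  have -> : x + b *: w + a *: u - x = a *: u + b *: w.
    by rewrite -[x + _ + _]addrA [LHS]addrC addKr addrC.
  rewrite mulrDr (le_trans (ler_normD _ _)) // lerD // normrZ ler_wpM2r //.
have [s|c [ch Ec]] := @MVT_abs R phi (fun s => 'D_u f (x + h *: w + s *: u) - 'D_u f (x + s *: u)) h.
  move=> sh; apply: is_deriveB.
    by apply: is_derive_line; apply: derivableP; apply: H1; exact: le_lt_trans (bnd _ _ sh (lexx _)) hde.
  apply: is_derive_line; apply: derivableP; apply: H1.
  by have := bnd s 0 sh; rewrite normr0 scale0r addr0 => /(_ (normr_ge0 _)) b; exact: le_lt_trans b hde.
have [s|c2 [ch2 Ec2]] := @MVT_abs R (fun s => 'D_u f (x + c *: u + s *: w)) (fun s => 'D_w ('D_u f) (x + c *: u + s *: w)) h.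
  move=> sh; apply: (@is_derive_line R V ('D_u f) (x + c *: u) w s).
  apply: derivableP; apply: H2.
  rewrite [x + _ + _]addrAC; exact: le_lt_trans (bnd _ _ ch sh) hde.
exists (x + c *: u + c2 *: w); split.
  by rewrite [x + _ + _]addrAC; exact: bnd.
move: Ec Ec2; rewrite /phi !scale0r !addr0 => Ec Ec2.
rewrite expr2 -mulrA [h * 'D_w _ _]mulrC -Ec2 [h * _]mulrC.
rewrite [x + c *: u + h *: w]addrAC -Ec [x + h *: u + h *: w]addrAC; ring.
Qed.

(** Two continuous functions taking equal values at points arbitrarily close
    to [x] agree at [x]. *)
Lemma continuous_eq_near (A B : V -> R) (x : V) :
  {for x, continuous A} -> {for x, continuous B} ->
  (forall r : R, 0 < r -> exists y z, [/\ `|y - x| < r, `|z - x| < r & A y = B z]) ->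
  A x = B x.
Proof.
move=> c1 c2 H; apply/eqP; rewrite -subr_eq0 -normr_le0.
apply/ler_addgt0Pl => /= e; rewrite addr0 => e0.
have e20 : 0 < e / 2 by rewrite divr_gt0.
have [d1 d10 K1] := continuous_eps c1 e20.
have [d2 d20 K2] := continuous_eps c2 e20.
have [|y [z []]] := H (Num.min d1 d2); first by rewrite lt_min d10.
rewrite !lt_min => /andP[/K1 By _] /andP[_ /K2 Bz] E.
move: By Bz; rewrite E !ler_norml.
move: (B z) (B x) (A x) => p1 p2 p3.
by move=> /andP[? ?] /andP[? ?]; apply/andP; split; lra.
Qed.

Lemma schwarz_symmetry (f : V -> R) (x u w : V) (de : R) : 0 < de ->
  (forall y, `|y - x| < de -> derivable f y u /\ derivable f y w) ->
  (forall y, `|y - x| < de -> derivable ('D_u f) y w /\ derivable ('D_w f) y u) ->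
  {for x, continuous ('D_w ('D_u f))} -> {for x, continuous ('D_u ('D_w f))} ->
  'D_w ('D_u f) x = 'D_u ('D_w f) x.
Proof.
move=> de0 H1 H2 c1 c2; apply: continuous_eq_near c1 c2 _ => r r0.
pose m := Num.min de r.
have m0 : 0 < m by rewrite !lt_min de0 r0.
pose D := `|u| + `|w| + 1.
have D0 : 0 < D by rewrite ltr_wpDl ?addr_ge0.
pose h := m / D.
have h0 : 0 < h by rewrite divr_gt0.
have hm : `|h| * (`|u| + `|w|) < m.
  rewrite gtr0_norm // /h -mulrA gtr_pMr // mulrC ltr_pdivrMr // mul1r.
  by rewrite /D ltrDl.
have hm2 : `|h| * (`|w| + `|u|) < m by rewrite [`|w| + _]addrC.
have md : m <= de by rewrite ge_min lexx.
have mr : m <= r by rewrite ge_min lexx orbT.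
have [y [yx Ey]] := double_difference (fun y yx => (H1 y yx).1) (fun y yx => (H2 y yx).1) (lt_le_trans hm md).
have [z [zx Ez]] := double_difference (fun y yx => (H1 y yx).2) (fun y yx => (H2 y yx).2) (lt_le_trans hm2 md).
exists y, z; split.
- exact: le_lt_trans yx (lt_le_trans hm mr).
- exact: le_lt_trans zx (lt_le_trans hm2 mr).
move: ('D_w _ y) ('D_u _ z) Ey Ez => p q Ey Ez.
have h20 : h ^+ 2 != 0 by rewrite expf_neq0 // gt_eqF.
apply: (mulfI h20); rewrite -Ey -Ez [x + h *: w + h *: u]addrAC.
by move: (f _) (f _) (f _) (f _) => p1 p2 p3 p4; ring.
Qed.

End DoubleDifference.

Section PartialDerivatives.
Context {R : realType} {n : nat}.
Implicit Types (f : 'rV[R]_n -> R) (x v : 'rV[R]_n).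

Lemma basis_vecE (i j : 'I_n) : basis_vec i 0 j = (j == i)%:R :> R.
Proof. by rewrite /basis_vec mxE eqxx. Qed.

Lemma coord_le_norm x i : `|x 0 i| <= `|x|.
Proof.
rewrite [leRHS]/Num.Def.normr /= mx_normrE.
exact: (le_bigmax 0 (fun ij : 'I_1 * 'I_n => `|x ij.1 ij.2|) (0, i)).
Qed.

Lemma norm_le_coord x (c : R) : 0 <= c -> (forall i, `|x 0 i| <= c) -> `|x| <= c.
Proof.
move=> c0 H; rewrite [leLHS]/Num.Def.normr /= mx_normrE.
by rewrite (bigmax_le _ c0) //= => -[i j] _ /=; rewrite ord1.
Qed.

(** Continuous partial derivatives give directional derivatives: the increment
    telescopes over the coordinates. *)
Lemma partials_is_derive f x v (de : R) : 0 < de ->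
  (forall y, `|y - x| < de -> forall i, derivable f y (basis_vec i)) ->
  (forall i, {for x, continuous ('D_(basis_vec i) f)}) ->
  is_derive x v f (\sum_i v 0 i * 'D_(basis_vec i) f x).
Proof.
move=> de0 H1 H2; apply: is_derive_eps => e e0.
pose S : R := \sum_i `|v 0 i| + 1.
have S0 : 0 < S by rewrite ltr_wpDl // sumr_ge0.
have eS : 0 < e / S by rewrite divr_gt0.
have [d1 d10 K1] : exists2 d : R, 0 < d & forall y, `|y - x| < d ->
    forall i, `|'D_(basis_vec i) f y - 'D_(basis_vec i) f x| <= e / S.
  have K i : exists2 d : R, 0 < d & forall y, `|y - x| < d ->
    `|'D_(basis_vec i) f y - 'D_(basis_vec i) f x| <= e / S := continuous_eps (H2 i) eS.
  have [d Hd] : exists d : 'I_n -> R, forall i, 0 < d i /\ (forall y, `|y - x| < d i ->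
    `|'D_(basis_vec i) f y - 'D_(basis_vec i) f x| <= e / S).
    by exists (fun i => sval (cid2 (K i))) => i; case: (cid2 (K i)).
  exists (\big[Num.min/1]_i d i).
    by apply: lt_bigmin => // i _; exact: (Hd i).1.
  move=> y yx i; apply: (Hd i).2; apply: lt_le_trans yx _; exact: bigmin_le_cond.
pose m := Num.min de d1.
have m0 : 0 < m by rewrite lt_min de0.
exists (m / S); first by rewrite divr_gt0.
move=> h hS.
have hv : `|h| * `|v| < m.
  have vS : `|v| <= S.
    apply: norm_le_coord (ltW S0) _ => i.
    by rewrite /S (bigD1 i) //= -addrA lerDl addr_ge0 // sumr_ge0.
  by apply: le_lt_trans (ler_wpM2l (normr_ge0 h) vS) _; rewrite -ltr_pdivlMr.
pose p (k : nat) : 'rV[R]_n := x + h *: \row_j (if (j < k)%N then v 0 j else 0).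
have Ek (i : 'I_n) : exists y, `|y - x| < m /\ f (p i.+1) - f (p i) = 'D_(basis_vec i) f y * (h * v 0 i).
  have bnd (c : R) : `|c| <= `|h * v 0 i| -> `|p i + c *: basis_vec i - x| < m.
    move=> ch; apply: le_lt_trans hv; apply: norm_le_coord; first by rewrite mulr_ge0.
    move=> j; rewrite !mxE /= addrAC [x 0 j + _]addrC addrK.
    have [ji|ji] := eqVneq j i.
      rewrite ji ltnn mulr0 add0r mulr1 (le_trans ch) // normrM ler_wpM2l // coord_le_norm //.
    rewrite mulr0 addr0; case: ifP => _; last by rewrite mulr0 normr0 mulr_ge0.
    by rewrite normrM ler_wpM2l // coord_le_norm.
  have [c ch|c [ch E]] := @MVT_abs R (fun t => f (p i + t *: basis_vec i))
      (fun t => 'D_(basis_vec i) f (p i + t *: basis_vec i)) (h * v 0 i).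
    apply: (@is_derive_line R _ f (p i) (basis_vec i) c); apply: derivableP; apply: H1.
    by apply: lt_le_trans (bnd c ch) _; rewrite ge_min lexx.
  exists (p i + c *: basis_vec i); split; first exact: bnd.
  rewrite -E scale0r addr0; congr (f _ - _); rewrite /p -addrA; congr (_ + _).
  apply/rowP => j; rewrite !mxE /= ltnS leq_eqVlt.
  have [ji|ji] := eqVneq (j : nat) i.
    have -> : j = i by apply: val_inj.
    by rewrite eqxx ltnn /= mulr0 add0r mulr1.
  have -> : (j == i) = false by apply/eqP => ji2; rewrite ji2 eqxx in ji.
  by rewrite /= mulr0 addr0.
have Ef : f (x + h *: v) - f x = \sum_(i < n) (f (p i.+1) - f (p i)).
  rewrite -(big_mkord xpredT (fun i => f (p i.+1) - f (p i))) telescope_sumr //.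
  congr (f _ - f _); rewrite /p; last first.
    suff -> : \row_j (if (j < 0)%N then v 0 j else 0) = 0 by rewrite scaler0 addr0.
    by apply/rowP => j; rewrite !mxE.
  by congr (_ + _ *: _); apply/rowP => j; rewrite !mxE ltn_ord.
rewrite Ef mulr_suml -sumrB.
apply: le_trans (ler_norm_sum _ _ _) _.
have -> : e * `|h| = \sum_(i < n) (e / S * (`|v 0 i| * `|h|)) + e / S * `|h|.
  rewrite -mulr_sumr -mulr_suml -mulrDr -[X in _ + X]mul1r -mulrDl -/S mulrA.
  by rewrite divfK // gt_eqF.
apply: (@le_trans _ _ (\sum_(i < n) (e / S * (`|v 0 i| * `|h|)))); last first.
  by rewrite lerDl mulr_ge0 // ltW.
apply: ler_sum => i _; have [y [yx ->]] := Ek i.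
have := K1 y _ i; rewrite (lt_le_trans yx) ?ge_min ?lexx ?orbT // => /(_ isT) b.
move: ('D__ _ y) ('D__ _ x) b => p1 p2 b.
have -> : p1 * (h * v 0 i) - v 0 i * p2 * h = (p1 - p2) * (v 0 i * h) by ring.
by rewrite !normrM; apply: ler_wpM2r b; rewrite mulr_ge0.
Qed.

End PartialDerivatives.


(** * Pointwise rules of differentiation *)

Section PointwiseRules.
Context {R : realType} {V : normedModType R}.
Implicit Types (f g : V -> R) (x v : V).

Lemma dder_eq f x v (a b : R) : is_derive x v f a -> a = b -> is_derive x v f b.
Proof. by move=> H <-. Qed.

Lemma dderC (c : R) x v : is_derive x v (fun _ : V => c) 0.
Proof. exact: is_derive_cst. Qed.

Lemma dderD f g x v (a b : R) : is_derive x v f a -> is_derive x v g b ->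
  is_derive x v (fun t => f t + g t) (a + b).
Proof. exact: is_deriveD. Qed.

Lemma dderB f g x v (a b : R) : is_derive x v f a -> is_derive x v g b ->
  is_derive x v (fun t => f t - g t) (a - b).
Proof. exact: is_deriveB. Qed.

Lemma dderM f g x v (a b : R) : is_derive x v f a -> is_derive x v g b ->
  is_derive x v (fun t => f t * g t) (a * g x + f x * b).
Proof.
move=> ha hb; have H := @is_deriveM R V f g x v a b ha hb.
rewrite (_ : a * g x + f x * b = f x *: b + g x *: a); first exact: H.
by rewrite addrC /GRing.scale /=; congr (_ + _); rewrite mulrC.
Qed.

Lemma dderZ (c : R) f x v (a : R) : is_derive x v f a ->
  is_derive x v (fun t => c * f t) (c * a).
Proof. by move=> ha; have := dderM (dderC c x v) ha; rewrite mul0r add0r. Qed.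

Lemma dderX f n x v (a : R) : is_derive x v f a ->
  is_derive x v (fun t => f t ^+ n) (n%:R * f x ^+ n.-1 * a).
Proof.
move=> ha; elim: n => [|n IH].
  by rewrite mulr0n !mul0r; exact: dderC.
have -> : (fun t => f t ^+ n.+1) = (fun t => f t * f t ^+ n).
  by apply/funext => t; rewrite exprS.
apply: (dder_eq (dderM ha IH)).
case: n {IH} => [|n] /=; first by rewrite expr0 mulr0n !mul0r mulr0 addr0 mulr1 !mul1r.
by rewrite -[n.+2]addn1 natrD !exprS; ring.
Qed.

Lemma dder_sum (I : Type) (r : seq I) (f : I -> V -> R) x v (a : I -> R) :
  (forall i, is_derive x v (f i) (a i)) ->
  is_derive x v (fun t => \sum_(i <- r) f i t) (\sum_(i <- r) a i).
Proof.
move=> H; elim: r => [|i r IH].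
  have -> : (fun t => \sum_(i <- [::]) f i t) = fun=> 0 by apply/funext => t; rewrite big_nil.
  by rewrite big_nil; exact: dderC.
have -> : (fun t => \sum_(j <- i :: r) f j t) = (fun t => f i t + \sum_(j <- r) f j t).
  by apply/funext => t; rewrite big_cons.
by rewrite big_cons; exact: dderD.
Qed.

Lemma dder_comp (h : R -> R) f x v (a b : R) : is_derive x v f a ->
  is_derive (f x) 1 h b -> is_derive x v (fun t => h (f t)) (b * a).
Proof.
move=> ha hb; apply: is_derive_eps => e e0.
pose K : R := `|a| + 1.
have K0 : 0 < K by rewrite ltr_wpDl.
have b0 : 0 < `|b| + 1 by rewrite ltr_wpDl.
have [d1 d10 H1] := is_derive_epsP hb (divr_gt0 (divr_gt0 e0 (ltr0Sn R 1)) K0).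
have e1 : 0 < Num.min 1 (e / 2 / (`|b| + 1)) by rewrite lt_min ltr01 !divr_gt0.
have [d2 d20 H2] := is_derive_epsP ha e1.
exists (Num.min d2 (d1 / K)); first by rewrite lt_min d20 divr_gt0.
move=> s; rewrite lt_min => /andP[/H2 sa]; rewrite ltr_pdivlMr // => sd1.
set D := f (x + s *: v) - f x in sa.
have [sa1 sa2] : `|D - a * s| <= `|s| /\ `|D - a * s| <= e / 2 / (`|b| + 1) * `|s|.
  have m1 : Num.min 1 (e / 2 / (`|b| + 1)) <= 1 by rewrite ge_min lexx.
  have m2 : Num.min 1 (e / 2 / (`|b| + 1)) <= e / 2 / (`|b| + 1) by rewrite ge_min lexx orbT.
  split; last exact: le_trans sa (ler_wpM2r (normr_ge0 s) m2).
  by have := le_trans sa (ler_wpM2r (normr_ge0 s) m1); rewrite mul1r.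
have DK : `|D| <= `|s| * K.
  rewrite -[D](subrK (a * s)) mulrDr mulr1 addrC (le_trans (ler_normD _ _)) //.
  by rewrite lerD // normrM mulrC.
have := H1 D (le_lt_trans DK sd1); rewrite [_%:A]mulr1 {1}/D [f x + _]addrC subrK => h1.
have -> : h (f (x + s *: v)) - h (f x) - b * a * s =
  (h (f (x + s *: v)) - h (f x) - b * D) + b * (D - a * s) by ring.
apply: le_trans (ler_normD _ _) _; rewrite [e]splitr mulrDl; apply: lerD.
  apply: le_trans h1 _; apply: le_trans (ler_wpM2l _ DK) _.
    by rewrite !divr_ge0 // ltW.
  by rewrite [`|s| * K]mulrC mulrA divfK ?gt_eqF.
rewrite normrM; apply: le_trans (ler_wpM2l (normr_ge0 _) sa2) _.
rewrite mulrA; apply: ler_wpM2r => //.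
by rewrite mulrA ler_pdivrMr // mulrC ler_wpM2l ?lerDl // ltW // divr_gt0.
Qed.

End PointwiseRules.

Section PointwiseRulesReal.
Context {R : realType}.
Implicit Types (f g : R -> R) (x : R).

Lemma dder_id x : is_derive x 1 (fun t : R => t) 1.
Proof. exact: is_derive_id. Qed.

Lemma quad_is_derive (c0 c1 c2 s : R) :
  is_derive s 1 (fun t : R => c0 + c1 * t + c2 * t ^+ 2) (c1 + 2 * c2 * s).
Proof.
apply: (dder_eq (dderD (dderD (dderC _ _ _) (dderZ c1 (dder_id s)))
  (dderZ c2 (dderX 2 (dder_id s))))).
by rewrite /= expr1; ring.
Qed.

End PointwiseRulesReal.


(** * The comparison principle *)

Lemma symmetric_shift_psd_gt (R : realType) n (A B : 'M[R]_n) k (e : R) :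
  A^T = A -> B^T = B -> 0 < e -> (0 < k <= n)%N ->
  (forall j, (1 <= j <= k)%N -> 0 <= (minor_poly A)`_j) ->
  (forall y : 'cV[R]_n, 0 <= (y^T *m (B - (A + e%:M)) *m y) 0 0) ->
  (minor_poly A)`_k < (minor_poly B)`_k.
Proof.
move=> sA sB e0 /andP[k0 kn] HA Hq.
have Hs := symmetric_shift_gt sA e0 kn HA.
have sAe : (A + e%:M)^T = A + e%:M by rewrite linearD /= sA tr_scalar_mx.
have [_ /(_ k0) lt] := Hs k (leqnn k); apply: lt_le_trans lt _.
have -> : B = A + e%:M + (B - (A + e%:M)) by rewrite addrC subrK.
apply: symmetric_psd_ge => //; first by rewrite linearB /= sB sAe.
by move=> j jk; have [] := Hs j jk.
Qed.

Section EuclideanBall.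
Context {R : realType} {n : nat}.
Implicit Types (x y v : 'rV[R]_n).

Lemma continuous_at_sum (T : topologicalType) (I : Type) (r : seq I) (F : I -> T -> R) (a : T) :
  (forall i, {for a, continuous (F i)}) ->
  {for a, continuous (fun z => \sum_(i <- r) F i z)}.
Proof.
move=> H; elim: r => [|i r IH].
  have -> : (fun z => \sum_(i <- [::]) F i z) = cst 0 by apply/funext => z; rewrite big_nil.
  exact: cst_continuous.
have -> : (fun z => \sum_(j <- i :: r) F j z) = F i \+ (fun z => \sum_(j <- r) F j z).
  by apply/funext => z; rewrite big_cons.
exact: continuousD.
Qed.

(** Squared Euclidean norm. *)
Definition sqnorm x : R := \sum_i x 0 i ^+ 2.

Lemma sqnorm_ge0 x : 0 <= sqnorm x.
Proof. by apply: sumr_ge0 => i _; rewrite sqr_ge0. Qed.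

Lemma enormE x : enorm x = Num.sqrt (sqnorm x). Proof. by []. Qed.

Lemma enorm_ge0 x : 0 <= enorm x. Proof. exact: sqrtr_ge0. Qed.

Lemma enorm_sqr x : enorm x ^+ 2 = sqnorm x.
Proof. by rewrite sqr_sqrtr ?sqnorm_ge0. Qed.

Lemma continuous_sqnorm : continuous sqnorm.
Proof.
move=> x; apply: continuous_at_sum => i.
have -> : (fun z : 'rV[R]_n => z 0 i ^+ 2) = (fun z => z 0 i) * (fun z => z 0 i).
  by apply/funext => z; rewrite expr2.
by apply: continuousM; exact: coord_continuous.
Qed.

Lemma continuous_enorm : continuous (enorm : 'rV[R]_n -> R).
Proof.
move=> x; apply: (@continuous_comp _ _ _ sqnorm Num.sqrt); first exact: continuous_sqnorm.
exact: sqrt_continuous.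
Qed.

Lemma coord_le_enorm x i : `|x 0 i| <= enorm x.
Proof.
rewrite -sqrtr_sqr ler_sqrt ?sqnorm_ge0 // /sqnorm (bigD1 i) //= lerDl.
by apply: sumr_ge0 => j _; rewrite sqr_ge0.
Qed.

Lemma norm_le_enorm x : `|x| <= enorm x.
Proof. by apply: norm_le_coord; [exact: enorm_ge0|move=> i; exact: coord_le_enorm]. Qed.

Lemma unit_ball_near x : unit_ball x ->
  exists2 d : R, 0 < d & forall y, `|y - x| < d -> unit_ball y.
Proof.
rewrite /unit_ball /= => x1.
have e0 : 0 < (1 - enorm x) / 2 by rewrite divr_gt0 // subr_gt0.
have [d d0 H] := continuous_eps (@continuous_enorm x) e0.
exists d => // y /H; rewrite ler_norml => /andP[_].
rewrite /mkset; move: (enorm x) (enorm y) x1 => a b *; lra.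
Qed.

Lemma compact_closed_unit_ball : compact (@closed_unit_ball R n).
Proof.
apply: bounded_closed_compact.
  exists 1; split => // M M1 x /= x1.
  by apply: (le_trans (norm_le_enorm x)); apply: (le_trans x1); exact: ltW.
have -> : @closed_unit_ball R n = enorm @^-1` [set r | r <= 1] by [].
apply: closed_comp; last exact: closed_le.
by move=> x _; exact: continuous_enorm.
Qed.

Section C2.
Variables (u : 'rV[R]_n -> R) (u2 : C2_on_rV unit_ball u).

Lemma C2_is_derive x v : unit_ball x ->
  is_derive x v u (\sum_i v 0 i * 'D_(basis_vec i) u x).
Proof.
move=> /[dup] x1 /unit_ball_near[d d0 H]; apply: (@partials_is_derive R n u x v d d0).
  by move=> y /H/u2[_ K] i; have [] := K i.
by move=> i; have [_ K] := u2 x1; have [] := K i.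
Qed.

Lemma C2_is_derive2 x v i : unit_ball x ->
  is_derive x v ('D_(basis_vec i) u)
    (\sum_j v 0 j * 'D_(basis_vec j) ('D_(basis_vec i) u) x).
Proof.
move=> /[dup] x1 /unit_ball_near[d d0 H]; apply: (@partials_is_derive R n ('D_(basis_vec i) u) x v d d0).
  by move=> y /H/u2[_ K] j; have [_ _ /(_ j)[]] := K i.
by move=> j; have [_ K] := u2 x1; have [_ _ /(_ j)[]] := K i.
Qed.

Lemma hessian_sym x : unit_ball x -> (hessian u x)^T = hessian u x.
Proof.
move=> /[dup] x1 /unit_ball_near[d d0 H]; apply/matrixP => i j; rewrite !mxE.
have [_ Kx] := u2 x1.
apply: (schwarz_symmetry d0).
- by move=> y /H/u2[_ K]; have [? _ _] := K i; have [? _ _] := K j.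
- by move=> y /H/u2[_ K]; have [_ _ /(_ i)[? _]] := K j; have [_ _ /(_ j)[? _]] := K i.
- by have [_ _ /(_ i)[]] := Kx j.
- by have [_ _ /(_ j)[]] := Kx i.
Qed.

End C2.

Lemma quad_formE (M : 'M[R]_n) (xi : 'cV[R]_n) :
  (xi^T *m M *m xi) 0 0 = \sum_i xi i 0 * \sum_j xi j 0 * M i j.
Proof.
rewrite -mulmxA mxE; apply: eq_bigr => i _; rewrite !mxE; congr (_ * _).
by apply: eq_bigr => j _; rewrite mulrC.
Qed.

Lemma quad_form_sub (A B E : 'M[R]_n) (xi : 'cV[R]_n) :
  - (xi^T *m (B - (A + E)) *m xi) 0 0 =
  (xi^T *m A *m xi) 0 0 - (xi^T *m B *m xi) 0 0 + (xi^T *m E *m xi) 0 0.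
Proof.
rewrite mulmxBr mulmxBl mulmxDr mulmxDl.
move: (xi^T *m A *m xi) (xi^T *m B *m xi) (xi^T *m E *m xi) => a b c.
by rewrite !mxE; ring.
Qed.

(** At an interior maximum of [v - w + e/2 (|.|^2 - 1)] the second directional
    derivatives are nonpositive, so [D^2 w >= D^2 v + e I]. *)
Lemma hessian_at_max (v w : 'rV[R]_n -> R) (e : R) x : C2_on_rV unit_ball v -> C2_on_rV unit_ball w ->
  unit_ball x ->
  (forall y, unit_ball y ->
     v y - w y + e / 2 * (sqnorm y - 1) <= v x - w x + e / 2 * (sqnorm x - 1)) ->
  forall xi : 'cV[R]_n,
    0 <= (xi^T *m (hessian w x - (hessian v x + e%:M)) *m xi) 0 0.
Proof.
move=> v2 w2 x1 Hmax xi; pose z : 'rV[R]_n := xi^T.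
have [d d0 Hd] := unit_ball_near x1.
pose N := `|z| + 1.
have N0 : 0 < N by rewrite ltr_wpDl.
have Hb (s : R) : `|s| < d / N -> unit_ball (x + s *: z).
  move=> sd; apply: Hd; rewrite addrC addKr normrZ.
  rewrite ltr_pdivlMr // in sd; apply: le_lt_trans sd.
  by rewrite ler_wpM2l // lerDl.
pose f s := v (x + s *: z) - w (x + s *: z) + e / 2 * (sqnorm (x + s *: z) - 1).
pose f1 s := \sum_i z 0 i * 'D_(basis_vec i) v (x + s *: z)
   - \sum_i z 0 i * 'D_(basis_vec i) w (x + s *: z)
   + e * (\sum_i x 0 i * z 0 i + sqnorm z * s).
pose f2 := \sum_i z 0 i * (\sum_j z 0 j * 'D_(basis_vec j) ('D_(basis_vec i) v) x)
   - \sum_i z 0 i * (\sum_j z 0 j * 'D_(basis_vec j) ('D_(basis_vec i) w) x)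
   + e * sqnorm z.
have dline (u : 'rV[R]_n -> R) : C2_on_rV unit_ball u -> is_derive (0 : R) 1
    (fun s : R => \sum_i z 0 i * 'D_(basis_vec i) u (x + s *: z))
    (\sum_i z 0 i * (\sum_j z 0 j * 'D_(basis_vec j) ('D_(basis_vec i) u) x)).
  move=> u2; apply: dder_sum => i; apply: dderZ.
  apply: (@is_derive_line R _ ('D_(basis_vec i) u) x z 0); rewrite scale0r addr0.
  exact: C2_is_derive2.
have f2le : f2 <= 0.
  apply: (@second_derivative_at_max R f f1 f2 (d / N)).
  - by rewrite divr_gt0.
  - move=> s /Hb sb; apply: dderD.
      by apply: dderB; apply: is_derive_line; exact: C2_is_derive.
    have -> : (fun t : R => e / 2 * (sqnorm (x + t *: z) - 1)) =
        (fun t => e / 2 * (sqnorm x - 1) + e * (\sum_i x 0 i * z 0 i) * t + e / 2 * sqnorm z * t ^+ 2).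
      apply/funext => t; rewrite /sqnorm.
      have -> : \sum_i (x + t *: z) 0 i ^+ 2 = \sum_i x 0 i ^+ 2 +
          2 * t * (\sum_i x 0 i * z 0 i) + t ^+ 2 * \sum_i z 0 i ^+ 2.
        rewrite !mulr_sumr -!big_split /=; apply: eq_bigr => i _.
        by rewrite mxE [(t *: z) 0 i]mxE; ring.
      by field.
    by apply: (dder_eq (quad_is_derive _ _ _ _)); field.
  - apply: dderD; first by apply: dderB; exact: dline.
    apply: dderZ; have := quad_is_derive (\sum_i x 0 i * z 0 i) (sqnorm z) 0 (0 : R).
    rewrite !mulr0 addr0; congr (is_derive _ _ _ _).
    by apply/funext => t; rewrite mul0r addr0.
  - move=> s /Hb sb; rewrite /f scale0r addr0; exact: Hmax.
rewrite -oppr_le0; apply: le_trans f2le; apply: eq_imply_le.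
have zE i : z 0 i = xi i 0 by rewrite mxE.
have Qu (u : 'rV[R]_n -> R) : \sum_i z 0 i * (\sum_j z 0 j * 'D_(basis_vec j) ('D_(basis_vec i) u) x)
    = (xi^T *m hessian u x *m xi) 0 0.
  rewrite quad_formE; apply: eq_bigr => i _; rewrite zE; congr (_ * _).
  by apply: eq_bigr => j _; rewrite zE mxE.
have Qe : e * sqnorm z = (xi^T *m e%:M *m xi) 0 0.
  rewrite quad_formE /sqnorm mulr_sumr; apply: eq_bigr => i _; rewrite zE.
  rewrite (bigD1 i) //= big1 => [|j /negPf ji]; rewrite !mxE.
    by rewrite eqxx mulr1n addr0; ring.
  by rewrite eq_sym ji mulr0n mulr0.
rewrite quad_form_sub /f2.
exact: (congr2 (fun a b => a + b) (congr2 (fun a b => a - b) (esym (Qu v)) (esym (Qu w))) (esym Qe)).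
Qed.

(** Only the smaller function has to be admissible. At a positive interior
    maximum of the penalised difference [v - w + e/2 (|.|^2 - 1)], strict
    monotonicity of [S_k] contradicts the inequality between the Hessian
    operators. *)
Lemma comparison_principle k (v w : 'rV[R]_n -> R) : (0 < k <= n)%N ->
  k_admissible k v -> C2_on_rV unit_ball w -> {within closed_unit_ball, continuous w} ->
  (forall x, unit_ball x -> hessian_S k w x <= hessian_S k v x) ->
  (forall x, unit_sphere x -> v x <= w x) ->
  forall x, closed_unit_ball x -> v x <= w x.
Proof.
move=> /andP[k0 kn] [v2 cv Sv] w2 cw Svw Bvw x xB; rewrite leNgt; apply/negP => wv.
(* With e = v x - w x the penalisation cannot cancel the positive value at x,
   and it vanishes on the sphere. *)
pose e := v x - w x.
have e0 : 0 < e by rewrite subr_gt0.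
pose h y := v y - w y + e / 2 * (sqnorm y - 1).
have hx : 0 < h x.
  rewrite /h -/e; have := sqnorm_ge0 x; move: (sqnorm x) => a a0.
  have : 0 <= e * a by rewrite mulr_ge0 // ltW.
  rewrite mulrBr mulr1 mulrAC; move: (e * a) => b b0; lra.
have ch : {within closed_unit_ball, continuous h}.
  move=> y; apply: cvgD; first by apply: cvgB; [exact: cv|exact: cw].
  apply: cvgM; first exact: cvg_cst.
  apply: cvgB; last exact: cvg_cst.
  exact: (continuous_subspaceT continuous_sqnorm).
have [|y yB ymax] := EVT_max_rV _ compact_closed_unit_ball ch; first by exists x.
have hy : 0 < h y by apply: lt_le_trans hx (ymax _ _); rewrite inE.
have yin : unit_ball y.
  move: yB; rewrite inE /closed_unit_ball /unit_ball /= le_eqVlt => /orP[/eqP y1|//].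
  move: hy; rewrite /h -enorm_sqr y1 expr1n subrr mulr0 addr0 subr_gt0 ltNge.
  by rewrite Bvw.
have Hq := @hessian_at_max v w e y v2 w2 yin.
have {}Hq : forall xi : 'cV[R]_n,
    0 <= (xi^T *m (hessian w y - (hessian v y + e%:M)) *m xi) 0 0.
  apply: Hq => t tB; apply: ymax; rewrite inE /closed_unit_ball /=; exact: ltW.
have sA := hessian_sym v2 yin; have sB := hessian_sym w2 yin.
have Hk j : hessian_S j v y = (minor_poly (hessian v y))`_j by exact: eigenvalues_symmetric.
have Hw j : hessian_S j w y = (minor_poly (hessian w y))`_j by exact: eigenvalues_symmetric.
have HA j : (1 <= j <= k)%N -> 0 <= (minor_poly (hessian v y))`_j.
  by move=> jk; rewrite -Hk; exact: Sv.
have := Svw y yin; rewrite Hk Hw; apply/negP; rewrite -ltNge.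
by apply: (symmetric_shift_psd_gt sA sB e0) Hq; rewrite ?k0.
Qed.

End EuclideanBall.


(** * Radial functions *)

Section RadialFunctions.
Context {R : realType}.

Lemma dder_continuous (f : R -> R) (x a : R) : is_derive x 1 f a -> {for x, continuous f}.
Proof. by move=> [H _]; apply: differentiable_continuous; apply/derivable1_diffP. Qed.

Lemma dderV (f : R -> R) (x a : R) : f x != 0 -> is_derive x 1 f a ->
  is_derive x 1 (fun t => (f t)^-1) (- a / f x ^+ 2).
Proof.
move=> f0 H; have := is_deriveV f0 H; rewrite /GRing.scale /=.
by rewrite mulNr mulrC mulNr.
Qed.

Lemma eps_continuous (V : normedModType R) (f : V -> R) (x : V) :
  (forall e : R, 0 < e -> exists2 d : R, 0 < d & forall y, `|y - x| < d -> `|f y - f x| <= e) ->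
  {for x, continuous f}.
Proof.
move=> H; apply/cvgrPdist_le => /= e e0; have [d d0 Hd] := H e e0.
apply/nbhs_ballP; exists d => // y; rewrite -ball_normE /= => yd.
by rewrite distrC; apply: Hd; rewrite distrC.
Qed.

Context {n : nat}.
Implicit Types (x y : 'rV[R]_n).

Lemma dder_coord x v (i : 'I_n) : is_derive x v (fun y : 'rV[R]_n => y 0 i) (v 0 i).
Proof.
apply: is_derive_eps => e e0; exists 1 => // h _.
have -> : (x + h *: v) 0 i - x 0 i - v 0 i * h = 0 by rewrite !mxE; ring.
by rewrite normr0 mulr_ge0 // ltW.
Qed.

Lemma dder_sqnorm x v : is_derive x v (@sqnorm R n) (2 * \sum_i x 0 i * v 0 i).
Proof.
rewrite mulr_sumr; apply: dder_sum => i.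
by apply: (dder_eq (dderX 2 (dder_coord x v i))); rewrite /= expr1 mulrA.
Qed.

Lemma dder_enorm x v : 0 < enorm x ->
  is_derive x v (@enorm R n) ((\sum_i x 0 i * v 0 i) / enorm x).
Proof.
move=> x0; have q0 : 0 < sqnorm x by rewrite -enorm_sqr exprn_gt0.
apply: (dder_eq (dder_comp (dder_sqnorm x v) (is_derive1_sqrt q0))).
by rewrite -enormE; field; rewrite gt_eqF.
Qed.

Lemma sum_basis x (j : 'I_n) : \sum_i x 0 i * basis_vec j 0 i = x 0 j.
Proof.
rewrite (bigD1 j) //= big1 ?addr0 ?basis_vecE ?eqxx ?mulr1 // => i /negPf ij.
by rewrite basis_vecE ij mulr0.
Qed.

Lemma enorm0 : enorm (0 : 'rV[R]_n) = 0.
Proof. by rewrite enormE /sqnorm big1 ?sqrtr0 // => i _; rewrite mxE expr0n. Qed.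

Lemma enorm_eq0 x : enorm x = 0 -> x = 0.
Proof.
move=> x0; apply/rowP => i; rewrite mxE; apply/eqP.
by rewrite -normr_le0 -x0 coord_le_enorm.
Qed.

Lemma enorm_scale_basis (h : R) (j : 'I_n) : enorm (h *: basis_vec j : 'rV[R]_n) = `|h|.
Proof.
rewrite enormE /sqnorm (bigD1 j) //= big1 ?addr0.
  by rewrite mxE basis_vecE eqxx mulr1 sqrtr_sqr.
by move=> i /negPf ij; rewrite mxE basis_vecE ij mulr0 expr0n.
Qed.

Lemma continuous_at0_enorm (f : 'rV[R]_n -> R) (C : R) :
  (forall y, unit_ball y -> `|f y| <= C * enorm y) -> f 0 = 0 -> {for 0, continuous f}.
Proof.
move=> H f0; apply: eps_continuous => e e0.
have C0 : 0 < `|C| + 1 by rewrite ltr_wpDl.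
have m0 : 0 < Num.min (1 / 2) (e / (`|C| + 1)) by rewrite lt_min !divr_gt0.
have [d d0 Hd] := continuous_eps (@continuous_enorm R n 0) m0.
exists d => // y /Hd; rewrite f0 enorm0 !subr0 le_min ger0_norm ?enorm_ge0 // => /andP[y1 y2].
have yb : unit_ball y.
  by rewrite /unit_ball /=; apply: le_lt_trans y1 _; rewrite ltr_pdivrMr // mul1r ltr1n.
apply: le_trans (H y yb) _; rewrite ler_pdivlMr // in y2; apply: le_trans y2.
rewrite mulrC ler_wpM2l ?enorm_ge0 // (le_trans (ler_norm C)) // lerDl //.
Qed.

(** A profile [u] with [u' = s], [s' = ds] whose first and second derivatives
    are [O(r^2)] and [O(r)] at the origin gives a [C^2] function of [x], all of
    whose second derivatives vanish at [0]. *)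
Section Profile.
Variables (u s ds : R -> R) (K : R).
Hypothesis Hu : forall r : R, 0 < r < 1 -> is_derive r 1 u (s r).
Hypothesis Hs : forall r : R, 0 < r < 1 -> is_derive r 1 s (ds r).
Hypothesis cds : forall r : R, 0 < r < 1 -> {for r, continuous ds}.
Hypothesis Ku : forall r : R, 0 < r < 1 -> `|u r - u 0| <= K * r ^+ 2.
Hypothesis Ks : forall r : R, 0 < r < 1 -> `|s r| <= K * r ^+ 2.
Hypothesis Kds : forall r : R, 0 < r < 1 -> `|ds r| <= K * r.

(* The Hessian at x is a(|x|) I + b(|x|) x^T x; division by zero makes a(0) = 0,
   which is the right value. *)
Let a (r : R) := s r / r.
Let b (r : R) := (ds r - s r / r) / r ^+ 2.
Let v x := u (enorm x).

Lemma profile_cases x : unit_ball x -> x = 0 \/ 0 < enorm x < 1.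
Proof.
rewrite /unit_ball /= => x1; have := enorm_ge0 x; rewrite le_eqVlt => /orP[/eqP|] h.
  by left; apply: enorm_eq0.
by right; rewrite h.
Qed.

Lemma profile_K0 : 0 <= K.
Proof.
have h : 0 < (1 / 2 : R) < 1 by rewrite divr_gt0 //= ltr_pdivrMr // mul1r ltr1n.
by have := le_trans (normr_ge0 _) (Kds h); case/andP: h => h _; rewrite pmulr_lge0.
Qed.

Lemma profile_a (r : R) : 0 < r < 1 -> `|a r| <= K * r.
Proof.
move=> r01; have /andP[r0 _] := r01.
rewrite /a normrM normfV (gtr0_norm r0) ler_pdivrMr // -mulrA -expr2; exact: Ks.
Qed.

Lemma profile_b (r : R) : 0 < r < 1 -> `|r ^+ 2 * b r| <= 2 * K * r.
Proof.
move=> r01; have /andP[r0 _] := r01.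
rewrite /b mulrC divfK ?expf_neq0 ?gt_eqF //.
by rewrite -mulrA mulr2n mulrDl mul1r; apply: le_trans (ler_normB _ _) _; rewrite lerD ?Kds ?profile_a.
Qed.

Lemma profile_da (r : R) : 0 < r < 1 -> is_derive r 1 a (r * b r).
Proof.
move=> r01; have /andP[r0 _] := r01; have r0' : r != 0 by rewrite gt_eqF.
apply: (dder_eq (dderM (Hs r01) (dderV r0' (dder_id r)))).
by rewrite /b; field.
Qed.

Lemma radial_is_derive x i : unit_ball x ->
  is_derive x (basis_vec i) v (a (enorm x) * x 0 i).
Proof.
move=> /profile_cases[->|x01].
  rewrite mxE mulr0; apply: is_derive_eps => e e0.
  have K1 : 0 < K + 1 by rewrite ltr_wpDl ?profile_K0.
  exists (Num.min 1 (e / (K + 1))); first by rewrite lt_min ltr01 divr_gt0.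
  move=> h; rewrite lt_min => /andP[h1 he]; rewrite mul0r subr0 add0r /v enorm_scale_basis enorm0.
  have [->|h0] := eqVneq h 0; first by rewrite normr0 subrr normr0 mulr0.
  have h01 : 0 < `|h| < 1 by rewrite normr_gt0 h0.
  apply: le_trans (Ku h01) _; rewrite expr2 mulrA ler_wpM2r //.
  rewrite ltr_pdivlMr // in he; apply: le_trans (ltW he); rewrite mulrC ler_wpM2l // lerDl //.
have /andP[x0 _] := x01.
apply: (dder_eq (dder_comp (dder_enorm (basis_vec i) x0) (Hu x01))).
by rewrite sum_basis /a mulrA mulrAC.
Qed.

Lemma radial_is_derive2 x i j : unit_ball x ->
  is_derive x (basis_vec j) (fun y => a (enorm y) * y 0 i)
    ((i == j)%:R * a (enorm x) + x 0 i * x 0 j * b (enorm x)).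
Proof.
move=> /profile_cases[->|x01].
  rewrite !mxE !mul0r addr0 enorm0 /a invr0 !mulr0; apply: is_derive_eps => e e0.
  have K1 : 0 < K + 1 by rewrite ltr_wpDl ?profile_K0.
  exists (Num.min 1 (e / (K + 1))); first by rewrite lt_min ltr01 divr_gt0.
  move=> h; rewrite lt_min => /andP[h1 he]; rewrite mul0r subr0 add0r enorm_scale_basis !mxE mulr0 subr0.
  have [->|h0] := eqVneq h 0; first by rewrite !(normr0, mul0r, mulr0).
  have h01 : 0 < `|h| < 1 by rewrite normr_gt0 h0.
  rewrite normrM; apply: (@le_trans _ _ (K * `|h| * `|h|)).
    apply: ler_pM => //; first exact: profile_a.
    rewrite normrM ger_pMr ?normr_gt0 //=.
    by case: (_ == _); rewrite ?normr1 ?normr0.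
  rewrite ler_wpM2r //.
  rewrite ltr_pdivlMr // in he; apply: le_trans (ltW he); rewrite mulrC ler_wpM2l // lerDl //.
have /andP[x0 _] := x01.
apply: (dder_eq (dderM (dder_comp (dder_enorm (basis_vec j) x0) (profile_da x01)) (dder_coord x (basis_vec j) i))).
rewrite sum_basis basis_vecE addrC [a _ * _]mulrC; congr (_ + _).
by field; rewrite gt_eqF.
Qed.

Lemma radial_D1 x i : unit_ball x ->
  'D_(basis_vec i) v x = a (enorm x) * x 0 i.
Proof. by move=> /(radial_is_derive i)[]. Qed.

Lemma radial_near (P : 'rV[R]_n -> Prop) x : (forall y, unit_ball y -> P y) ->
  unit_ball x -> \forall y \near x, P y.
Proof.
move=> H /unit_ball_near[d d0 Hd]; apply/nbhs_ballP; exists d => // y.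
by rewrite -ball_normE /= => yd; apply/H/Hd; rewrite distrC.
Qed.

Lemma radial_is_derive2' x i j : unit_ball x ->
  is_derive x (basis_vec j) ('D_(basis_vec i) v)
    ((i == j)%:R * a (enorm x) + x 0 i * x 0 j * b (enorm x)).
Proof.
move=> x1; apply: near_eq_is_derive (radial_is_derive2 i j x1).
by apply: radial_near x1 => y y1; rewrite radial_D1.
Qed.

Lemma radial_D2 x i j : unit_ball x ->
  'D_(basis_vec j) ('D_(basis_vec i) v) x =
    (i == j)%:R * a (enorm x) + x 0 i * x 0 j * b (enorm x).
Proof. by move=> /(radial_is_derive2' i j)[]. Qed.

Lemma continuous_comp_enorm (f : R -> R) x : {for enorm x, continuous f} ->
  {for x, continuous (fun y => f (enorm y))}.
Proof. by move=> cf; apply: continuous_comp => //; exact: continuous_enorm. Qed.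

Lemma near_continuous (f g : 'rV[R]_n -> R) x : unit_ball x ->
  (forall y, unit_ball y -> f y = g y) -> {for x, continuous g} -> {for x, continuous f}.
Proof.
move=> x1 fg cg; apply: eps_continuous => e e0.
have [d0 d00 H0] := unit_ball_near x1; have [d d1 Hd] := continuous_eps cg e0.
exists (Num.min d0 d); first by rewrite lt_min d00.
by move=> y; rewrite lt_min => /andP[/H0 yb /Hd]; rewrite !fg.
Qed.

Lemma radial_a_cont x : 0 < enorm x < 1 -> {for x, continuous (fun y => a (enorm y))}.
Proof. by move=> x01; apply: continuous_comp_enorm; apply: dder_continuous (profile_da x01). Qed.

Lemma radial_b_cont x : 0 < enorm x < 1 -> {for x, continuous (fun y => b (enorm y))}.
Proof.
move=> x01; apply: continuous_comp_enorm; have /andP[r0 _] := x01.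
have r0' : enorm x != 0 by rewrite gt_eqF.
apply: continuousM.
  by apply: continuousB; [exact: cds|exact: dder_continuous (profile_da x01)].
apply: continuousV; first by rewrite expf_neq0.
exact: dder_continuous (dderX 2 (dder_id _)).
Qed.

Lemma radial_C2 : C2_on_rV unit_ball v.
Proof.
move=> x x1; split.
  have [->|x01] := profile_cases x1; last first.
    by apply: continuous_comp_enorm; exact: dder_continuous (Hu x01).
  have H : {for 0, continuous (fun y => v y - u 0)}.
    apply: (@continuous_at0_enorm _ K); last by rewrite /v enorm0 subrr.
    move=> y /profile_cases[->|y01]; first by rewrite /v enorm0 subrr normr0 mulr0.
    apply: le_trans (Ku y01) _; rewrite ler_wpM2l ?profile_K0 //.
    by have /andP[y0 y1] := y01; rewrite expr2 ger_pMr // ltW.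
  have -> : v = (fun y => v y - u 0) \+ cst (u 0) by apply/funext => y; rewrite /= subrK.
  by apply: continuousD => //; exact: cst_continuous.
move=> i; split.
- by have [] := radial_is_derive i x1.
- apply: (near_continuous x1 (fun y => @radial_D1 y i)).
  have [->|x01] := profile_cases x1; last first.
    by apply: continuousM; [exact: radial_a_cont|exact: coord_continuous].
  apply: (@continuous_at0_enorm _ K); last by rewrite mxE mulr0.
  move=> y /profile_cases[->|y01]; first by rewrite mxE mulr0 enorm0 normr0 mulr0.
  have /andP[y0 y1] := y01.
  rewrite normrM -[leRHS]mulr1; apply: ler_pM => //; first exact: profile_a.
  by apply: le_trans (coord_le_enorm _ _) _; exact: ltW.
- move=> j; split; first by have [] := radial_is_derive2' i j x1.
  apply: (near_continuous x1 (fun y => @radial_D2 y i j)).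
  have [->|x01] := profile_cases x1; last first.
    apply: continuousD; first by apply: continuousM; [exact: cst_continuous|exact: radial_a_cont].
    by apply: continuousM; [apply: continuousM; exact: coord_continuous|exact: radial_b_cont].
  apply: (@continuous_at0_enorm _ (3 * K)); last first.
    by rewrite !mxE !mul0r addr0 enorm0 /a invr0 !mulr0.
  move=> y /profile_cases[->|y01].
    by rewrite !mxE !mul0r addr0 enorm0 /a invr0 !mulr0 normr0.
  have /andP[y0 y1] := y01.
  have -> : 3 * K * enorm y = K * enorm y + 2 * K * enorm y by ring.
  apply: le_trans (ler_normD _ _) _; apply: lerD.
    rewrite normrM; apply: le_trans (profile_a y01).
    by case: (i == j); rewrite ?normr1 ?normr0 ?mul1r ?mul0r.
  apply: le_trans (profile_b y01); rewrite !normrM ler_wpM2r // (gtr0_norm y0).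
  by rewrite ler_pM // coord_le_enorm.
Qed.

(** The eigenvalues are [s / r], [n - 1] times, and [ds]. *)
Lemma radial_hessian_S x i : unit_ball x -> (0 < i)%N -> (0 < n)%N ->
  hessian_S i v x = if enorm x == 0 then 0 else
    'C(n.-1, i)%:R * a (enorm x) ^+ i + 'C(n.-1, i.-1)%:R * a (enorm x) ^+ i.-1 * ds (enorm x).
Proof.
move=> x1 i0 n0; rewrite /hessian_S eigenvalues_symmetric; last exact: hessian_sym radial_C2 _ x1.
set al := a (enorm x); set be := b (enorm x).
have -> : hessian v x = diag_mx (const_mx al) + (be *: x^T) *m x.
  apply/matrixP => p r; rewrite !mxE radial_D2 // big_ord1 !mxE /= -/al -/be.
  by rewrite mulr_natl; congr (_ + _); ring.
rewrite minor_poly_diag_rank1.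
have -> : \prod_(i0 < n) (1 + (const_mx al : 'rV[R]_n) 0 i0 *: 'X) = (1 + al *: 'X) ^+ n :> {poly R}.
  by under eq_bigr do rewrite mxE; rewrite prodr_const card_ord.
have -> : \sum_(i0 < n) ((be *: x^T) i0 0 * x 0 i0) *:
    \prod_(j < n | j != i0) (1 + (const_mx al : 'rV[R]_n) 0 j *: 'X) =
    (be * sqnorm x) *: (1 + al *: 'X) ^+ n.-1 :> {poly R}.
  rewrite /sqnorm mulr_sumr scaler_suml; apply: eq_bigr => p _.
  rewrite !mxE -mulrA -expr2; congr (_ *: _).
  under eq_bigr do rewrite mxE.
  by rewrite prodr_const cardC1 card_ord.
have cX (m c : nat) : ((1 + al *: 'X : {poly R}) ^+ m)`_c = 'C(m, c)%:R * al ^+ c.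
  rewrite exprDn coef_sum.
  have E (p : 'I_m.+1) : (1 ^+ (m - p) * (al *: 'X) ^+ p *+ 'C(m, p) : {poly R})`_c =
      if (p == c :> nat) then 'C(m, c)%:R * al ^+ c else 0.
    rewrite expr1n mul1r exprZn coefMn coefZ coefXn eq_sym.
    by case: eqP => [->|_]; rewrite ?mulr1 ?mulr_natl // mulr0 mul0rn.
  under eq_bigr do rewrite E.
  have [cm|mc] := leqP c m; last first.
    rewrite bin_small // mul0r big1 // => p _.
    by case: eqP => // pc; move: (ltn_ord p); rewrite pc ltnS leqNgt mc.
  rewrite (bigD1 (Ordinal (cm : c < m.+1)%N)) //= eqxx big1 ?addr0 // => p pc.
  by case: eqP => // pc'; case/eqP: pc; apply: val_inj.
have EB c : 'C(n, c.+1) = ('C(n.-1, c.+1) + 'C(n.-1, c))%N by rewrite -{1}(prednK n0) binS.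
case: i i0 => // i _; rewrite coefD coefXM /= coefZ !cX EB natrD.
have [x0|x0] := eqVneq (enorm x) 0.
  rewrite /al /a x0 invr0 mulr0 expr0n /= mulr0 add0r -enorm_sqr x0 expr0n /= mulr0 mul0r //.
have -> : be * sqnorm x = ds (enorm x) - al.
  by rewrite /be /b -enorm_sqr divfK ?expf_neq0.
by rewrite exprS; move: (ds _) => q; ring.
Qed.

End Profile.
End RadialFunctions.


(** * Primitives and monotone functions *)

Section Primitive.
Context {R : realType}.
Implicit Types (f F : R -> R).

Lemma MVT_oo f (df : R -> R) (a b : R) : a < b ->
  (forall x : R, a <= x <= b -> {for x, continuous f}) ->
  (forall x : R, a < x < b -> is_derive x 1 f (df x)) ->
  exists c, [/\ a < c, c < b & f b - f a = df c * (b - a)].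
Proof.
move=> ab cf H.
have [c] : exists2 c, c \in `]a, b[%R & f b - f a = df c * (b - a).
  apply: (@MVT R f df a b ab).
  by apply: continuous_in_subspaceT => x /set_mem /= /itvP xab; apply: cf; rewrite !xab.
by move=> /itvP cab ->; exists c; rewrite !cab.
Qed.

Lemma derive_ge0_le f (df : R -> R) (a b : R) : a <= b ->
  (forall x : R, a <= x <= b -> {for x, continuous f}) ->
  (forall x : R, a < x < b -> is_derive x 1 f (df x)) ->
  (forall x : R, a < x < b -> 0 <= df x) -> f a <= f b.
Proof.
rewrite le_eqVlt => /orP[/eqP-> //|ab] cf H H0.
have [c [ac cb E]] := MVT_oo ab cf H.
by rewrite -subr_ge0 E mulr_ge0 ?H0 ?ac // subr_ge0 ltW.
Qed.

(** Primitive vanishing at [0] of a function that is zero on the negative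
    half-line; starting at [-1] makes it differentiable at [0] as well. *)
Definition prim f (r : R) : R := (\int[lebesgue_measure]_(t in `[(-1)%R, r]) f t)%R.

Lemma prim_le0 f (r : R) : (forall t : R, t <= 0 -> f t = 0) -> r <= 0 -> prim f r = 0.
Proof.
move=> H r0; rewrite /prim /Rintegral integral0_eq // => t /= /itvP tr.
by rewrite H // (le_trans _ r0) // tr.
Qed.

Lemma prim_is_derive f (r : R) : continuous f -> (forall t : R, t <= 0 -> f t = 0) ->
  is_derive r 1 (prim f) (f r).
Proof.
move=> cf H; have [r0|r0] := ltP r 0.
  rewrite H ?ltW //; apply: (near_eq_is_derive _ (dderC 0 r 1)).
  by near=> t; rewrite prim_le0 //; apply: ltW; near: t; exact: lt_nbhsl.
have r1 : r < r + 1 by rewrite ltrDl.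
have [|||D1 D2] := @continuous_FTC1_closed R f (-1) r (r + 1) r1.
- apply: continuous_compact_integrable; first exact: segment_compact.
  by apply: continuous_subspaceT.
- by apply: lt_le_trans r0; rewrite oppr_lt0.
- exact: cf.
by rewrite derive1E in D2; exact: (DeriveDef D1 D2).
Unshelve. all: by end_near. Qed.

Lemma prim_continuous f : continuous f -> (forall t : R, t <= 0 -> f t = 0) ->
  continuous (prim f).
Proof. by move=> cf H x; exact: dder_continuous (prim_is_derive x cf H). Qed.

Lemma prim_incr f (a b : R) : continuous f -> (forall t : R, t <= 0 -> f t = 0) ->
  a <= b -> (forall t : R, a < t < b -> 0 <= f t) -> prim f a <= prim f b.
Proof.
move=> cf H ab f0; apply: (derive_ge0_le ab) f0 => x _.
  exact: prim_continuous.
exact: prim_is_derive.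
Qed.

Lemma prim_le f g (a b : R) : continuous f -> (forall t : R, t <= 0 -> f t = 0) ->
  continuous g -> (forall t : R, t <= 0 -> g t = 0) ->
  a <= b -> (forall t : R, a < t < b -> f t <= g t) ->
  prim f b - prim f a <= prim g b - prim g a.
Proof.
move=> cf Hf cg Hg ab fg.
suff : prim g a - prim f a <= prim g b - prim f b by rewrite lerBlDr; lra.
apply: (@derive_ge0_le (fun t => prim g t - prim f t) (fun t => g t - f t)) => //.
- by move=> x _; apply: continuousB; exact: prim_continuous.
- by move=> x _; apply: dderB; exact: prim_is_derive.
- by move=> x /fg; rewrite subr_ge0.
Qed.

Lemma prim_le_0 f g (b : R) : continuous f -> (forall t : R, t <= 0 -> f t = 0) ->
  continuous g -> (forall t : R, t <= 0 -> g t = 0) ->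
  0 <= b -> (forall t : R, 0 < t < b -> f t <= g t) -> prim f b <= prim g b.
Proof.
move=> cf Hf cg Hg b0 fg; have := prim_le cf Hf cg Hg b0 fg.
rewrite (prim_le0 Hf (lexx 0)) (prim_le0 Hg (lexx 0)).
by move: (prim f b) (prim g b) => x y; rewrite !subr0.
Qed.

End Primitive.

Opaque prim.

(** * Auxiliary facts on real functions *)

Section RealFunctions.
Context {R : realType}.

Lemma derive1_is (f : R -> R) (x d : R) : is_derive x 1 f d -> derive1 f x = d.
Proof. by move=> [_ H]; rewrite derive1E. Qed.

Lemma has_deriv_within_eps (A : set R) (f : R -> R) (x d e : R) :
  has_deriv_within A f x d -> 0 < e ->
  exists2 de : R, 0 < de & forall y : R, A y -> `|y - x| < de ->
    `|f y - f x - d * (y - x)| <= e * `|y - x|.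
Proof.
move=> H e0.
have N : \forall y \near within A x^', `|d - (f y - f x) / (y - x)| <= e.
  by move/cvgrPdist_le : H => /(_ e e0).
rewrite /within /= in N; move: N => /nbhs_ballP[de /= de0 Hd].
exists de => // y Ay yx; have [->|yx0] := eqVneq y x; first by rewrite !subrr mulr0 subrr normr0 mulr0.
have yb : ball x de y by rewrite -ball_normE /= distrC.
have := Hd y yb yx0 Ay; have yx1 : y - x != 0 by rewrite subr_eq0.
move=> h; have -> : f y - f x - d * (y - x) = - ((d - (f y - f x) / (y - x)) * (y - x)) by field.
by rewrite normrN normrM ler_wpM2r.
Qed.

Lemma deriv_within (A : set R) (f : R -> R) (x d : R) :
  is_derive x 1 f d -> has_deriv_within A f x d.
Proof.
move=> /is_derive_epsP H; rewrite /has_deriv_within.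
have C : (f y - f x) / (y - x) @[y --> x^'] --> d.
  apply/cvgrPdist_le => e e0; have [de de0 Hd] := H e e0.
  near=> y.
  have yx : y != x by near: y; exact: nbhs_dnbhs_neq.
  have yd : `|y - x| < de.
    rewrite distrC; near: y; apply: cvg_within.
    by apply/nbhs_ballP; exists de => // z; rewrite -ball_normE.
  have yx0 : y - x != 0 by rewrite subr_eq0.
  have := Hd _ yd; rewrite [_%:A]mulr1 [x + _]addrC subrK => h.
  rewrite -(ler_pM2r (_ : 0 < `|y - x|)) ?normr_gt0 //; apply: le_trans h.
  rewrite -normrM -normrN; apply: eq_imply_le; congr `|_|.
  by field.
by apply: cvg_trans C; apply: cvg_app; exact: cvg_within.
Unshelve. all: by end_near. Qed.

Lemma eq_pos_continuous (f g : R -> R) (x : R) : 0 < x -> (forall r, 0 < r -> f r = g r) ->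
  {for x, continuous g} -> {for x, continuous f}.
Proof.
move=> x0 fg cg; apply: eps_continuous => e e0; have [d d0 Hd] := continuous_eps cg e0.
exists (Num.min d x); first by rewrite lt_min d0.
move=> y; rewrite lt_min => /andP[/Hd h yx]; rewrite !fg //.
by move: yx; rewrite ltr_norml => /andP[+ _]; rewrite ltrBrDr addrC subrr.
Qed.

Lemma lipschitz_abs_continuous (f : R -> R) (a b K : R) :
  (forall x y : R, a <= x -> x <= y -> y <= b -> `|f y - f x| <= K * (y - x)) -> abs_continuous a b f.
Proof.
move=> H e e0; pose K' := `|K| + 1.
have K0 : 0 < K' by rewrite ltr_wpDl.
exists (e / K'); first by rewrite divr_gt0.
move=> N x y xy _; rewrite ltr_pdivlMr // => h; apply: le_lt_trans h.
rewrite mulr_suml; apply: ler_sum => i _; have [ax xyi yb] := xy i (ltn_ord i).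
apply: le_trans (H _ _ ax xyi yb) _; rewrite mulrC ler_wpM2l ?subr_ge0 //.
by rewrite /K' (le_trans (ler_norm K)) // lerDl.
Qed.

(** A nondecreasing function on (0,1) that is [O(r)] at the origin is
    nonnegative. *)
Lemma vanishing_origin_ge0 (f df : R -> R) (K r : R) :
  (forall x : R, 0 < x < 1 -> is_derive x 1 f (df x)) ->
  (forall x : R, 0 < x < 1 -> 0 <= df x) ->
  (forall x : R, 0 < x < 1 -> `|f x| <= K * x) -> 0 < r < 1 -> 0 <= f r.
Proof.
move=> Df df0 fK /andP[r0 r1]; rewrite leNgt; apply/negP => fr.
have K1 : 0 < `|K| + 1 by rewrite ltr_wpDl.
(* At this point the bound on |f s| is smaller than |f r|. *)
pose s := Num.min (r / 2) (- f r / (`|K| + 1) / 2).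
have e0 : 0 < - f r / (`|K| + 1) / 2 by rewrite !divr_gt0 // oppr_gt0.
have s0 : 0 < s by rewrite lt_min e0 divr_gt0.
have sr : s < r by rewrite gt_min ltr_pdivrMr // ltr_pMr // ltr1n.
have s1 := lt_trans sr r1.
have H : f s <= f r.
  apply: (@derive_ge0_le R f df s r (ltW sr)).
  - move=> x /andP[sx xr]; apply: (@dder_continuous R f x (df x)); apply: Df.
    by rewrite (lt_le_trans s0 sx) (le_lt_trans xr r1).
  - by move=> x /andP[sx xr]; apply: Df; rewrite (lt_trans s0 sx) (lt_trans xr r1).
  - by move=> x /andP[sx xr]; apply: df0; rewrite (lt_trans s0 sx) (lt_trans xr r1).
have s01 : 0 < s < 1 by rewrite s0.
have := fK s s01; rewrite ler_norml => /andP[h _].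
have se : s <= - f r / (`|K| + 1) / 2 by rewrite ge_min lexx orbT.
rewrite -mulrA -invfM ler_pdivlMr ?mulr_gt0 // in se.
have Ks' : K * s <= `|K| * s by rewrite ler_wpM2r ?(ltW s0) // ler_norm.
have ks0 : 0 <= `|K| * s by rewrite mulr_ge0 // ltW.
have E : s * ((`|K| + 1) * 2) = 2 * (`|K| * s) + 2 * s by ring.
rewrite E in se; move: H h se Ks' ks0 fr s0.
by move: (f s) (f r) (`|K| * s) (K * s) (s : R) => a b k' c' d H h se Ks' ks0 fr s0; lra.
Qed.

Lemma shift_neg (x h : R) : h < 0 -> - x < h -> x + h < x /\ 0 < x + h.
Proof. by move=> h0 xh; split; lra. Qed.

Lemma shift_pos (x h : R) : 0 < h -> h < 1 - x -> x < x + h /\ x + h < 1.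
Proof. by move=> h0 xh; split; lra. Qed.

(** If the secant slopes [- (w' - w) / h] lie between [g1] and [g2], both close
    to [g], then [- g] is the derivative up to [e]; [h] negative here, positive in
    [secant_pos]. *)
Lemma secant_neg (e g g1 g2 w w' x h : R) : h < 0 -> `|g1 - g| <= e -> `|g2 - g| <= e ->
  g1 * (x - (x + h)) <= w' - w /\ w' - w <= g2 * (x - (x + h)) ->
  `|w' - w - - g * h| <= e * `|h|.
Proof.
move=> h0; have -> : x - (x + h) = - h by ring.
rewrite !ler_norml ltr0_norm // => /andP[a1 a2] /andP[b1 b2] [c1 c2].
have p1 : (g - e) * - h <= g1 * - h by rewrite ler_wpM2r; lra.
have p2 : g2 * - h <= (g + e) * - h by rewrite ler_wpM2r; lra.
by apply/andP; split; lra.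
Qed.

Lemma secant_pos (e g g1 g2 w w' x h : R) : 0 < h -> `|g1 - g| <= e -> `|g2 - g| <= e ->
  g2 * (x + h - x) <= w - w' /\ w - w' <= g1 * (x + h - x) ->
  `|w' - w - - g * h| <= e * `|h|.
Proof.
move=> h0; have -> : x + h - x = h by ring.
rewrite !ler_norml gtr0_norm // => /andP[a1 a2] /andP[b1 b2] [c1 c2].
have p1 : (g - e) * h <= g2 * h by rewrite ler_wpM2r; lra.
have p2 : g1 * h <= (g + e) * h by rewrite ler_wpM2r; lra.
by apply/andP; split; lra.
Qed.

Lemma nondecreasing_le_lim (u : nat -> R) (l : R) :
  (forall i j, (i <= j)%N -> u i <= u j) -> u j @[j --> \oo] --> l -> forall j, u j <= l.
Proof.
move=> H ul j; apply: (@ler_cvg_to _ _ _ _ (fun=> u j) u) ul _; first exact: cvg_cst.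
by near=> i; apply: H; near: i; exact: nbhs_infty_ge.
Unshelve. all: by end_near. Qed.

Lemma limit_le (u v : nat -> R) (a b : R) : u j @[j --> \oo] --> a -> v j @[j --> \oo] --> b ->
  (forall j, u j <= v j) -> a <= b.
Proof. by move=> ua vb uv; apply: (ler_cvg_to ua vb); near=> j. Unshelve. all: by end_near. Qed.

(** Projection of the line on [0,1]; composing with it extends functions on
    [0,1] continuously to the line. *)
Definition clamp (r : R) : R := Num.min (Num.max r 0) 1.

Lemma clamp_ge0 (r : R) : 0 <= clamp r.
Proof. by rewrite /clamp le_min ler01 le_max lexx orbT. Qed.

Lemma clamp_le1 (r : R) : clamp r <= 1.
Proof. by rewrite /clamp ge_min lexx orbT. Qed.

Lemma clamp_id (r : R) : 0 <= r -> r <= 1 -> clamp r = r.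
Proof. by move=> r0 r1; rewrite /clamp max_l // min_l. Qed.

Lemma clamp_cases (r : R) :
  [\/ r <= 0 /\ clamp r = 0, (0 <= r /\ r <= 1) /\ clamp r = r | 1 <= r /\ clamp r = 1].
Proof.
have [r0|r0] := leP r 0; first by apply: Or31; rewrite /clamp max_r // min_l.
have r0w := ltW r0; have [r1|r1] := leP r 1; first by apply: Or32; rewrite clamp_id.
by have r1w := ltW r1; apply: Or33; rewrite /clamp max_l // min_r.
Qed.

Lemma clamp_lipschitz (x y : R) : `|clamp x - clamp y| <= `|x - y|.
Proof.
wlog xy : x y / x <= y.
  move=> H; have [/H//|/ltW/H] := leP x y.
  by rewrite distrC [in leRHS]distrC.
have xy0 : x - y <= 0 by rewrite subr_le0.
rewrite (ler0_norm xy0) ler_norml; apply/andP.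
by case: (clamp_cases x) => -[hx ->]; case: (clamp_cases y) => -[hy ->]; move: hx hy => //=;
  intuition lra.
Qed.

Lemma clamp_continuous : continuous clamp.
Proof.
move=> x; apply: eps_continuous => e e0; exists e => // y yx.
exact: le_trans (clamp_lipschitz y x) (ltW yx).
Qed.

Lemma max0_lipschitz (x y : R) : `|Num.max y 0 - Num.max x 0| <= `|y - x|.
Proof.
have h1 := ler_norm (y - x); have h2 := ler_norm (x - y); rewrite distrC in h2.
rewrite ler_norml; move: `|y - x| h1 h2 => p h1 h2.
by apply/andP; case: (leP x 0) => hx; case: (leP y 0) => hy; split; lra.
Qed.

End RealFunctions.



(** * The radial integral operator *)

Section PowerLemmas.
Context {R : realType}.

Lemma powR_continuous (q x : R) : 0 < x -> {for x, continuous (fun t : R => t `^ q)}.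
Proof. by move=> x0; exact: dder_continuous (is_derive1_powR q x0). Qed.

Lemma powR_le (q x y : R) : 0 <= q -> 0 <= x -> x <= y -> x `^ q <= y `^ q.
Proof.
by move=> q0 x0 xy; apply: ge0_ler_powR => //; rewrite nnegrE // (le_trans x0).
Qed.

Lemma powR_ge1 (q x : R) : 0 <= q -> 1 <= x -> 1 <= x `^ q.
Proof.
move=> q0 x1; have -> : 1 = 1 `^ q :> R by rewrite powR1.
exact: powR_le.
Qed.

Lemma root_powK (k : nat) (x : R) : (0 < k)%N -> 0 <= x -> (x `^ (k%:R^-1)) ^+ k = x.
Proof.
move=> k0 x0; rewrite -powR_mulrn ?powR_ge0 // -powRrM mulVf ?powRr1 //.
by rewrite pnatr_eq0 -lt0n.
Qed.

Lemma root_le (k : nat) (x y : R) : 0 <= x -> x <= y -> x `^ (k%:R^-1) <= y `^ (k%:R^-1).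
Proof. by move=> x0 xy; apply: powR_le => //; rewrite invr_ge0. Qed.

Lemma root_expr (k : nat) (x : R) : (0 < k)%N -> 0 <= x -> (x ^+ k) `^ (k%:R^-1) = x.
Proof.
move=> k0 x0; rewrite -powR_mulrn // -powRrM divff ?powRr1 //.
by rewrite pnatr_eq0 -lt0n.
Qed.

Lemma continuous_max1 (w : R -> R) x : {for x, continuous w} ->
  {for x, continuous (fun s => Num.max 1 (w s))}.
Proof.
move=> cw; apply: (@continuous_max R _ (fun=> 1) w); [exact: cst_continuous|exact: cw].
Qed.

Lemma powR_step (p x : R) : 0 < x -> x `^ p = x * x `^ (p - 1).
Proof.
move=> x0; have E : p = 1 + (p - 1) by ring.
have H : x `^ (1 + (p - 1)) = x `^ 1 * x `^ (p - 1).
  by apply: powRD; rewrite (lt0r_neq0 x0) implybT.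
by rewrite {1}E H (powRr1 (ltW x0)).
Qed.

Lemma exists_bound (w : R -> R) : continuous w ->
  exists M : R, forall s, 0 < s -> s < 1 -> Num.max 1 (w s) <= M.
Proof.
move=> cw; have cm : {within `[0 : R, 1], continuous (fun s => Num.max 1 (w s))}.
  by apply: continuous_subspaceT => x; apply: continuous_max1; exact: cw.
have [c' _ Hc] := EVT_max ler01 cm.
by exists (Num.max 1 (w c')) => s s0 s1; apply: Hc; rewrite in_itv /= !ltW.
Qed.

End PowerLemmas.

(** [rho_le] says that the weight vanishes at the origin to order [2k]; [rho_ge]
    says that it does not decrease too fast from [r] to [r/2]. *)
Section RadialOperator.
Context {R : realType}.
Variables (n k : nat) (q L kap : R) (rho : R -> R).
Hypotheses (hk : (0 < k)%N) (hn : (2 * k < n)%N) (q0 : 0 < q).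
Hypothesis rho_cont : continuous (fun s : R => rho (Num.max s 0)).
Hypothesis rho_gt0 : forall r : R, 0 < r -> 0 < rho r.
Hypothesis rho_le : forall r : R, 0 <= r -> r <= 1 -> rho r <= L * r ^+ (2 * k).
Hypothesis kap0 : 0 < kap.
Hypothesis rho_ge : forall r s : R, 0 < r -> r <= 1 -> r / 2 <= s -> s <= r -> kap * rho r <= rho s.

Local Notation c := (@c_nk R n k).
Implicit Types (r s : R) (w : R -> R).

Lemma kn_lt : (k < n)%N.
Proof. by apply: leq_ltn_trans hn; rewrite leq_pmull. Qed.

Lemma n_gt0 : (0 < n)%N. Proof. exact: leq_trans kn_lt. Qed.

Lemma c_gt0 : 0 < c.
Proof. by rewrite /c_nk divr_gt0 // ltr0n ?bin_gt0 ?n_gt0 // ltnW // kn_lt. Qed.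

Lemma rho_ge0 r : 0 <= r -> 0 <= rho r.
Proof.
rewrite le_eqVlt => /orP[/eqP<-|/rho_gt0/ltW //].
rewrite leNgt; apply/negP => r0.
have e0 : 0 < - rho 0 / 2 by rewrite divr_gt0 // oppr_gt0.
have [d d0 Hd] := continuous_eps (rho_cont (x := 0)) e0.
have := Hd (d / 2); rewrite maxxx subr0 gtr0_norm ?divr_gt0 // ltr_pdivrMr // ltr_pMr // ltr1n.
have d20 : 0 <= d / 2 by apply: ltW; rewrite divr_gt0.
move=> /(_ isT); rewrite (max_l d20) ler_norml => /andP[_].
have := rho_gt0 (divr_gt0 d0 (ltr0Sn R 1)); move: (rho _) r0 => a; move: (rho 0) => b; lra.
Qed.

(** The integrand [s^(n-1) rho(s) w(s)^q], extended by [0] to the negative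
    half-line; truncating [w] from below by [1] makes it monotone in [w]
    unconditionally. *)
Definition src (w : R -> R) (s : R) : R :=
  Num.max s 0 ^+ (n - 1) * rho (Num.max s 0) * Num.max 1 (w s) `^ q.

Lemma n1_gt0 : (0 < n - 1)%N.
Proof. by rewrite subn_gt0 (leq_trans _ kn_lt) // ltnS. Qed.

Lemma src_le0 w (s : R) : s <= 0 -> src w s = 0.
Proof. by move=> s0; rewrite /src max_r // expr0n gtn_eqF ?n1_gt0 // !mul0r. Qed.

Lemma srcE w (s : R) : 0 <= s -> 1 <= w s -> src w s = s ^+ (n - 1) * rho s * w s `^ q.
Proof. by move=> s0 w1; rewrite /src max_l // max_r. Qed.

Lemma max1_ge1 (a : R) : 1 <= Num.max 1 a. Proof. by rewrite le_max lexx. Qed.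

Lemma max1_gt0 (a : R) : 0 < Num.max 1 a. Proof. exact: lt_le_trans (max1_ge1 a). Qed.

Lemma src_ge0 w s : 0 <= src w s.
Proof.
rewrite /src mulr_ge0 ?powR_ge0 // mulr_ge0 ?exprn_ge0 ?rho_ge0 // le_max lexx orbT //.
Qed.

Lemma src_gt0 w s : 0 < s -> 0 < src w s.
Proof.
move=> s0; rewrite /src max_l ?ltW // mulr_gt0 ?powR_gt0 ?max1_gt0 //.
by rewrite mulr_gt0 ?exprn_gt0 ?rho_gt0.
Qed.

Lemma src_continuous w : continuous w -> continuous (src w).
Proof.
move=> cw s.
have c1 : {for s, continuous (fun t : R => Num.max t 0 ^+ (n - 1))}.
  apply: (@continuous_comp _ _ _ (fun s : R => Num.max s 0) (fun t : R => t ^+ (n - 1))).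
    by apply: (@continuous_max R _ id (fun=> 0)); [exact: cvg_id|exact: cst_continuous].
  exact: dder_continuous (dderX (n - 1) (dder_id _)).
have c2 : {for s, continuous (fun t : R => Num.max 1 (w t) `^ q)}.
  apply: (@continuous_comp _ _ _ (fun s : R => Num.max 1 (w s)) (fun t : R => t `^ q)).
    by apply: continuous_max1; exact: cw.
  by apply: powR_continuous; exact: max1_gt0.
exact: (cvgM (cvgM c1 (@rho_cont s)) c2).
Qed.

Lemma src_mono w1 w2 s : (0 < s -> w1 s <= w2 s) -> src w1 s <= src w2 s.
Proof.
move=> H; have [s0|s0] := leP s 0; first by rewrite !src_le0.
rewrite /src ler_wpM2l ?mulr_ge0 ?exprn_ge0 ?rho_ge0 ?le_max ?lexx ?orbT //.
apply: powR_le; [exact: ltW|exact: ltW (max1_gt0 _)|].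
by rewrite ge_max max1_ge1 le_max H ?orbT.
Qed.

(** [flux w r] is the integral of the source from [0] to [r]. *)
Definition flux w := prim (src w).

Section Flux.
Variable w : R -> R.
Hypothesis cw : continuous w.

Lemma flux_is_derive r : is_derive r 1 (flux w) (src w r).
Proof. by apply: prim_is_derive; [exact: src_continuous|exact: src_le0]. Qed.

Lemma flux_le0 r : r <= 0 -> flux w r = 0.
Proof. by move=> r0; apply: prim_le0 => //; exact: src_le0. Qed.

Lemma flux_gt0 r : 0 < r -> 0 < flux w r.
Proof.
move=> r0; have [c' [c0 cr E]] := @MVT_point R (flux w) (src w) 0 r r0 (fun x _ => flux_is_derive x).
rewrite (flux_le0 (lexx 0)) !subr0 in E; rewrite E mulr_gt0 // src_gt0 //.
Qed.

Lemma flux_ge0 r : 0 <= flux w r.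
Proof. by have [/flux_le0->//|/flux_gt0/ltW] := leP r 0. Qed.

Lemma flux_continuous : continuous (flux w).
Proof. by move=> x; exact: dder_continuous (flux_is_derive x). Qed.

End Flux.

Lemma flux_mono w1 w2 r : continuous w1 -> continuous w2 ->
  (forall s, 0 < s -> s < r -> w1 s <= w2 s) -> flux w1 r <= flux w2 r.
Proof.
move=> c1 c2 H; have [r0|r0] := leP r 0; first by rewrite !flux_le0.
apply: (prim_le_0 (src_continuous c1) (@src_le0 w1) (src_continuous c2) (@src_le0 w2) (ltW r0)).
move=> t /andP[t0 tr].
by apply: src_mono => _; exact: H.
Qed.

(** The value of [u'(r)] prescribed by the integrated equation
    [c r^(n-k) u'^k = lam flux] when [1 - u = w]; zero for [r <= 0]. *)
Definition slope (lam : R) w (r : R) : R :=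
  if r <= 0 then 0 else (lam / c * flux w r / r ^+ (n - k)) `^ (k%:R^-1).

(** [Phi lam w r = 1 + int_r^1 slope lam w]: a function [u] with [u(1) = 0]
    solves the radial problem when [w = 1 - u] is a fixed point. *)
Definition Phi (lam : R) w (r : R) : R := 1 + prim (slope lam w) 1 - prim (slope lam w) r.

(** Derivative of the slope at positive radii. *)
Definition dslope (lam : R) w (r : R) : R :=
  slope lam w r / k%:R * (src w r / flux w r - (n - k)%:R / r).

Section Slope.
Variables (lam : R) (w : R -> R) (M : R).
Hypotheses (lam0 : 0 < lam) (cw : continuous w).
Hypothesis wM : forall s : R, 0 < s -> s < 1 -> Num.max 1 (w s) <= M.

Lemma T_gt0 (r : R) : 0 < r -> 0 < lam / c * flux w r / r ^+ (n - k).
Proof. by move=> r0; rewrite !divr_gt0 ?mulr_gt0 ?exprn_gt0 ?invr_gt0 ?c_gt0 ?flux_gt0. Qed.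

Lemma slope_ge0 r : 0 <= slope lam w r.
Proof. by rewrite /slope; case: ifP => // _; exact: powR_ge0. Qed.

Lemma slope_gt0 r : 0 < r -> 0 < slope lam w r.
Proof. by move=> r0; rewrite /slope leNgt r0 /= powR_gt0 // T_gt0. Qed.

Lemma slope_le0 r : r <= 0 -> slope lam w r = 0.
Proof. by rewrite /slope => ->. Qed.

Lemma slope_expr r : 0 < r -> slope lam w r ^+ k = lam / c * flux w r / r ^+ (n - k).
Proof. by move=> r0; rewrite /slope leNgt r0 /= root_powK // ltW // T_gt0. Qed.

Lemma slope_is_derive r : 0 < r -> is_derive r 1 (slope lam w) (dslope lam w r).
Proof.
move=> r0.
pose T (t : R) := lam / c * flux w t / t ^+ (n - k).
have rn : r ^+ (n - k) != 0 by rewrite expf_neq0 // gt_eqF.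
have F0 := flux_gt0 cw r0.
have dT : is_derive r 1 T (T r * (src w r / flux w r - (n - k)%:R / r)).
  apply: (dder_eq (dderM (dderZ _ (flux_is_derive cw r)) (@dderV R (fun t => t ^+ (n - k)) r _ rn (dderX (n - k) (dder_id r))))).
  have nk0 : (0 < n - k)%N by rewrite subn_gt0 kn_lt.
  rewrite /T -(prednK nk0) /= exprS; have rp := exprn_gt0 (n - k).-1 r0.
  by move: (lam / c) => lc; field; rewrite !gt_eqF.
have H := dder_comp dT (is_derive1_powR (k%:R^-1) (T_gt0 r0)).
have E : k%:R^-1 * T r `^ (k%:R^-1 - 1) * (T r * (src w r / flux w r - (n - k)%:R / r)) = dslope lam w r.
  rewrite /dslope /slope leNgt r0 /= -/(T r).
  have := @mulr_powRB1 R (T r) (k%:R^-1) (ltW (T_gt0 r0)); rewrite invr_gt0 ltr0n hk => /(_ isT) <-.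
  by move: (_ - _ : R) (_ `^ _) => p1 p2; ring.
rewrite -E; apply: near_eq_is_derive H; near=> t.
have t0 : 0 < t by near: t; exact: lt_nbhsr.
by rewrite /slope leNgt t0.
Unshelve. all: by end_near. Qed.

Lemma L_ge0 : 0 <= L.
Proof. by have := rho_le ler01 (lexx 1); rewrite expr1n mulr1; apply: le_trans; rewrite ltW // rho_gt0. Qed.

Lemma flux_upper r : 0 < r -> r <= 1 -> flux w r <= L * M `^ q * r ^+ (n + 2 * k).
Proof.
move=> r0 r1; have [t [t0 tr E]] := @MVT_point R (flux w) (src w) 0 r r0 (fun x _ => flux_is_derive cw x).
rewrite (flux_le0 w (lexx 0)) !subr0 in E; rewrite E.
have -> : L * M `^ q * r ^+ (n + 2 * k) = r ^+ (n - 1) * (L * r ^+ (2 * k)) * M `^ q * r.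
  rewrite -{1}(subnK n_gt0) addn1 addSn exprS exprD; ring.
have rw := ltW r0; have tw := ltW t0; have trw := ltW tr.
apply: ler_wpM2r => //; rewrite /src (max_l tw); apply: ler_pM.
- by rewrite mulr_ge0 ?exprn_ge0 ?rho_ge0.
- exact: powR_ge0.
- apply: ler_pM; rewrite ?exprn_ge0 ?rho_ge0 //.
    by rewrite lerXn2r ?nnegrE.
  apply: le_trans (rho_le tw (le_trans trw r1)) _.
  by rewrite ler_wpM2l ?L_ge0 // lerXn2r ?nnegrE.
- apply: powR_le; [exact: ltW|exact: ltW (max1_gt0 _)|].
  by apply: wM => //; exact: lt_le_trans r1.
Qed.

(** Constant of the bound [slope <= Ks r^3]. *)
Definition Ks : R := (lam / c * (L * M `^ q)) `^ (k%:R^-1).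

Lemma Ks_ge0 : 0 <= Ks. Proof. exact: powR_ge0. Qed.

(** As [rho = O(r^(2k))], the flux is [O(r^(n+2k))] and the slope is [O(r^3)]. *)
Lemma slope_upper r : 0 < r -> r <= 1 -> slope lam w r <= Ks * r ^+ 3.
Proof.
move=> r0 r1; have rw := ltW r0; have cw0 := ltW c_gt0; have lw := ltW lam0; have L0 := L_ge0.
rewrite -[leLHS](@root_expr R k) ?slope_ge0 // slope_expr //.
rewrite -[r ^+ 3](@root_expr R k) ?exprn_ge0 // /Ks -powRM ?exprn_ge0 //; last first.
  by rewrite !mulr_ge0 ?powR_ge0 ?invr_ge0.
apply: root_le; first exact: ltW (T_gt0 r0).
rewrite ler_pdivrMr ?exprn_gt0 // -!mulrA; apply: ler_wpM2l => //.
apply: ler_wpM2l; first by rewrite invr_ge0.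
rewrite -!exprM -exprD mulrA.
have -> : (3 * k + (n - k) = n + 2 * k)%N.
  by rewrite -{2}(subnK (ltnW kn_lt)) addnC -addnA -mulSn.
exact: flux_upper.
Qed.

Lemma slope_continuous : continuous (slope lam w).
Proof.
move=> r; have [r0|r0|r0] := ltgtP r 0.
- apply: (@dder_continuous _ _ _ 0); apply: (near_eq_is_derive _ (dderC 0 r 1)).
  by near=> t; rewrite slope_le0 // ltW //; near: t; exact: lt_nbhsl.
- exact: dder_continuous (slope_is_derive r0).
rewrite r0; apply: eps_continuous => e e0.
have K1 : 0 < Ks + 1 by rewrite ltr_wpDl ?Ks_ge0.
exists (Num.min 1 (e / (Ks + 1))); first by rewrite lt_min ltr01 divr_gt0.
move=> t; rewrite subr0 lt_min => /andP[t1 te]; rewrite [slope _ _ 0]slope_le0 // subr0.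
have [t0|t0] := leP t 0; first by rewrite slope_le0 // normr0 ltW.
rewrite gtr0_norm // in t1 te; rewrite ger0_norm ?slope_ge0 //.
apply: le_trans (slope_upper t0 (ltW t1)) _.
rewrite ltr_pdivlMr // in te; apply: le_trans (ltW te); rewrite mulrC.
have tw := ltW t0; apply: ler_pM; rewrite ?exprn_ge0 ?Ks_ge0 ?lerDl //.
by rewrite exprS ger_pMr // exprn_ile1 // ltW.
Unshelve. all: by end_near. Qed.

(** The source term in the derivative of the slope is nonnegative; this
    one-sided bound yields the nonnegativity of every [S_i], [i <= k]. *)
Lemma dslope_ge r : 0 < r ->
  - ((n - k)%:R / k%:R) * slope lam w r <= r * dslope lam w r.
Proof.
move=> r0; have k0 : (0 : R) < k%:R by rewrite ltr0n.
have F0 := flux_gt0 cw r0.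
have -> : r * dslope lam w r = - ((n - k)%:R / k%:R) * slope lam w r
    + r * (slope lam w r / k%:R * (src w r / flux w r)).
  by rewrite /dslope; field; rewrite !gt_eqF.
rewrite lerDl mulr_ge0 ?(ltW r0) // mulr_ge0 ?divr_ge0 ?slope_ge0 ?src_ge0 //; exact: ltW.
Qed.

Lemma flux_lower r : 0 < r -> r <= 1 -> kap / 2 ^+ n * (r ^+ n * rho r) <= flux w r.
Proof.
move=> r0 r1; have h0 : 0 < r / 2 by rewrite divr_gt0.
have hr : r / 2 < r by rewrite ltr_pdivrMr // ltr_pMr // ltr1n.
have [t [t0 tr E]] := @MVT_point R (flux w) (src w) (r / 2) r hr (fun x _ => flux_is_derive cw x).
have -> : flux w r = flux w (r / 2) + src w t * (r - r / 2) by rewrite -E addrC subrK.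
have F0 := flux_ge0 cw (r / 2).
rewrite -[leLHS]add0r; apply: lerD => //.
have -> : r - r / 2 = r / 2 by field.
have -> : kap / 2 ^+ n * (r ^+ n * rho r) = (r / 2) ^+ (n - 1) * (kap * rho r) * 1 * (r / 2).
  rewrite -{1 2}(subnK n_gt0) addn1 !exprS exprMn exprVn.
  by field; rewrite expf_neq0 // pnatr_eq0.
have hw := ltW h0; have t00 := lt_trans h0 t0; have tw := ltW t00.
apply: ler_wpM2r => //; rewrite /src (max_l tw); apply: ler_pM => //.
- by rewrite mulr_ge0 ?exprn_ge0 // mulr_ge0 ?rho_ge0 // ltW.
- apply: ler_pM; rewrite ?exprn_ge0 //.
  + by rewrite mulr_ge0 ?rho_ge0 // ltW.
  + by rewrite lerXn2r ?nnegrE // ltW.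
  + by apply: rho_ge => //; exact: ltW.
- by apply: powR_ge1; [exact: ltW|exact: max1_ge1].
Qed.

(** Constant of the bound [src / flux <= Kq / r]. *)
Definition Kq : R := M `^ q * 2 ^+ n / kap.

Lemma src_flux r : 0 < r -> r < 1 -> src w r / flux w r <= Kq / r.
Proof.
move=> r0 r1; have F0 := flux_gt0 cw r0; have rw := ltW r0.
rewrite ler_pdivrMr //; apply: (@le_trans _ _ (r ^+ (n - 1) * rho r * M `^ q)).
  rewrite /src (max_l rw); apply: ler_wpM2l; first by rewrite mulr_ge0 ?exprn_ge0 ?rho_ge0.
  by apply: powR_le; [exact: ltW|exact: ltW (max1_gt0 _)|exact: wM].
apply: le_trans (ler_wpM2l _ (flux_lower r0 (ltW r1))); last first.
  by rewrite /Kq !divr_ge0 ?mulr_ge0 ?powR_ge0 ?exprn_ge0 // ltW.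
have En : r ^+ n = r * r ^+ (n - 1) by rewrite -{1}(subnK n_gt0) addn1 exprS.
have p0 : (2 : R) ^+ n != 0 by rewrite expf_neq0 // pnatr_eq0.
apply: eq_imply_le; rewrite /Kq En; move: (2 ^+ n) p0 => p p0.
by field; rewrite p0 !gt_eqF.
Qed.

(** Constant of the bound [|dslope| <= Kd r^2]. *)
Definition Kd : R := Ks / k%:R * (Kq + n%:R).

Lemma dslope_upper r : 0 < r -> r < 1 -> `|dslope lam w r| <= Kd * r ^+ 2.
Proof.
move=> r0 r1; have k0 : (0 : R) < k%:R by rewrite ltr0n.
have F0 := flux_gt0 cw r0; have rw := ltW r0.
have Q0 : 0 <= Kq by rewrite /Kq divr_ge0 ?mulr_ge0 ?powR_ge0 ?exprn_ge0 // ltW.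
have -> : Kd * r ^+ 2 = (Ks * r ^+ 3 / k%:R) * ((Kq + n%:R) / r).
  by rewrite /Kd; field; rewrite !gt_eqF.
rewrite normrM; apply: ler_pM => //.
  rewrite ger0_norm ?divr_ge0 ?slope_ge0 // ler_pM2r ?invr_gt0 //.
  by apply: slope_upper => //; exact: ltW.
rewrite mulrDl; apply: le_trans (ler_normB _ _) _; apply: lerD.
  rewrite ger0_norm; first exact: src_flux.
  by rewrite divr_ge0 ?src_ge0 // ltW.
rewrite ger0_norm ?divr_ge0 // ler_pM2r ?invr_gt0 // ler_nat leq_subr //.
Qed.

Lemma dslope_continuous r : 0 < r -> {for r, continuous (dslope lam w)}.
Proof.
move=> r0; have F0 := flux_gt0 cw r0.
have c1 : {for r, continuous (fun t : R => slope lam w t / k%:R)}.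
  by apply: cvgM; [exact: slope_continuous|exact: cvg_cst].
have c2 : {for r, continuous (fun t : R => src w t / flux w t)}.
  apply: cvgM; first exact: src_continuous.
  by apply: cvgV; [rewrite gt_eqF|exact: flux_continuous].
have c3 : {for r, continuous (fun t : R => (n - k)%:R / t)}.
  by apply: cvgM; [exact: cvg_cst|apply: cvgV; [rewrite gt_eqF|exact: cvg_id]].
exact: (cvgM c1 (cvgB c2 c3)).
Qed.

Lemma Phi_is_derive r : is_derive r 1 (Phi lam w) (- slope lam w r).
Proof.
have H := prim_is_derive r slope_continuous slope_le0.
by apply: (dder_eq (dderB (dderC (1 + prim (slope lam w) 1) r 1) H)); rewrite sub0r.
Qed.

Lemma Phi_continuous : continuous (Phi lam w).
Proof. by move=> r; exact: dder_continuous (Phi_is_derive r). Qed.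

Lemma Phi1 : Phi lam w 1 = 1.
Proof. by rewrite /Phi addrK. Qed.

Lemma Phi_decr (a b : R) : a <= b -> Phi lam w b <= Phi lam w a.
Proof.
move=> ab; rewrite /Phi lerB //; apply: prim_incr => //.
- exact: slope_continuous.
- exact: slope_le0.
- by move=> t _; exact: slope_ge0.
Qed.

Lemma Phi_ge1 r : r <= 1 -> 1 <= Phi lam w r.
Proof. by move=> /Phi_decr; rewrite Phi1. Qed.

Lemma Phi_gt1 r : 0 <= r -> r < 1 -> 1 < Phi lam w r.
Proof.
move=> r0 r1; have [t [t0 tr E]] := @MVT_point R _ _ r 1 r1 (fun x _ => Phi_is_derive x).
rewrite Phi1 in E; rewrite -subr_gt0 -opprB E mulNr opprK mulr_gt0 ?subr_gt0 //.
by apply: slope_gt0; exact: le_lt_trans t0.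
Qed.

(** A common constant for the bounds on the profile and its derivatives. *)
Definition Kp : R := Ks + Kd.

Lemma Ks_le_Kp : Ks <= Kp.
Proof.
rewrite /Kp lerDl /Kd mulr_ge0 ?divr_ge0 ?Ks_ge0 // addr_ge0 // /Kq.
by rewrite divr_ge0 ?mulr_ge0 ?powR_ge0 ?exprn_ge0 // ltW.
Qed.

Lemma Kd_le_Kp : Kd <= Kp.
Proof. by rewrite /Kp lerDr Ks_ge0. Qed.

(** The solution candidate [1 - Phi lam w]. *)
Definition usol r : R := 1 - Phi lam w r.

Lemma usol_is_derive r : is_derive r 1 usol (slope lam w r).
Proof.
by apply: (dder_eq (dderB (dderC 1 r 1) (Phi_is_derive r))); rewrite sub0r opprK.
Qed.

Lemma usol_continuous : continuous usol.
Proof. by move=> r; exact: dder_continuous (usol_is_derive r). Qed.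

Lemma usol_bound r : 0 < r < 1 -> `|usol r - usol 0| <= Kp * r ^+ 2.
Proof.
move=> /andP[r0 r1]; have rw := ltW r0; have r1w := ltW r1.
have [t [t0 tr E]] := @MVT_point R _ _ 0 r r0 (fun x _ => usol_is_derive x).
have tw := ltW t0; have t1 := ltW (lt_trans tr r1).
rewrite E subr0 normrM !ger0_norm ?slope_ge0 //.
rewrite expr2 mulrA; apply: ler_wpM2r => //.
apply: le_trans (slope_upper t0 t1) _; apply: ler_pM; rewrite ?Ks_ge0 ?exprn_ge0 ?Ks_le_Kp //.
apply: le_trans (ltW tr); rewrite exprS ger_pMr // exprn_ile1 //.
Qed.

Lemma slope_bound r : 0 < r < 1 -> `|slope lam w r| <= Kp * r ^+ 2.
Proof.
move=> /andP[r0 r1]; rewrite ger0_norm ?slope_ge0 //; have rw := ltW r0; have r1w := ltW r1.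
apply: le_trans (slope_upper r0 r1w) _; apply: ler_pM; rewrite ?Ks_ge0 ?exprn_ge0 ?Ks_le_Kp //.
by rewrite exprS ger_pMl ?exprn_gt0.
Qed.

Lemma dslope_bound r : 0 < r < 1 -> `|dslope lam w r| <= Kp * r.
Proof.
move=> /andP[r0 r1]; have rw := ltW r0; have r1w := ltW r1.
apply: le_trans (dslope_upper r0 r1) _.
have Kd0 : 0 <= Kd by have := le_trans (normr_ge0 _) (dslope_upper r0 r1); rewrite pmulr_lge0 ?exprn_gt0.
by apply: ler_pM; rewrite ?exprn_ge0 ?Kd_le_Kp // expr2 ger_pMr.
Qed.

(** [S_i] of the Hessian of the radial function with slope [slope lam w]. *)
Definition radial r i : R :=
  'C(n.-1, i)%:R * (slope lam w r / r) ^+ i +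
  'C(n.-1, i.-1)%:R * (slope lam w r / r) ^+ i.-1 * dslope lam w r.

Lemma bin_ratio i : (0 < i)%N ->
  n%:R * 'C(n.-1, i)%:R = (n%:R - i%:R) * 'C(n, i)%:R :> R /\
  n%:R * 'C(n.-1, i.-1)%:R = i%:R * 'C(n, i)%:R :> R.
Proof.
move=> i0; split; last first.
  by rewrite -!natrM mul_bin_diag prednK.
have [ni|ni] := leqP i n; last by rewrite !bin_small ?mulr0 // (leq_ltn_trans (leq_pred _)).
by rewrite -natrB // -!natrM mul_bin_down.
Qed.

Lemma radial_ge0 r i : 0 < r -> (1 <= i <= k)%N -> 0 <= radial r i.
Proof.
move=> r0 /andP[i0 ik]; have [E1 E2] := bin_ratio i0.
have := dslope_ge r0; have s0 := slope_ge0 r; rewrite /radial natrB; last exact: ltnW kn_lt.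
have n0 : (0 : R) < n%:R by rewrite ltr0n n_gt0.
have k0 : (0 : R) < k%:R by rewrite ltr0n.
have ikR : i%:R <= k%:R :> R by rewrite ler_nat.
have Ei (x : R) : x ^+ i = x * x ^+ i.-1 by rewrite -exprS prednK.
rewrite Ei.
have -> : 'C(n.-1, i)%:R = (n%:R - i%:R) * 'C(n, i)%:R / n%:R :> R by rewrite -E1; field; rewrite gt_eqF.
have -> : 'C(n.-1, i.-1)%:R = i%:R * 'C(n, i)%:R / n%:R :> R by rewrite -E2; field; rewrite gt_eqF.
set a := _ ^+ i.-1; have a0 : 0 <= a by rewrite exprn_ge0 // divr_ge0 // ltW.
have C0 : 0 <= 'C(n, i)%:R / n%:R :> R by rewrite divr_ge0.
move: (slope lam w r) (dslope lam w r) s0 a a0 ('C(n, i)%:R) C0 => s ds s0 a a0 Ci C0 H.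
have -> : (n%:R - i%:R) * Ci / n%:R * (s / r * a) + i%:R * Ci / n%:R * a * ds =
   Ci / n%:R * a / r * ((n%:R - i%:R) * s + i%:R * (r * ds)).
  by field; rewrite !gt_eqF.
apply: mulr_ge0; first by apply: divr_ge0; [exact: mulr_ge0|exact: ltW].
have H2 : i%:R * (- ((n%:R - k%:R) / k%:R) * s) <= i%:R * (r * ds) by rewrite ler_wpM2l.
rewrite -lerBlDl sub0r; apply: le_trans H2.
rewrite lerNl -subr_ge0.
have -> : (n%:R - i%:R) * s - - (i%:R * (- ((n%:R - k%:R) / k%:R) * s)) = n%:R * (k%:R - i%:R) / k%:R * s.
  by field; rewrite gt_eqF.
apply: mulr_ge0 => //; apply: divr_ge0; last exact: ltW.
by apply: mulr_ge0; [exact: ltW|rewrite subr_ge0].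
Qed.

Lemma radial_eq r : 0 < r -> radial r k = lam * rho r * Num.max 1 (w r) `^ q.
Proof.
move=> r0; have [E1 E2] := bin_ratio hk.
have n0 : (0 : R) < n%:R by rewrite ltr0n n_gt0.
have k0 : (0 : R) < k%:R by rewrite ltr0n.
have F0 := flux_gt0 cw r0.
have cE : 'C(n, k)%:R = c * n%:R by rewrite /c_nk divfK // gt_eqF.
have c0 := c_gt0.
have -> : radial r k = c * r * (src w r / flux w r) * (slope lam w r ^+ k / r ^+ k).
  rewrite /radial -expr_div_n.
  have -> : 'C(n.-1, k)%:R = (n%:R - k%:R) * c :> R.
    by apply: (mulfI (lt0r_neq0 n0)); rewrite E1 cE; ring.
  have -> : 'C(n.-1, k.-1)%:R = k%:R * c :> R.
    by apply: (mulfI (lt0r_neq0 n0)); rewrite E2 cE; ring.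
  have Ek (x : R) : x ^+ k = x * x ^+ k.-1 by rewrite -exprS prednK.
  rewrite !Ek /dslope natrB; last exact: ltnW kn_lt.
  by move: (_ ^+ k.-1) => p; field; rewrite !gt_eqF.
rewrite slope_expr // /src (max_l (ltW r0)) -mulrA.
have -> : r ^+ (n - 1) = r ^+ (n - k) * r ^+ k / r.
  by rewrite -exprD subnK ?(ltnW kn_lt) // -{2}(subnK n_gt0) addn1 exprSr mulfK // gt_eqF.
by field; rewrite !gt_eqF ?exprn_gt0.
Qed.



(** * Solutions produced by the radial operator *)

Lemma usol_derive1 : derive1 usol = slope lam w.
Proof. by apply/funext => r; apply: derive1_is; exact: usol_is_derive. Qed.

Lemma power_is_derive i r : 0 < r ->
  is_derive r 1 (fun s => s ^+ (n - i) * slope lam w s ^+ i)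
    ((n - i)%:R * r ^+ (n - i).-1 * slope lam w r ^+ i +
     r ^+ (n - i) * (i%:R * slope lam w r ^+ i.-1 * dslope lam w r)).
Proof.
move=> r0; apply: (dder_eq (dderM (dderX (n - i) (dder_id r)) (dderX i (slope_is_derive r0)))).
by rewrite mulr1.
Qed.

Lemma power_derive_ge0 i r : 0 < r -> (1 <= i <= k)%N ->
  0 <= derive1 (fun s => s ^+ (n - i) * slope lam w s ^+ i) r.
Proof.
move=> r0 /andP[i0 ik]; rewrite (derive1_is (power_is_derive i r0)).
have k0 : (0 : R) < k%:R by rewrite ltr0n.
have ni : (0 < n - i)%N by rewrite subn_gt0 (leq_ltn_trans ik kn_lt).
have Ei (x : R) : x ^+ i = x * x ^+ i.-1 by rewrite -exprS prednK.
have Er : r ^+ (n - i) = r * r ^+ (n - i).-1 by rewrite -exprS prednK.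
rewrite Ei Er.
have -> : (n - i)%:R * r ^+ (n - i).-1 * (slope lam w r * slope lam w r ^+ i.-1) +
  r * r ^+ (n - i).-1 * (i%:R * slope lam w r ^+ i.-1 * dslope lam w r) =
  r ^+ (n - i).-1 * slope lam w r ^+ i.-1 * ((n - i)%:R * slope lam w r + i%:R * (r * dslope lam w r)) by ring.
apply: mulr_ge0; first by rewrite mulr_ge0 ?exprn_ge0 ?slope_ge0 // ltW.
have s0 := slope_ge0 r.
have H2 : i%:R * (- ((n - k)%:R / k%:R) * slope lam w r) <= i%:R * (r * dslope lam w r).
  by rewrite ler_wpM2l //; exact: dslope_ge.
rewrite -lerBlDl sub0r; apply: le_trans H2; rewrite lerNl -subr_ge0.
rewrite !natrB; [|exact: ltnW kn_lt|exact: leq_trans ik (ltnW kn_lt)].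
move: (slope lam w r) s0 => s s0.
have -> : (n%:R - i%:R) * s - - (i%:R * (- ((n%:R - k%:R) / k%:R) * s)) = n%:R * (k%:R - i%:R) / k%:R * s.
  by field; rewrite gt_eqF.
apply: mulr_ge0 => //; apply: divr_ge0; last exact: ltW.
by apply: mulr_ge0 => //; rewrite subr_ge0 ler_nat.
Qed.

Lemma usol_Phi0 : Phi0 n k usol.
Proof.
split; first split.
- move=> x /= /itvP x01; have x0 : 0 < x by rewrite x01.
  split.
  + by have [] := usol_is_derive x.
  + by rewrite usol_derive1; have [] := slope_is_derive x0.
  + rewrite usol_derive1; apply: (eq_pos_continuous x0) (dslope_continuous x0) => r r0.
    by apply: derive1_is; exact: slope_is_derive.
- exists (slope lam w); first by apply: continuous_subspaceT; exact: slope_continuous.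
  by move=> x _; apply: deriv_within; exact: usol_is_derive.
- by move=> i ik r /andP[r0 _]; rewrite usol_derive1; exact: power_derive_ge0.
- by apply: deriv_within; apply: (dder_eq (usol_is_derive 0)); exact: slope_le0.
- by rewrite /usol Phi1 subrr.
Qed.

Lemma usol_classical : (forall r, 0 < r -> r < 1 -> Phi lam w r = Num.max 1 (w r)) ->
  classical_solution n k q rho lam usol.
Proof.
move=> fixw; split; first exact: usol_Phi0.
move=> r /andP[r0 r1]; rewrite usol_derive1.
have H : is_derive r 1 (fun s => s ^+ (n - k) * slope lam w s ^+ k) (lam / c * src w r).
  apply: near_eq_is_derive (dderZ (lam / c) (flux_is_derive cw r)).
  near=> t; have t0 : 0 < t by near: t; exact: lt_nbhsr.
  by rewrite slope_expr //; field; rewrite !gt_eqF ?exprn_gt0 ?c_gt0.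
rewrite (derive1_is H) /usol subKr fixw // /src (max_l (ltW r0)).
by have c0 := c_gt0; have rn := exprn_gt0 (n - 1) r0; field; rewrite !gt_eqF.
Unshelve. all: by end_near. Qed.

Lemma rho0 : rho 0 = 0.
Proof.
apply/eqP; rewrite eq_le rho_ge0 // andbT; apply: le_trans (rho_le (lexx 0) ler01) _.
by rewrite expr0n muln_eq0 /= gtn_eqF // mulr0.
Qed.

Let v (x : 'rV[R]_n) := usol (enorm x).

Let Hu r : 0 < r < 1 -> is_derive r 1 usol (slope lam w r).
Proof. by move=> _; exact: usol_is_derive. Qed.

Let Hs r : 0 < r < 1 -> is_derive r 1 (slope lam w) (dslope lam w r).
Proof. by move=> /andP[r0 _]; exact: slope_is_derive. Qed.

Let cds r : 0 < r < 1 -> {for r, continuous (dslope lam w)}.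
Proof. by move=> /andP[r0 _]; exact: dslope_continuous. Qed.

Lemma usol_C2_rV : C2_on_rV unit_ball v.
Proof. exact: (@radial_C2 R n _ _ _ _ Hu Hs cds usol_bound slope_bound dslope_bound). Qed.

Lemma usol_hessian_S i x : unit_ball x -> (0 < i)%N ->
  hessian_S i v x = if enorm x == 0 then 0 else radial (enorm x) i.
Proof.
move=> x1 i0.
have H := @radial_hessian_S R n _ _ _ _ Hu Hs cds usol_bound slope_bound dslope_bound x i x1 i0 n_gt0.
exact: H.
Qed.

Lemma usol_continuous_rV : continuous v.
Proof. by move=> x; apply: continuous_comp_enorm; exact: usol_continuous. Qed.

Lemma usol_admissible : k_admissible k v.
Proof.
split; [exact: usol_C2_rV|exact: continuous_subspaceT usol_continuous_rV|].
move=> i /[dup] ik /andP[i0 _] x x1; rewrite usol_hessian_S //; case: eqP => // /eqP x0.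
by apply: radial_ge0 => //; rewrite lt0r x0 enorm_ge0.
Qed.

(** The Hessian equation satisfied by [1 - Phi lam w], for an arbitrary [w] on
    the right-hand side. *)
Lemma usol_hessian_k x : unit_ball x ->
  hessian_S k v x = lam * rho (enorm x) * Num.max 1 (w (enorm x)) `^ q.
Proof.
move=> x1; rewrite usol_hessian_S //; case: eqP => [->|/eqP x0].
  by rewrite rho0 mulr0 mul0r.
by apply: radial_eq; rewrite lt0r x0 enorm_ge0.
Qed.
End Slope.


(** * Monotone limits of the integral equation *)

Lemma ratio_mono (l1 l2 f1 f2 p1 p2 : R) : 0 <= l1 -> l1 <= l2 -> 0 <= f1 -> f1 <= f2 ->
  0 < p2 -> p2 <= p1 -> l1 / c * f1 / p1 <= l2 / c * f2 / p2.
Proof.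
move=> l0 l12 f0 f12 p0 p12; have c0 := c_gt0.
have p10 : 0 < p1 := lt_le_trans p0 p12.
apply: ler_pM; last by rewrite lef_pV2 ?posrE.
- by rewrite mulr_ge0 // divr_ge0 // ltW.
- by rewrite invr_ge0 ltW.
- apply: ler_pM => //; first by rewrite divr_ge0 // ltW.
  by rewrite ler_pM2r ?invr_gt0.
Qed.

Lemma slope_mono (l1 l2 : R) w1 w2 r : 0 < l1 -> l1 <= l2 ->
  continuous w1 -> continuous w2 ->
  (forall s, 0 < s -> s < r -> w1 s <= w2 s) -> slope l1 w1 r <= slope l2 w2 r.
Proof.
move=> l0 l12 c1 c2 H; have [r0|r0] := leP r 0; first by rewrite (slope_le0 l1 w1 r0) (slope_le0 l2 w2 r0).
have r0f : (r <= 0) = false by rewrite leNgt r0.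
rewrite /slope r0f.
apply: root_le; first exact: ltW (T_gt0 l0 c1 r0).
exact: (ratio_mono (ltW l0) l12 (flux_ge0 c1 r) (flux_mono c1 c2 H) (exprn_gt0 (n - k) r0) (lexx _)).
Qed.

Lemma Phi_mono (l1 l2 : R) w1 w2 r : 0 < l1 -> l1 <= l2 ->
  continuous w1 -> continuous w2 ->
  (forall s, 0 < s -> s < 1 -> w1 s <= w2 s) -> r <= 1 -> Phi l1 w1 r <= Phi l2 w2 r.
Proof.
move=> l0 l12 c1 c2 H r1; have l20 := lt_le_trans l0 l12.
have [M1 B1] := exists_bound c1; have [M2 B2] := exists_bound c2.
have Hs (t : R) : r < t < 1 -> slope l1 w1 t <= slope l2 w2 t.
  move=> /andP[_ t1]; apply: (slope_mono l0 l12 c1 c2) => s s0 st; apply: H s0 _.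
  exact: lt_trans st t1.
have := prim_le (slope_continuous l0 c1 B1) (@slope_le0 l1 w1)
  (slope_continuous l20 c2 B2) (@slope_le0 l2 w2) r1 Hs.
have A (a1 a2 a3 a4 : R) : a1 - a2 <= a3 - a4 -> 1 + a1 - a2 <= 1 + a3 - a4 by lra.
exact: A.
Qed.

Lemma flux_incr w (a b : R) : continuous w -> a <= b -> flux w a <= flux w b.
Proof.
move=> cw ab; apply: (prim_incr (src_continuous cw) (@src_le0 w) ab).
by move=> x _; exact: src_ge0.
Qed.

Lemma mean_ge0 (lam : R) w (a b : R) : 0 < lam -> continuous w -> 0 < b ->
  0 <= lam / c * flux w a / b ^+ (n - k).
Proof.
move=> l0 cw b0; apply: divr_ge0; last exact: exprn_ge0 (ltW b0).
by apply: mulr_ge0 (flux_ge0 cw a); apply: divr_ge0; apply: ltW => //; exact: c_gt0.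
Qed.

Lemma slopeE (lam : R) w (r : R) : 0 < r ->
  slope lam w r = (lam / c * flux w r / r ^+ (n - k)) `^ (k%:R^-1).
Proof. by rewrite /slope leNgt => ->. Qed.

(** On [a, b] the slope lies between two constants that involve the flux at the
    endpoints only. *)
Lemma slope_le_mean (lam : R) w (a b t : R) : 0 < lam -> continuous w -> 0 < a -> a <= t -> t <= b ->
  slope lam w t <= (lam / c * flux w b / a ^+ (n - k)) `^ (k%:R^-1).
Proof.
move=> l0 cw a0 at_ tb; have t0 := lt_le_trans a0 at_.
rewrite (slopeE lam w t0); apply: root_le; first exact: ltW (T_gt0 l0 cw t0).
apply: (ratio_mono (ltW l0) (lexx lam) (flux_ge0 cw t) (flux_incr cw tb) (exprn_gt0 (n - k) a0)).
by rewrite lerXn2r ?nnegrE // ltW.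
Qed.

Lemma slope_ge_mean (lam : R) w (a b t : R) : 0 < lam -> continuous w -> 0 < a -> a <= t -> t <= b ->
  (lam / c * flux w a / b ^+ (n - k)) `^ (k%:R^-1) <= slope lam w t.
Proof.
move=> l0 cw a0 at_ tb; have t0 := lt_le_trans a0 at_; have b0 := lt_le_trans t0 tb.
rewrite (slopeE lam w t0); apply: root_le.
  exact: mean_ge0.
apply: (ratio_mono (ltW l0) (lexx lam) (flux_ge0 cw a) (flux_incr cw at_) (exprn_gt0 (n - k) t0)).
by rewrite lerXn2r ?nnegrE // ltW.
Qed.

Lemma Phi_diff (lam : R) w (a b : R) : 0 < lam -> continuous w -> a < b ->
  exists t, [/\ a < t, t < b & Phi lam w a - Phi lam w b = slope lam w t * (b - a)].
Proof.
move=> l0 cw ab; have [M B] := exists_bound cw.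
have [t [at_ tb E]] := @MVT_point R _ _ a b ab (fun x _ => Phi_is_derive l0 cw B x).
by exists t; split => //; rewrite -opprB E mulNr opprK.
Qed.

Lemma flux_integral w (r : R) : continuous w -> 0 < r ->
  (\int[lebesgue_measure]_(s in `]0%R, r[) (src w s)%:E = (flux w r)%:E)%E.
Proof.
move=> cw r0; have cs := src_continuous cw.
have ms : measurable_fun `]0%R, r[ (fun s => (src w s)%:E).
  apply: measurable_funTS; apply/measurable_EFinP; exact: continuous_measurable_fun.
rewrite -(@integral_itv_bndoo R 0 r _ true false ms).
rewrite (@continuous_FTC2 R (src w) (flux w) 0 r r0).
- by rewrite (flux_le0 w (lexx 0)) sube0.
- exact: continuous_subspaceT.
- split; first by move=> x _; have [] := flux_is_derive cw x.
  + by apply: cvg_at_right_filter; exact: flux_continuous.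
  + by apply: cvg_at_left_filter; exact: flux_continuous.
- by move=> x _; apply: derive1_is; exact: flux_is_derive.
Qed.

(** Functions [wj], nondecreasing in [j] and nonincreasing in the radius, and
    their images [Phi lamj wj] have the same pointwise limit [wl] on (0,1); no bound near the origin is assumed. *)
Section Limit.
Variables (lamj : nat -> R) (lam : R) (wj : nat -> R -> R) (wl : R -> R).
Hypothesis lamj0 : forall j, 0 < lamj j.
Hypothesis lamj_mono : forall i j, (i <= j)%N -> lamj i <= lamj j.
Hypothesis lamj_cvg : lamj j @[j --> \oo] --> lam.
Hypothesis cwj : forall j, continuous (wj j).
Hypothesis wj_ge1 : forall j s, 0 < s -> s < 1 -> 1 <= wj j s.
Hypothesis wj_decr : forall j s t, 0 < s -> s <= t -> t < 1 -> wj j t <= wj j s.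
Hypothesis wj_mono : forall i j s, (i <= j)%N -> 0 < s -> s < 1 -> wj i s <= wj j s.
Hypothesis wj_cvg : forall s, 0 < s -> s < 1 -> wj j s @[j --> \oo] --> wl s.
Hypothesis zj_cvg : forall s, 0 < s -> s < 1 -> Phi (lamj j) (wj j) s @[j --> \oo] --> wl s.
Hypothesis wl1 : wl 1 = 1.

Lemma wj_le_wl j s : 0 < s -> s < 1 -> wj j s <= wl s.
Proof.
move=> s0 s1; apply: (nondecreasing_le_lim (u := fun j => wj j s)); last exact: wj_cvg.
by move=> i l il; exact: wj_mono.
Qed.

Lemma zj_le_wl j s : 0 < s -> s < 1 -> Phi (lamj j) (wj j) s <= wl s.
Proof.
move=> s0 s1; apply: (nondecreasing_le_lim (u := fun j => Phi (lamj j) (wj j) s)); last exact: zj_cvg.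
by move=> i l il; apply: Phi_mono => //; [exact: lamj_mono|move=> t t0 t1; exact: wj_mono|exact: ltW].
Qed.

Lemma wl_ge1 s : 0 < s -> s < 1 -> 1 <= wl s.
Proof. by move=> s0 s1; apply: le_trans (wj_ge1 0 s0 s1) (wj_le_wl 0 s0 s1). Qed.

(** The drop of [Phi lamj wj] between [r] and [(r + 1) / 2] is at most [wl r] and
    controls the flux at [r]. *)
Lemma flux_bounded1 r : 0 < r -> r < 1 -> exists B : R, forall j, flux (wj j) r <= B.
Proof.
move=> r0 r1; pose b := (r + 1) / 2.
have rb : r < b by rewrite ltr_pdivlMr //; lra.
have b1 : b < 1 by rewrite ltr_pdivrMr //; lra.
have b0 := lt_trans r0 rb.
exists ((wl r / (b - r)) ^+ k / (lamj 0 / c)) => j.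
have c0 := c_gt0.
rewrite ler_pdivlMr; last exact: divr_gt0 (lamj0 0) c0.
have [t [rt tb E]] := Phi_diff (lamj0 j) (@cwj j) rb.
have [M B] := exists_bound (@cwj j).
have z1 : Phi (lamj j) (wj j) r - Phi (lamj j) (wj j) b <= wl r.
  have := Phi_ge1 (lamj0 j) (@cwj j) B (ltW b1); have := zj_le_wl j r0 r1.
  move: (Phi _ _ r) (Phi _ _ b) => p1 p2; lra.
rewrite E -ler_pdivlMr ?subr_gt0 // in z1.
have sk : slope (lamj j) (wj j) t ^+ k <= (wl r / (b - r)) ^+ k.
  by rewrite lerXn2r // nnegrE ?slope_ge0 // divr_ge0 ?subr_ge0 ?(ltW rb) // (le_trans ler01) // wl_ge1.
apply: le_trans sk; rewrite mulrC.
have := slope_ge_mean (lamj0 j) (@cwj j) r0 (ltW rt) (ltW tb).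
move=> h.
have {}h : (lamj j / c * flux (wj j) r / b ^+ (n - k)) <= slope (lamj j) (wj j) t ^+ k.
  have g0 : 0 <= lamj j / c * flux (wj j) r / b ^+ (n - k).
    exact: mean_ge0.
  by rewrite -[leLHS](root_powK hk g0) lerXn2r // nnegrE ?powR_ge0 ?slope_ge0.
apply: le_trans h; rewrite -[leLHS]divr1; apply: ratio_mono => //.
- exact: ltW.
- exact: lamj_mono.
- exact: flux_ge0.
- exact: exprn_gt0.
- by rewrite exprn_ile1 // ltW.
Qed.

Lemma src_bound j (x t : R) : 0 < x -> x < 1 -> x <= t -> t < 1 -> src (wj j) t <= L * wl x `^ q.
Proof.
move=> x0 x1 xt t1; have t0 := lt_le_trans x0 xt; have tw := ltW t0; have t1w := ltW t1.
rewrite srcE //; last exact: wj_ge1.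
apply: ler_pM; rewrite ?powR_ge0 ?mulr_ge0 ?exprn_ge0 ?rho_ge0 //.
  rewrite -[leRHS]mul1r; apply: ler_pM; rewrite ?exprn_ge0 ?rho_ge0 ?exprn_ile1 //.
  by apply: le_trans (rho_le tw t1w) _; rewrite -[leRHS]mulr1 ler_wpM2l ?L_ge0 // exprn_ile1.
apply: powR_le; [exact: ltW|by apply: le_trans ler01 _; exact: wj_ge1|].
exact: le_trans (@wj_decr j x t x0 xt t1) (wj_le_wl j x0 x1).
Qed.

Lemma flux_lipschitz j (x a b : R) : 0 < x -> x < 1 -> x <= a -> a <= b -> b <= 1 ->
  flux (wj j) b - flux (wj j) a <= L * wl x `^ q * (b - a).
Proof.
move=> x0 x1 xa; rewrite le_eqVlt => /orP[/eqP->|ab] b1; first by rewrite !subrr mulr0.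
have [t [at_ tb ->]] := @MVT_point R _ _ a b ab (fun x _ => flux_is_derive (@cwj j) x).
rewrite ler_wpM2r ?subr_ge0 ?(ltW ab) //; apply: src_bound => //.
  by apply: le_trans xa _; exact: ltW.
exact: lt_le_trans tb b1.
Qed.

Lemma flux_bounded r : 0 < r -> r <= 1 -> exists B : R, forall j, flux (wj j) r <= B.
Proof.
move=> r0 r1; have h0 : (0 : R) < 1 / 2 by [].
have h1 : (1 / 2 : R) < 1 by rewrite ltr_pdivrMr // mul1r ltr1n.
have [B HB] := flux_bounded1 h0 h1; exists (B + L * wl (1 / 2) `^ q * (1 - 1 / 2)) => j.
apply: le_trans (flux_incr (@cwj j) r1) _.
have := flux_lipschitz j h0 h1 (lexx _) (ltW h1) (lexx 1); have := HB j.
move: (flux _ _) (flux _ _) => f1 f2; lra.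
Qed.

Lemma flux_mono_j i j r : (i <= j)%N -> r <= 1 -> flux (wj i) r <= flux (wj j) r.
Proof.
move=> ij r1; apply: flux_mono => // s s0 sr; apply: wj_mono => //.
exact: lt_le_trans sr r1.
Qed.

(** Limit of the increasing fluxes of [wj]. *)
Definition flux_limit r : R := sup (range (fun j => flux (wj j) r)).

Lemma flux_limit_cvg r : 0 < r -> r <= 1 -> flux (wj j) r @[j --> \oo] --> flux_limit r.
Proof.
move=> r0 r1; apply: nondecreasing_cvgn; first by move=> i j ij; exact: flux_mono_j.
have [B HB] := flux_bounded r0 r1; exists B => _ [j _ <-]; exact: HB.
Qed.

Lemma flux_limit_gt0 r : 0 < r -> r <= 1 -> 0 < flux_limit r.
Proof.
move=> r0 r1; apply: lt_le_trans (flux_gt0 (@cwj 0) r0) _.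
apply: (nondecreasing_le_lim (u := fun j => flux (wj j) r)); last exact: flux_limit_cvg.
by move=> i j ij; exact: flux_mono_j.
Qed.

Lemma limit_lam_gt0 : 0 < lam.
Proof. by apply: lt_le_trans (lamj0 0) _; exact: nondecreasing_le_lim. Qed.

Lemma flux_limit_lipschitz (x a b : R) : 0 < x -> x < 1 -> x <= a -> a <= b -> b <= 1 ->
  `|flux_limit b - flux_limit a| <= L * wl x `^ q * (b - a).
Proof.
move=> x0 x1 xa ab b1; have a0 := lt_le_trans x0 xa; have b0 := lt_le_trans a0 ab.
have ca := flux_limit_cvg a0 (le_trans ab b1); have cb := flux_limit_cvg b0 b1.
rewrite ger0_norm; last first.
  by rewrite subr_ge0; apply: limit_le ca cb _ => j; exact: flux_incr (@cwj j) ab.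
apply: (limit_le (cvgB cb ca) (cvg_cst _)) => j.
exact: flux_lipschitz.
Qed.

Lemma flux_limit_continuous r : 0 < r -> r < 1 -> {for r, continuous flux_limit}.
Proof.
move=> r0 r1; apply: eps_continuous => e e0.
have h0 : 0 < r / 2 by rewrite divr_gt0.
have hr : r / 2 < r by rewrite ltr_pdivrMr // ltr_pMr // ltr1n.
have h1 := lt_trans hr r1.
pose K := L * wl (r / 2) `^ q.
have K0 : 0 <= K by rewrite mulr_ge0 ?L_ge0 ?powR_ge0.
have K1 : 0 < K + 1 by rewrite ltr_wpDl.
exists (Num.min (Num.min (r / 2) (1 - r)) (e / (K + 1))).
  by rewrite !lt_min h0 subr_gt0 r1 divr_gt0.
move=> y; rewrite !lt_min => /andP[/andP[y1 y2] y3].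
have [ya yb] : r / 2 <= y /\ y <= 1.
  move: y1 y2; rewrite !ltr_norml => /andP[a1 _] /andP[_ a2]; split; lra.
apply: (@le_trans _ _ (K * `|y - r|)).
  have [ry|yr] := leP r y.
    by rewrite [in leRHS]ger0_norm ?subr_ge0 //; apply: flux_limit_lipschitz => //; exact: ltW.
  rewrite distrC [in leRHS]distrC [in leRHS]ger0_norm ?subr_ge0 ?(ltW yr) //.
  by apply: flux_limit_lipschitz => //; exact: ltW.
rewrite ltr_pdivlMr // in y3; apply: le_trans (ltW y3); rewrite mulrC ler_wpM2l // lerDl //.
Qed.

(** Slope computed with the limiting flux at [a] and the radius [b]; the secant
    slopes of [wl] between [x] and [y] lie between [mean_slope x y] and
    [mean_slope y x]. *)
Definition mean_slope (a b : R) : R := (lam / c * flux_limit a / b ^+ (n - k)) `^ (k%:R^-1).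

Lemma zj_cvg1 (s : R) : 0 < s -> s <= 1 -> Phi (lamj j) (wj j) s @[j --> \oo] --> wl s.
Proof.
move=> s0; rewrite le_eqVlt => /orP[/eqP->|s1]; last exact: zj_cvg.
by rewrite wl1; under eq_fun do rewrite Phi1; exact: cvg_cst.
Qed.

Lemma wl_diff (x y : R) : 0 < x -> x < y -> y <= 1 ->
  mean_slope x y * (y - x) <= wl x - wl y /\ wl x - wl y <= mean_slope y x * (y - x).
Proof.
move=> x0 xy y1; have y0 := lt_trans x0 xy; have x1 := lt_le_trans xy y1.
have H j := Phi_diff (lamj0 j) (@cwj j) xy.
have zc : Phi (lamj j) (wj j) x - Phi (lamj j) (wj j) y @[j --> \oo] --> wl x - wl y.
  exact: cvgB (zj_cvg x0 x1) (zj_cvg1 y0 y1).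
have Gc (a b : R) : 0 < a -> a <= 1 -> 0 < b ->
    (lamj j / c * flux (wj j) a / b ^+ (n - k)) `^ (k%:R^-1) @[j --> \oo] --> mean_slope a b.
  move=> a0 a1 b0.
  have T0 : 0 < lam / c * flux_limit a / b ^+ (n - k).
    by rewrite !divr_gt0 ?mulr_gt0 ?exprn_gt0 ?invr_gt0 ?c_gt0 ?flux_limit_gt0 ?limit_lam_gt0.
  have Tc : lamj j / c * flux (wj j) a / b ^+ (n - k) @[j --> \oo] --> lam / c * flux_limit a / b ^+ (n - k).
    exact: cvgM (cvgM (cvgM lamj_cvg (cvg_cst _)) (flux_limit_cvg a0 a1)) (cvg_cst _).
  have hc : t `^ (k%:R^-1) @[t --> lam / c * flux_limit a / b ^+ (n - k)] --> mean_slope a b by exact: powR_continuous.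
  exact: cvg_comp Tc hc.
split.
  apply: (limit_le (cvgM (Gc x y x0 (ltW x1) y0) (cvg_cst (y - x))) zc) => j.
  have [t [xt ty ->]] := H j; rewrite ler_wpM2r ?subr_ge0 ?(ltW xy) //.
  by apply: slope_ge_mean => //; exact: ltW.
apply: (limit_le zc (cvgM (Gc y x y0 y1 x0) (cvg_cst (y - x)))) => j.
have [t [xt ty ->]] := H j; rewrite ler_wpM2r ?subr_ge0 ?(ltW xy) //.
by apply: slope_le_mean => //; exact: ltW.
Qed.

Lemma wl_is_derive (x : R) : 0 < x -> x < 1 -> is_derive x 1 wl (- mean_slope x x).
Proof.
move=> x0 x1; apply: is_derive_eps => e e0.
have T0 : 0 < lam / c * flux_limit x / x ^+ (n - k).
  by rewrite !divr_gt0 ?mulr_gt0 ?exprn_gt0 ?invr_gt0 ?c_gt0 ?(flux_limit_gt0 x0 (ltW x1)) ?limit_lam_gt0.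
have cG1 : {for x, continuous (fun t : R => mean_slope t x)}.
  apply: (@continuous_comp _ _ _ (fun t : R => lam / c * flux_limit t / x ^+ (n - k)) (fun t : R => t `^ (k%:R^-1))).
    by apply: cvgM; [apply: cvgM; [exact: cvg_cst|exact: flux_limit_continuous]|exact: cvg_cst].
  exact: powR_continuous.
have cG2 : {for x, continuous (fun t : R => mean_slope x t)}.
  apply: (@continuous_comp _ _ _ (fun t : R => lam / c * flux_limit x / t ^+ (n - k)) (fun t : R => t `^ (k%:R^-1))).
    apply: cvgM; first exact: cvg_cst.
    apply: cvgV; first by rewrite expf_neq0 // gt_eqF.
    exact: dder_continuous (dderX (n - k) (dder_id x)).
  exact: powR_continuous.
have [d1 d10 H1] := continuous_eps cG1 e0; have [d2 d20 H2] := continuous_eps cG2 e0.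
exists (Num.min (Num.min d1 d2) (Num.min x (1 - x))).
  by rewrite !lt_min d10 d20 x0 subr_gt0.
move=> h; rewrite !lt_min => /andP[/andP[hd1 hd2] /andP[hx h1x]]; rewrite [_%:A]mulr1.
have {}H1 : `|mean_slope (x + h) x - mean_slope x x| <= e by apply: H1; rewrite addrC addKr.
have {}H2 : `|mean_slope x (x + h) - mean_slope x x| <= e by apply: H2; rewrite addrC addKr.
move: hx h1x; rewrite !ltr_norml => /andP[ha _] /andP[_ hb].
have [h0|h0|->] := ltgtP h 0.
- have [xh xh0] := shift_neg h0 ha.
  exact: secant_neg h0 H1 H2 (wl_diff xh0 xh (ltW x1)).
- have [xh xh1] := shift_pos h0 hb.
  exact: secant_pos h0 H1 H2 (wl_diff x0 xh (ltW xh1)).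
- by rewrite addr0 subrr mulr0 subrr normr0 mulr0.
Qed.


Lemma srcj_cvg (s : R) : 0 < s -> s < 1 ->
  src (wj j) s @[j --> \oo] --> s ^+ (n - 1) * rho s * wl s `^ q.
Proof.
move=> s0 s1; have sw := ltW s0.
have pc : t `^ q @[t --> wl s] --> wl s `^ q.
  by apply: powR_continuous; apply: lt_le_trans ltr01 (wl_ge1 s0 s1).
have E : (fun j => src (wj j) s) = (fun j => s ^+ (n - 1) * rho s * wj j s `^ q).
  by apply/funext => j; rewrite srcE //; exact: wj_ge1.
rewrite E; apply: cvgM; first exact: cvg_cst.
exact: cvg_comp (wj_cvg s0 s1) pc.
Qed.

(** Monotone convergence. *)
Lemma flux_limit_integral (r : R) : 0 < r -> r <= 1 ->
  (\int[lebesgue_measure]_(s in `]0%R, r[) (s ^+ (n - 1) * rho s * wl s `^ q)%:E = (flux_limit r)%:E)%E.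
Proof.
move=> r0 r1.
have H := @cvg_monotone_convergence _ _ R lebesgue_measure `]0%R, r[ (measurable_itv _)
  (fun j s => (src (wj j) s)%:E).
have {}H : (\int[lebesgue_measure]_(s in `]0%R, r[) (src (wj j) s)%:E)%E @[j --> \oo] -->
   (\int[lebesgue_measure]_(s in `]0%R, r[) (s ^+ (n - 1) * rho s * wl s `^ q)%:E)%E.
  have -> : (\int[lebesgue_measure]_(s in `]0%R, r[) (s ^+ (n - 1) * rho s * wl s `^ q)%:E)%E =
     (\int[lebesgue_measure]_(s in `]0%R, r[) (limn (fun j => (src (wj j) s)%:E)))%E.
    apply: eq_integral => s /set_mem /= /itvP sr.
    have s0 : 0 < s by rewrite sr.
    have s1 : s < 1 by rewrite (lt_le_trans _ r1) // sr.
    apply/esym/cvg_lim => //; apply: cvg_EFin; first by near=> j.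
    exact: srcj_cvg.
  apply: H.
  - move=> j; apply: measurable_funTS; apply/measurable_EFinP; apply: continuous_measurable_fun.
    exact: src_continuous.
  - by move=> j s _; rewrite lee_fin; exact: src_ge0.
  - move=> s /= /itvP sr i j ij; rewrite lee_fin; apply: src_mono => s0.
    by apply: wj_mono => //; rewrite (lt_le_trans _ r1) // sr.
have E : (fun j => (\int[lebesgue_measure]_(s in `]0%R, r[) (src (wj j) s)%:E)%E) = (fun j => (flux (wj j) r)%:E).
  by apply/funext => j; apply: flux_integral.
rewrite E in H.
apply: (cvg_unique _ H).
  exact: ereal_hausdorff.
apply: cvg_EFin; first by near=> j.
exact: flux_limit_cvg.
Unshelve. all: by end_near. Qed.

Lemma limit_integral_solution : integral_solution n k q rho lam (fun r => 1 - wl r).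
Proof.
have E r : (\int[lebesgue_measure]_(s in `]0%R, r[) (s ^+ (n - 1) * rho s * (1 - (1 - wl s)) `^ q)%:E =
  \int[lebesgue_measure]_(s in `]0%R, r[) (s ^+ (n - 1) * rho s * wl s `^ q)%:E)%E.
  by apply: eq_integral => s _; rewrite subKr.
have G0 a b : 0 < a -> a <= 1 -> 0 < b -> 0 < mean_slope a b.
  move=> a0 a1 b0; apply: powR_gt0; apply: divr_gt0; last exact: exprn_gt0.
  by apply: mulr_gt0 (flux_limit_gt0 a0 a1); apply: divr_gt0 limit_lam_gt0 c_gt0.
split.
- move=> a a0 a1; apply: (lipschitz_abs_continuous (K := mean_slope 1 a)).
  move=> x y ax xy y1; have x0 := lt_le_trans a0 ax.
  move: xy; rewrite le_eqVlt => /orP[/eqP<-|xy]; first by rewrite !subrr normr0 mulr0.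
  have y0 := lt_trans x0 xy; have x1 := le_trans (ltW xy) y1.
  have [h1 h2] := wl_diff x0 xy y1.
  have h3 : 0 <= mean_slope x y * (y - x).
    by rewrite mulr_ge0 ?subr_ge0 ?(ltW xy) // ltW // G0.
  have -> : 1 - wl y - (1 - wl x) = wl x - wl y by ring.
  rewrite ger0_norm ?(le_trans h3 h1) //; apply: le_trans h2 _.
  apply: ler_wpM2r; first by rewrite subr_ge0 ltW.
  apply: root_le.
    apply: divr_ge0; last by rewrite exprn_ge0 // ltW.
    by apply: ltW; apply: mulr_gt0 (flux_limit_gt0 y0 y1); apply: divr_gt0 limit_lam_gt0 c_gt0.
  apply: (ratio_mono (ltW limit_lam_gt0) (lexx lam) (ltW (flux_limit_gt0 y0 y1)) _ (exprn_gt0 (n - k) a0)).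
    apply: (limit_le (flux_limit_cvg y0 y1) (flux_limit_cvg ltr01 (lexx 1))) => j.
    exact: flux_incr.
  by rewrite lerXn2r ?nnegrE // ltW.
- by rewrite E flux_limit_integral // ltry.
- move=> r /andP[r0 r1]; have [h _] := wl_diff r0 r1 (lexx 1).
  have := G0 r 1 r0 (ltW r1) ltr01 => g.
  have : 0 < mean_slope r 1 * (1 - r) by rewrite mulr_gt0 // subr_gt0.
  move=> h1; have := lt_le_trans h1 h; rewrite wl1; move: (wl r) => x; lra.
- by rewrite wl1 subrr.
- move=> r /andP[r0 r1].
  have D := wl_is_derive r0 r1.
  have D1 : is_derive r 1 (fun r => 1 - wl r) (mean_slope r r).
    by apply: (dder_eq (dderB (dderC 1 r 1) D)); rewrite sub0r opprK.
  split; first by have [] := D1.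
  rewrite (derive1_is D1) E (flux_limit_integral r0 (ltW r1)) -EFinM; congr (_%:E).
  rewrite /mean_slope root_powK //; last first.
    apply: divr_ge0; last by rewrite exprn_ge0 // ltW.
    by apply: ltW; apply: mulr_gt0 (flux_limit_gt0 r0 (ltW r1)); apply: divr_gt0 limit_lam_gt0 c_gt0.
  have c0 := c_gt0; have p0 := exprn_gt0 (n - k) r0.
  by move: (flux_limit r) => f; field; rewrite !gt_eqF.
Qed.

End Limit.



(** * Monotone iteration below a barrier *)

Lemma Phi_lipschitz (lam M : R) w (x y : R) : 0 < lam -> continuous w ->
  (forall s, 0 < s -> s < 1 -> Num.max 1 (w s) <= M) ->
  0 <= x -> x <= y -> y <= 1 -> `|Phi lam w x - Phi lam w y| <= Ks lam M * (y - x).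
Proof.
move=> l0 cw wM x0; rewrite le_eqVlt => /orP[/eqP->|xy] y1; first by rewrite !subrr normr0 mulr0.
have [t [xt ty ->]] := Phi_diff l0 cw xy; have t0 := le_lt_trans x0 xt; have t1 := le_trans (ltW ty) y1.
have sub0 : 0 <= y - x by rewrite subr_ge0 ltW.
rewrite normrM (ger0_norm sub0) (ger0_norm (slope_ge0 lam w t)).
apply: ler_wpM2r => //; apply: le_trans (slope_upper l0 cw wM t0 t1) _.
by rewrite -[leRHS]mulr1; apply: ler_wpM2l; [exact: Ks_ge0|rewrite exprn_ile1 // ltW].
Qed.

(** Both sides have the same derivative and the same value at [1]. *)
Lemma Phi_fixpoint (lam : R) w (r : R) : 0 < lam -> continuous w ->
  (forall x : R, 0 < x -> x < 1 -> is_derive x 1 w (- slope lam w x)) -> w 1 = 1 ->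
  0 <= r -> r <= 1 -> Phi lam w r = w r.
Proof.
move=> lam0 cw dw w1 r0 r1; have [M B] := exists_bound cw.
have cP := Phi_continuous lam0 cw B.
have D (x : R) : r < x < 1 -> is_derive x 1 (Phi lam w) (- slope lam w x).
  by move=> _; exact: Phi_is_derive B x.
have D' (x : R) : r < x < 1 -> is_derive x 1 w (- slope lam w x).
  by move=> /andP[rx x1]; apply: dw => //; exact: le_lt_trans r0 rx.
have H1 : Phi lam w r - w r <= Phi lam w 1 - w 1.
  apply: (@derive_ge0_le R (fun t => Phi lam w t - w t) (fun t => - slope lam w t - - slope lam w t) r 1 r1).
  - by move=> x _; apply: continuousB; [exact: cP|exact: cw].
  - by move=> x xr; exact: dderB (D x xr) (D' x xr).
  - by move=> x _; rewrite subrr.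
have H2 : w r - Phi lam w r <= w 1 - Phi lam w 1.
  apply: (@derive_ge0_le R (fun t => w t - Phi lam w t) (fun t => - slope lam w t - - slope lam w t) r 1 r1).
  - by move=> x _; apply: continuousB; [exact: cw|exact: cP].
  - by move=> x xr; exact: dderB (D' x xr) (D x xr).
  - by move=> x _; rewrite subrr.
move: H1 H2; rewrite Phi1 w1 subrr; move: (Phi _ _ _) (w _) => a a' h1 h2.
by apply/eqP; rewrite eq_le; apply/andP; split; lra.
Qed.

(** A barrier [b], with [b' = - g], is a supersolution: [g] dominates the slope of
    every [w <= b]. *)
Section Barrier.
Variables (lam : R) (b g : R -> R).
Hypothesis lam0 : 0 < lam.
Hypothesis cb : continuous b.
Hypothesis b_ge1 : forall r : R, 0 <= r -> r <= 1 -> 1 <= b r.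
Hypothesis db : forall r : R, 0 < r -> r < 1 -> is_derive r 1 b (- g r).
Hypothesis slope_barrier : forall w r, continuous w ->
  (forall s : R, 0 < s -> s < 1 -> w s <= b s) -> 0 < r -> r < 1 -> slope lam w r <= g r.

Lemma Phi_le_barrier w (r : R) : continuous w -> (forall s : R, 0 < s -> s < 1 -> w s <= b s) ->
  0 <= r -> r <= 1 -> Phi lam w r <= b r.
Proof.
move=> cw wb r0 r1; have [M B] := exists_bound cw.
have H : Phi lam w r - b r <= Phi lam w 1 - b 1.
  apply: (@derive_ge0_le R (fun t => Phi lam w t - b t) (fun t => - slope lam w t - - g t) r 1 r1).
  - by move=> x _; apply: continuousB; [exact: Phi_continuous B _|exact: cb].
  - move=> x /andP[rx x1]; have x0 := le_lt_trans r0 rx.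
    exact: dderB (Phi_is_derive lam0 cw B x) (db x0 x1).
  - move=> x /andP[rx x1]; have x0 := le_lt_trans r0 rx.
    by rewrite opprK addrC subr_ge0; exact: slope_barrier.
move: H; rewrite Phi1; have := b_ge1 ler01 (lexx 1); move: (Phi _ _ _) (b 1) (b r) => p b1 br; lra.
Qed.

(** Iterates of [Phi lam] from the constant [1], frozen outside [0,1]. *)
Fixpoint iterate (j : nat) : R -> R :=
  if j is i.+1 then (fun r => Phi lam (iterate i) (clamp r)) else (fun=> 1).

Lemma iterate_continuous j : continuous (iterate j).
Proof.
elim: j => [|j IH] x /=; first exact: cst_continuous.
have [M B] := exists_bound IH.
apply: (@continuous_comp _ _ _ clamp (Phi lam (iterate j))); first exact: clamp_continuous.
exact: Phi_continuous B _.
Qed.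

Lemma iterate_ge1 j (r : R) : 1 <= iterate j r.
Proof.
case: j => [|j] //=; have [M B] := exists_bound (@iterate_continuous j).
exact: (Phi_ge1 lam0 (@iterate_continuous j) B (clamp_le1 r)).
Qed.

Lemma iterate_le_barrier j (r : R) : 0 <= r -> r <= 1 -> iterate j r <= b r.
Proof.
elim: j r => [|j IH] r r0 r1 /=; first exact: b_ge1.
rewrite (clamp_id r0 r1); apply: Phi_le_barrier => //; first exact: iterate_continuous.
by move=> s s0 s1; apply: IH; exact: ltW.
Qed.

Lemma iterate_incr j (r : R) : iterate j r <= iterate j.+1 r.
Proof.
elim: j r => [|j IH] r; first exact: (iterate_ge1 1).
apply: (Phi_mono lam0 (lexx lam) (@iterate_continuous j) (@iterate_continuous j.+1) _ (clamp_le1 r)).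
by move=> s _ _; exact: IH.
Qed.

Lemma iterate_mono i j (r : R) : (i <= j)%N -> iterate i r <= iterate j r.
Proof.
move=> /subnK <-; elim: (j - i)%N => [|m IH] //.
exact: le_trans IH (iterate_incr _ _).
Qed.

Lemma iterate_decr j (s t : R) : 0 < s -> s <= t -> t < 1 -> iterate j t <= iterate j s.
Proof.
case: j => [|j] //= s0 st t1; have [M B] := exists_bound (@iterate_continuous j).
have t0 := lt_le_trans s0 st.
rewrite (clamp_id (ltW t0) (ltW t1)) (clamp_id (ltW s0) (le_trans st (ltW t1))).
exact: (Phi_decr lam0 (@iterate_continuous j) B st).
Qed.

Lemma barrier_bound : exists M : R, forall r, 0 <= r -> r <= 1 -> b r <= M.
Proof.
have [c' _ Hc] := EVT_max ler01 (continuous_subspaceT (A := `[0 : R, 1]) cb).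
by exists (b c') => s s0 s1; apply: Hc; rewrite in_itv /= s0.
Qed.

Lemma iterate_clamp j (r : R) : iterate j (clamp r) = iterate j r.
Proof. by case: j => [|j] //=; rewrite (clamp_id (clamp_ge0 r) (clamp_le1 r)). Qed.

(** The constant does not depend on [j], which makes the limit continuous. *)
Lemma iterate_lipschitz : exists2 K : R, 0 <= K &
  forall j (x y : R), `|iterate j x - iterate j y| <= K * `|x - y|.
Proof.
have [M HM] := barrier_bound; exists (Ks lam M); first exact: Ks_ge0.
case=> [|j] x y /=; first by rewrite subrr normr0 mulr_ge0 ?Ks_ge0.
apply: (@le_trans _ _ (Ks lam M * `|clamp x - clamp y|)); last first.
  by apply: ler_wpM2l (clamp_lipschitz x y); exact: Ks_ge0.
have wM (s : R) : 0 < s -> s < 1 -> Num.max 1 (iterate j s) <= M.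
  move=> s0 s1; rewrite max_r ?iterate_ge1 //.
  by apply: le_trans (iterate_le_barrier j (ltW s0) (ltW s1)) _; apply: HM; exact: ltW.
have H (a a' : R) : 0 <= a -> a <= a' -> a' <= 1 ->
    `|Phi lam (iterate j) a - Phi lam (iterate j) a'| <= Ks lam M * (a' - a).
  exact: (Phi_lipschitz lam0 (@iterate_continuous j) wM).
have [xy|xy] := leP (clamp x) (clamp y).
  have E : `|clamp x - clamp y| = clamp y - clamp x by rewrite distrC ger0_norm ?subr_ge0.
  by rewrite E; exact: H (clamp_ge0 x) xy (clamp_le1 y).
have E : `|clamp x - clamp y| = clamp x - clamp y by rewrite gtr0_norm ?subr_gt0.
by rewrite E distrC; exact: H (clamp_ge0 y) (ltW xy) (clamp_le1 x).
Qed.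

(** Limit of the iterates, a fixed point of [Phi lam]. *)
Definition wsol (r : R) : R := sup (range (fun j => iterate j r)).

Lemma wsol_cvg (r : R) : iterate j r @[j --> \oo] --> wsol r.
Proof.
apply: nondecreasing_cvgn; first by move=> i j ij; exact: iterate_mono.
have [M HM] := barrier_bound; exists M => _ [j _ <-]; rewrite -iterate_clamp.
have h0 := clamp_ge0 r; have h1 := clamp_le1 r.
exact: le_trans (iterate_le_barrier j h0 h1) (HM _ h0 h1).
Qed.

Lemma wsol_continuous : continuous wsol.
Proof.
have [K K0 HK] := iterate_lipschitz; move=> x; apply: eps_continuous => e e0.
have K1 : 0 < K + 1 by rewrite ltr_wpDl.
exists (e / (K + 1)); first by rewrite divr_gt0.
move=> y; rewrite ltr_pdivlMr // => yx.
have C : `|iterate j y - iterate j x| @[j --> \oo] --> `|wsol y - wsol x|.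
  by apply: cvg_norm; apply: cvgB; exact: wsol_cvg.
apply: (@le_trans _ _ (K * `|y - x|)).
  by apply: (limit_le (v := fun=> K * `|y - x|) C (cvg_cst _)) => j; exact: HK.
by apply: le_trans (ltW yx); rewrite mulrC ler_wpM2l // lerDl.
Qed.

Lemma wsol_ge1 (r : R) : 1 <= wsol r.
Proof. by apply: (limit_le (u := fun=> 1) (v := fun j => iterate j r) (cvg_cst _) (@wsol_cvg r)) => j; exact: iterate_ge1. Qed.

Lemma wsol_at1 : wsol 1 = 1.
Proof.
have H : iterate j (1 : R) @[j --> \oo] --> (1 : R).
  have -> : (fun j => iterate j 1) = fun=> 1.
    by apply/funext => -[|j] //=; rewrite (clamp_id ler01 (lexx 1)) Phi1.
  exact: cvg_cst.
by apply: (cvg_unique _ (@wsol_cvg 1) H); exact: Rhausdorff.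
Qed.

Lemma wsol_is_derive (x : R) : 0 < x -> x < 1 -> is_derive x 1 wsol (- slope lam wsol x).
Proof.
move=> x0 x1.
have zc (s : R) : 0 < s -> s < 1 -> Phi lam (iterate j) s @[j --> \oo] --> wsol s.
  move=> s0 s1; have := @wsol_cvg s; rewrite -(cvg_shiftS _) /=.
  by rewrite (clamp_id (ltW s0) (ltW s1)).
have lc : (fun=> lam) j @[j --> \oo] --> lam by exact: cvg_cst.
have D := @wl_is_derive (fun=> lam) lam iterate wsol (fun=> lam0) (fun i j _ => lexx lam) lc
  (@iterate_continuous) (fun j s _ _ => iterate_ge1 j s) iterate_decr
  (fun i j s ij _ _ => iterate_mono s ij) (fun s _ _ => @wsol_cvg s) zc wsol_at1 x x0 x1.
have I := @flux_limit_integral (fun=> lam) iterate wsol (fun=> lam0) (fun i j _ => lexx lam) 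
  (@iterate_continuous) (fun j s _ _ => iterate_ge1 j s) iterate_decr
  (fun i j s ij _ _ => iterate_mono s ij) (fun s _ _ => @wsol_cvg s) zc x x0 (ltW x1).
have E : flux_limit iterate x = flux wsol x.
  apply: EFin_inj; rewrite -I -(flux_integral wsol_continuous x0).
  apply: eq_integral => s /set_mem /= /itvP sr.
  by rewrite srcE ?wsol_ge1 // ltW // sr.
by rewrite (slopeE lam wsol x0) -E; exact: D.
Qed.

Lemma wsol_fixpoint (r : R) : 0 <= r -> r <= 1 -> Phi lam wsol r = wsol r.
Proof. exact: (Phi_fixpoint lam0 wsol_continuous wsol_is_derive wsol_at1). Qed.

Lemma subsolution_le0 (v : 'rV[R]_n -> R) x : subsolution_P k q rho lam v -> closed_unit_ball x -> v x <= 0.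
Proof.
move=> [adm _ bd]; have [_ _ pos] := adm.
have Z (r : R) : is_derive r 1 (fun=> 0 : R) (0 : R) by exact: dderC.
have k1 : (0 < k <= n)%N by rewrite hk ltnW // kn_lt.
have C2 : C2_on_rV unit_ball (fun _ : 'rV[R]_n => 0 : R).
  apply: (@radial_C2 R n (fun=> 0) (fun=> 0) (fun=> 0) 0); try by move=> r _; exact: Z.
  - by move=> r _; exact: cst_continuous.
  - by move=> r _; rewrite subrr normr0 mul0r.
  - by move=> r _; rewrite normr0 mul0r.
  - by move=> r _; rewrite normr0 mul0r.
have cc : {within closed_unit_ball, continuous (fun _ : 'rV[R]_n => 0 : R)}.
  by apply: continuous_subspaceT => y; exact: cst_continuous.
have HS y : unit_ball y -> hessian_S k (fun _ : 'rV[R]_n => 0 : R) y <= hessian_S k v y.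
  move=> y1; have kk : (1 <= k <= k)%N by rewrite hk /=.
  apply: le_trans (pos k kk y y1).
  have c0 (r : R) : 0 < r < 1 -> {for r, continuous (fun=> 0 : R)} by move=> _; exact: cst_continuous.
  have z2 (r : R) : 0 < r < 1 -> `|(0 : R) - 0| <= 0 * r ^+ 2 by rewrite subrr normr0 mul0r.
  have z3 (r : R) : 0 < r < 1 -> `|0 : R| <= 0 * r ^+ 2 by rewrite normr0 mul0r.
  have z1 (r : R) : 0 < r < 1 -> `|0 : R| <= 0 * r by rewrite normr0 mul0r.
  rewrite (@radial_hessian_S R n (fun=> 0) (fun=> 0) (fun=> 0) 0 (fun r _ => Z r) (fun r _ => Z r)
    c0 z2 z3 z1 y k y1 hk n_gt0).
  by case: ifP => // _; rewrite mul0r mulr0 expr0n gtn_eqF // mulr0 addr0.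
exact: (comparison_principle k1 adm C2 cc HS bd).
Qed.

(** If [v <= 1 - w_j] then [S_k(D^2 v)] dominates [S_k] of the next iterate, and
    the comparison principle gives [v <= 1 - w_(j+1)]. *)
Lemma subsolution_le_iterate (v : 'rV[R]_n -> R) j x : subsolution_P k q rho lam v ->
  closed_unit_ball x -> v x <= 1 - iterate j (enorm x).
Proof.
move=> sv; elim: j x => [|j IH] x x1; first by rewrite subrr; exact: subsolution_le0 sv x1.
have [adm sub bd] := sv.
have cj := @iterate_continuous j; have [M B] := exists_bound cj.
have k1 : (0 < k <= n)%N by rewrite hk ltnW // kn_lt.
have C2 := usol_C2_rV lam0 cj B.
have cc := continuous_subspaceT (A := closed_unit_ball) (usol_continuous_rV lam0 cj B).
have HS y : unit_ball y -> hessian_S k (fun x => usol lam (iterate j) (enorm x)) y <= hessian_S k v y.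
  move=> y1; have y1w : closed_unit_ball y by exact: ltW y1.
  rewrite (usol_hessian_k lam0 cj B y1); apply: le_trans (sub y y1).
  apply: ler_wpM2l; first by rewrite mulr_ge0 ?(ltW lam0) // rho_ge0 // enorm_ge0.
  have h := IH y y1w; rewrite max_r ?iterate_ge1 //.
  apply: powR_le; [exact: ltW|exact: le_trans ler01 (iterate_ge1 j _)|].
  by move: h; move: (v y) (iterate _ _) => a a'; lra.
have bd' y : unit_sphere y -> v y <= usol lam (iterate j) (enorm y).
  by move=> y1; rewrite /usol y1 Phi1 subrr; exact: bd.
have H := comparison_principle k1 adm C2 cc HS bd' x1.
by move: H; rewrite /usol /= (clamp_id (enorm_ge0 x) x1).
Qed.

Theorem barrier_maximal_solution : maximal_bounded_solution n k q rho lam (usol lam wsol).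
Proof.
have cw := wsol_continuous; have [M B] := exists_bound cw.
have N (r : R) : 0 <= r -> r < 1 -> usol lam wsol r < 0.
  by move=> r0 r1; rewrite /usol subr_lt0; exact: (Phi_gt1 lam0 cw B r0 r1).
split.
- apply: (usol_classical lam0 cw B) => r r0 r1.
  by rewrite (wsol_fixpoint (ltW r0) (ltW r1)) max_r // wsol_ge1.
- by move=> r /andP[r0 r1]; exact: N.
- have [M' HM] := barrier_bound; exists M'; split; first exact: num_real.
  move=> m M'm r /= /itvP rr; have r0 : 0 <= r by rewrite rr.
  have r1 : r <= 1 by rewrite rr.
  rewrite /usol (wsol_fixpoint r0 r1) ler0_norm ?subr_le0 ?wsol_ge1 // opprB.
  have h : wsol r <= M'.
    apply: (limit_le (u := fun j => iterate j r) (v := fun=> M') (@wsol_cvg r) (cvg_cst _)) => j.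
    exact: le_trans (iterate_le_barrier j r0 r1) (HM _ r0 r1).
  by move: h; move: (wsol r) => a; lra.
- split; first split.
  + exact: (usol_admissible lam0 cw B).
  + by move=> x x1; apply: N => //; exact: enorm_ge0.
  + move=> x x1; rewrite (usol_hessian_k lam0 cw B x1); congr (_ * _ `^ _).
    rewrite /usol subKr (wsol_fixpoint (enorm_ge0 x)); last exact: ltW x1.
    by rewrite max_r // wsol_ge1.
  + by move=> x x1; rewrite /usol x1 Phi1 subrr.
  + move=> v sv x x1; rewrite /usol (wsol_fixpoint (enorm_ge0 x) x1).
    have C : 1 - iterate j (enorm x) @[j --> \oo] --> 1 - wsol (enorm x).
      by apply: cvgB; [exact: cvg_cst|exact: wsol_cvg].
    apply: (limit_le (u := fun=> v x) (cvg_cst _) C) => j.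
    exact: subsolution_le_iterate.
Qed.

End Barrier.



(** * Classical solutions are fixed points *)

Section Classical.
Variables (lam : R) (u : R -> R).
Hypothesis lam0 : 0 < lam.
Hypothesis sol : classical_solution n k q rho lam u.

(** The function [1 - v] on [0,1], extended to the line. *)
Definition one_minus (v : R -> R) (r : R) : R := 1 - v (clamp r).

Lemma one_minusE v (r : R) : 0 <= r -> r <= 1 -> one_minus v r = 1 - v r.
Proof. by move=> r0 r1; rewrite /one_minus clamp_id. Qed.

Lemma sol_derivable (r : R) : 0 < r < 1 ->
  is_derive r 1 u (derive1 u r) /\ is_derive r 1 (derive1 u) (derive1 (derive1 u) r).
Proof.
move=> /andP[r0 r1]; have [[[C2 _] _ _ _] _] := sol.
have rI : `]0, 1[ r by rewrite /= in_itv /= r0.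
have [d1 d2 _] := C2 r rI.
by split; [rewrite derive1E|rewrite derive1E]; apply: DeriveDef.
Qed.

Lemma sol_derive_bounded : exists2 M : R, 0 <= M & forall r : R, 0 < r < 1 -> `|derive1 u r| <= M.
Proof.
have [[[_ [df cdf Hdf]] _ _ _] _] := sol.
have cn : {within `[0 : R, 1], continuous (fun r => `|df r|)}.
  by move=> x; apply: cvg_norm; exact: cdf.
have [c' _ Hc] := EVT_max ler01 cn.
exists `|df c'| => // r /andP[r0 r1].
have rI : `[0, 1] r by rewrite /= in_itv /= !ltW.
have D : is_derive r 1 u (df r).
  apply: is_derive_eps => e e0.
  have [de de0 H] := has_deriv_within_eps (Hdf r rI) e0.
  exists (Num.min de (Num.min r (1 - r))); first by rewrite !lt_min de0 r0 subr_gt0.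
  move=> h; rewrite !lt_min => /andP[h1 /andP[h2 h3]]; rewrite [_%:A]mulr1.
  have E : r + h - r = h by rewrite addrC addKr.
  have := H (r + h); rewrite E; apply => //; rewrite /= in_itv /=.
  move: h2 h3; rewrite !ltr_norml => /andP[a1 _] /andP[_ a2]; apply/andP; split; lra.
by rewrite (derive1_is D); apply: Hc; rewrite in_itv /= !ltW.
Qed.

Lemma sol_continuous : continuous (one_minus u).
Proof.
have [[[_ [df cdf Hdf]] _ _ _] _] := sol.
move=> x; apply: eps_continuous => e e0.
have cI : `[0, 1] (clamp x) by rewrite /= in_itv /= clamp_ge0 clamp_le1.
have [de de0 H] := has_deriv_within_eps (Hdf _ cI) (ltr01 : (0 : R) < 1).
have D1 : 0 < 1 + `|df (clamp x)| by rewrite ltr_pwDl.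
exists (Num.min de (e / (1 + `|df (clamp x)|))); first by rewrite lt_min de0 divr_gt0.
move=> y; rewrite lt_min => /andP[yd]; rewrite ltr_pdivlMr // => ye.
have yc : `[0, 1] (clamp y) by rewrite /= in_itv /= clamp_ge0 clamp_le1.
have L1 := clamp_lipschitz y x.
have := H _ yc (le_lt_trans L1 yd); rewrite mul1r /one_minus.
move: (clamp y) (clamp x) L1 ye D1 => a b L1 ye D1 h.
have -> : 1 - u a - (1 - u b) = - ((u a - u b - df b * (a - b)) + df b * (a - b)) by ring.
rewrite normrN; apply: le_trans (ler_normD _ _) _; rewrite normrM.
have h2 : `|df b| * `|a - b| <= `|df b| * `|y - x| by rewrite ler_wpM2l.
move: L1 ye h h2; move: `|u a - _ - _| `|a - b| `|y - x| `|df b| => p1 p2 p3 p4 L1 ye h h2.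
lra.
Qed.

Lemma sol_derive_ge0 (r : R) : 0 < r < 1 -> 0 <= derive1 u r.
Proof.
move=> r01; have [M M0 HM] := sol_derive_bounded; have [[_ mono _ _] _] := sol.
have nn1 := n1_gt0.
have D (x : R) : 0 < x < 1 -> is_derive x 1 (fun s => s ^+ (n - 1) * derive1 u s ^+ 1)
    (derive1 (fun s => s ^+ (n - 1) * derive1 u s ^+ 1) x).
  move=> x01; have [_ D2] := sol_derivable x01.
  by have D := dderM (dderX (n - 1) (dder_id x)) (dderX 1 D2); rewrite (derive1_is D).
have H : 0 <= r ^+ (n - 1) * derive1 u r ^+ 1.
  apply: (@vanishing_origin_ge0 R _ _ M r D) r01.
  - by move=> x x01; apply: mono => //; rewrite hk.
  - move=> x /[dup] x01 /andP[x0 x1]; rewrite normrM expr1 mulrC normrX (gtr0_norm x0).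
    apply: ler_pM => //; [by rewrite exprn_ge0 // ltW|exact: HM|].
    by rewrite -(prednK nn1) exprS ger_pMr // exprn_ile1 // ltW.
have /andP[r0 _] := r01.
by rewrite pmulr_rge0 ?exprn_gt0 in H.
Qed.

Lemma one_minus_is_derive (r : R) : 0 < r < 1 -> is_derive r 1 (one_minus u) (- derive1 u r).
Proof.
move=> /[dup] r01 /andP[r0 r1]; have [D _] := sol_derivable r01.
have D1 : is_derive r 1 (fun s => 1 - u s) (- derive1 u r).
  by apply: (dder_eq (dderB (dderC 1 r 1) D)); rewrite sub0r.
apply: near_eq_is_derive D1; near=> t.
rewrite one_minusE //; apply: ltW; near: t; [exact: lt_nbhsr|exact: lt_nbhsl].
Unshelve. all: by end_near. Qed.

Lemma one_minus1 : one_minus u 1 = 1.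
Proof. by have [[_ _ _ u1] _] := sol; rewrite one_minusE // u1 subr0. Qed.

Lemma one_minus_decr (s t : R) : 0 <= s -> s <= t -> t <= 1 -> one_minus u t <= one_minus u s.
Proof.
move=> s0 st t1; rewrite -lerN2 -[leLHS]sub0r -[leRHS]sub0r.
apply: (@derive_ge0_le R (fun x => 0 - one_minus u x) (derive1 u) s t st).
- by move=> x _; apply: continuousB; [exact: cst_continuous|exact: sol_continuous].
- move=> x /andP[sx xt]; have x01 : 0 < x < 1 by rewrite (le_lt_trans s0 sx) (lt_le_trans xt t1).
  by apply: (dder_eq (dderB (dderC 0 x 1) (one_minus_is_derive x01))); rewrite sub0r opprK.
- move=> x /andP[sx xt]; apply: sol_derive_ge0; rewrite (le_lt_trans s0 sx) (lt_le_trans xt t1) //.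
Qed.

Lemma one_minus_ge1 (r : R) : 0 <= r -> r <= 1 -> 1 <= one_minus u r.
Proof. by move=> r0 r1; rewrite -one_minus1; exact: one_minus_decr. Qed.

(** [r^(n-k) u'^k] and [lam / c flux] have the same derivative and both vanish
    at the origin. *)
Lemma sol_slope (r : R) : 0 < r -> r < 1 -> slope lam (one_minus u) r = derive1 u r.
Proof.
move=> r0 r1; have r01 : 0 < r < 1 by rewrite r0.
have cw := sol_continuous; have [B HB] := exists_bound cw.
have [M M0 HM] := sol_derive_bounded; have [_ eqn] := sol.
have c0 := c_gt0.
pose f (s : R) := s ^+ (n - k) * derive1 u s ^+ k.
have Df (x : R) : 0 < x < 1 -> is_derive x 1 f (lam / c * src (one_minus u) x).
  move=> x01; have [_ D2] := sol_derivable x01; have /andP[x0 x1] := x01.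
  have D := dderM (dderX (n - k) (dder_id x)) (dderX k D2).
  apply: (dder_eq D); rewrite -(derive1_is D).
  have xp := exprn_gt0 (n - 1) x0.
  rewrite srcE ?one_minus_ge1 ?one_minusE ?(ltW x0) ?(ltW x1) //.
  have -> : lam / c * (x ^+ (n - 1) * rho x * (1 - u x) `^ q) =
     x ^+ (n - 1) / c * (lam * rho x * (1 - u x) `^ q) by ring.
  rewrite -(eqn x x01); move: (derive1 _ x) => d; move: (x ^+ (n - 1)) xp => p xp.
  by field; rewrite !gt_eqF.
have DF (x : R) := dderZ (lam / c) (flux_is_derive cw x).
have fb (x : R) : 0 < x < 1 -> `|f x| <= M ^+ k * x.
  move=> /[dup] x01 /andP[x0 x1]; rewrite /f normrM !normrX (gtr0_norm x0) mulrC.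
  apply: ler_pM; rewrite ?exprn_ge0 ?(ltW x0) //.
    by rewrite lerXn2r ?nnegrE // HM.
  have nk0 : (0 < n - k)%N by rewrite subn_gt0 kn_lt.
  by rewrite -(prednK nk0) exprS ger_pMr // exprn_ile1 // ltW.
have Fb (x : R) : 0 < x < 1 -> `|lam / c * flux (one_minus u) x| <= lam / c * (L * B `^ q) * x.
  move=> /andP[x0 x1]; have lc0 : 0 <= lam / c by rewrite divr_ge0 // ltW.
  have F0 := flux_ge0 cw x.
  rewrite (ger0_norm (mulr_ge0 lc0 F0)) -mulrA; apply: ler_wpM2l => //.
  apply: le_trans (flux_upper cw HB x0 (ltW x1)) _.
  apply: ler_wpM2l; first by rewrite mulr_ge0 ?L_ge0 ?powR_ge0.
  by rewrite -(prednK n_gt0) addSn exprS ger_pMr // exprn_ile1 // ltW.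
have H1 : 0 <= f r - lam / c * flux (one_minus u) r.
  apply: (@vanishing_origin_ge0 R (fun s => f s - lam / c * flux (one_minus u) s)
   (fun s => lam / c * src (one_minus u) s - lam / c * src (one_minus u) s) (M ^+ k + lam / c * (L * B `^ q)) r) r01.
  - by move=> x x01; exact: dderB (Df x x01) (DF x).
  - by move=> x _; rewrite subrr.
  - by move=> x x01; rewrite mulrDl; apply: le_trans (ler_normB _ _) _; exact: lerD (fb x x01) (Fb x x01).
have H2 : 0 <= lam / c * flux (one_minus u) r - f r.
  apply: (@vanishing_origin_ge0 R (fun s => lam / c * flux (one_minus u) s - f s)
   (fun s => lam / c * src (one_minus u) s - lam / c * src (one_minus u) s) (lam / c * (L * B `^ q) + M ^+ k) r) r01.
  - by move=> x x01; exact: dderB (DF x) (Df x x01).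
  - by move=> x _; rewrite subrr.
  - by move=> x x01; rewrite mulrDl; apply: le_trans (ler_normB _ _) _; exact: lerD (Fb x x01) (fb x x01).
have E : lam / c * flux (one_minus u) r = f r.
  by apply/eqP; rewrite eq_le -subr_ge0 H1 -subr_ge0 H2.
rewrite (slopeE lam (one_minus u) r0) E /f mulrC mulrA mulVf ?mul1r; last by rewrite expf_neq0 // gt_eqF.
exact: root_expr hk (sol_derive_ge0 r01).
Qed.

Lemma one_minus_derive_slope (r : R) : 0 < r -> r < 1 -> is_derive r 1 (one_minus u) (- slope lam (one_minus u) r).
Proof.
move=> r0 r1; have r01 : 0 < r < 1 by rewrite r0.
by apply: (dder_eq (one_minus_is_derive r01)); rewrite sol_slope.
Qed.

Lemma one_minus_fixpoint (r : R) : 0 <= r -> r <= 1 -> Phi lam (one_minus u) r = one_minus u r.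
Proof. exact: (Phi_fixpoint lam0 sol_continuous one_minus_derive_slope one_minus1). Qed.

(** A classical solution is a barrier for all smaller parameters. *)
Lemma sol_maximal_le (lam' : R) : 0 < lam' -> lam' <= lam ->
  exists v, maximal_bounded_solution n k q rho lam' v.
Proof.
move=> l0 ll; eexists.
apply: (@barrier_maximal_solution lam' (one_minus u) (fun r => slope lam (one_minus u) r) l0).
- exact: sol_continuous.
- exact: one_minus_ge1.
- exact: one_minus_derive_slope.
- move=> w r cw wb r0 r1; apply: (slope_mono l0 ll cw sol_continuous) => s s0 sr.
  by apply: wb s0 _; exact: lt_trans sr r1.
Qed.

End Classical.


(** * A priori bounds and an explicit barrier *)

Lemma one_continuous : continuous (fun _ : R => 1 : R).
Proof. by move=> x; exact: cst_continuous. Qed.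

Lemma flux_one_gt0 (r : R) : 0 < r -> 0 < flux (fun=> 1) r.
Proof. by move=> r0; have := flux_gt0 one_continuous r0. Qed.

Lemma flux_ge_const w (B t : R) : continuous w -> 1 <= B -> 0 < t ->
  (forall s : R, 0 < s -> s < t -> B <= w s) -> B `^ q * flux (fun=> 1) t <= flux w t.
Proof.
move=> cw B1 t0 H.
have D (x : R) : 0 < x < t -> is_derive x 1 (fun s => flux w s - B `^ q * flux (fun=> 1) s)
    (src w x - B `^ q * src (fun=> 1) x).
  by move=> _; exact: dderB (flux_is_derive cw x) (dderZ (B `^ q) (flux_is_derive one_continuous x)).
have H0 : flux w 0 - B `^ q * flux (fun=> 1) 0 = 0.
  by rewrite (flux_le0 w (lexx 0)) (flux_le0 (fun=> 1) (lexx 0)) mulr0 subr0.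
rewrite -subr_ge0 -[leLHS]H0.
apply: (@derive_ge0_le R (fun s => flux w s - B `^ q * flux (fun=> 1) s)
  (fun x => src w x - B `^ q * src (fun=> 1) x) 0 t (ltW t0) _ D).
  move=> x _; apply: continuousB; first exact: flux_continuous.
  apply: continuousM; first exact: cst_continuous.
  exact: flux_continuous one_continuous _.
move=> x /andP[x0 xt]; rewrite subr_ge0 /src maxxx powR1 mulr1 mulrC; apply: ler_wpM2l.
  by rewrite mulr_ge0 ?exprn_ge0 ?rho_ge0 // le_max lexx orbT.
apply: powR_le; [exact: ltW|exact: le_trans ler01 B1|].
by rewrite le_max H ?orbT.
Qed.

Lemma powR_div_root (x : R) : 0 <= x -> (x `^ q) `^ (k%:R^-1) = x `^ (q / k%:R).
Proof. by move=> x0; rewrite -powRrM. Qed.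

(** As [w] decreases, the flux at [t] is at least [w(t)^q] times the flux of the
    constant [1]; so [- w' >= A w^(q/k)] along a solution. *)
Lemma slope_ge_power (lam : R) w (a t : R) : 0 < lam -> continuous w -> 0 < a -> a <= t -> t <= 1 ->
  1 <= w t -> (forall s : R, 0 < s -> s < t -> w t <= w s) ->
  (lam / c * flux (fun=> 1) a) `^ (k%:R^-1) * w t `^ (q / k%:R) <= slope lam w t.
Proof.
move=> l0 cw a0 at_ t1 w1 H; have t0 := lt_le_trans a0 at_.
have w0 := le_trans ler01 w1; have lc0 : 0 < lam / c := divr_gt0 l0 c_gt0.
have P0 := flux_one_gt0 a0.
have lP0 := ltW (mulr_gt0 lc0 P0).
rewrite -(powR_div_root w0) -(powRM _ lP0 (powR_ge0 _ _)).
rewrite (slopeE lam w t0); apply: root_le; first exact: mulr_ge0 lP0 (powR_ge0 _ _).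
have f0 : 0 <= flux (fun=> 1) a * w t `^ q by exact: mulr_ge0 (ltW P0) (powR_ge0 _ _).
have f1 : flux (fun=> 1) a * w t `^ q <= flux w t.
  apply: le_trans (flux_ge_const cw w1 t0 H); rewrite mulrC; apply: ler_wpM2l; first exact: powR_ge0.
  exact: flux_incr one_continuous at_.
have tp : t ^+ (n - k) <= 1 by exact: exprn_ile1 (ltW t0) t1.
have F := ratio_mono (ltW l0) (lexx lam) f0 f1 (exprn_gt0 (n - k) t0) tp.
move: F; move: (flux (fun=> 1) a) => P; rewrite divr1 mulrA; exact.
Qed.

Section Superlinear.
Hypothesis hkq : k%:R < q.

Let k0 : (0 : R) < k%:R. Proof. by rewrite ltr0n. Qed.

Let e0 : 0 < q / k%:R - 1.
Proof. by rewrite subr_gt0 ltr_pdivlMr // mul1r. Qed.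

(** Lower bound for [w(r)^(1 - q/k)] obtained by integrating
    [- w' >= A w^(q/k)] from [r/2] to [r]. *)
Definition decay (lam r : R) : R :=
  (q / k%:R - 1) * (lam / c * flux (fun=> 1) (r / 2)) `^ (k%:R^-1) * (r / 2).

Lemma decay_gt0 (lam r : R) : 0 < lam -> 0 < r -> 0 < decay lam r.
Proof.
move=> l0 r0; have h0 : 0 < r / 2 by rewrite divr_gt0.
apply: (mulr_gt0 _ h0); apply: mulr_gt0 e0 _; apply: powR_gt0; apply: mulr_gt0 (divr_gt0 l0 c_gt0) _.
exact: flux_one_gt0.
Qed.

Lemma sol_decay (lam : R) u (r : R) : 0 < lam -> classical_solution n k q rho lam u ->
  0 < r -> r < 1 -> decay lam r <= one_minus u r `^ (1 - q / k%:R).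
Proof.
move=> l0 sol r0 r1; have h0 : 0 < r / 2 by rewrite divr_gt0.
have hr : r / 2 < r by rewrite ltr_pdivrMr // ltr_pMr // ltr1n.
have cw := sol_continuous sol.
have wp (t : R) : r / 2 <= t -> t <= r -> 0 < one_minus u t.
  move=> ht tr; apply: lt_le_trans ltr01 (one_minus_ge1 sol _ (le_trans tr (ltW r1))).
  by apply: ltW; exact: lt_le_trans h0 ht.
have D (t : R) : r / 2 < t < r -> is_derive t 1 (fun s => one_minus u s `^ (1 - q / k%:R))
   (((1 - q / k%:R) * one_minus u t `^ (1 - q / k%:R - 1)) * - slope lam (one_minus u) t).
  move=> /andP[ht tr]; have t0 := lt_trans h0 ht; have t1 := lt_trans tr r1.
  exact: dder_comp (one_minus_derive_slope l0 sol t0 t1) (is_derive1_powR _ (wp t (ltW ht) (ltW tr))).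
have cf (t : R) : r / 2 <= t <= r -> {for t, continuous (fun s => one_minus u s `^ (1 - q / k%:R))}.
  move=> /andP[ht tr]; apply: (@continuous_comp _ _ _ (one_minus u) (fun x : R => x `^ (1 - q / k%:R))).
    exact: cw.
  exact: powR_continuous (wp t ht tr).
have [t [ht tr E]] := MVT_oo hr cf D.
have t0 := lt_trans h0 ht; have t1 := lt_trans tr r1; have W0 := wp t (ltW ht) (ltW tr).
have mono (s : R) : 0 < s -> s < t -> one_minus u t <= one_minus u s.
  by move=> s0 st; exact: (one_minus_decr sol (ltW s0) (ltW st) (ltW t1)).
have S := slope_ge_power l0 cw h0 (ltW ht) (ltW t1) (one_minus_ge1 sol (ltW t0) (ltW t1)) mono.
have -> : one_minus u r `^ (1 - q / k%:R) = one_minus u (r / 2) `^ (1 - q / k%:R) +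
   (1 - q / k%:R) * one_minus u t `^ (1 - q / k%:R - 1) * - slope lam (one_minus u) t * (r - r / 2).
  by rewrite -E [RHS]addrC subrK.
rewrite -[leLHS]add0r; apply: lerD; first exact: powR_ge0.
have -> : r - r / 2 = r / 2 by field.
rewrite /decay; apply: ler_wpM2r; first exact: ltW.
have -> : (1 - q / k%:R) * one_minus u t `^ (1 - q / k%:R - 1) * - slope lam (one_minus u) t =
   (q / k%:R - 1) * (one_minus u t `^ (1 - q / k%:R - 1) * slope lam (one_minus u) t) by ring.
apply: ler_wpM2l; first exact: ltW.
have -> : 1 - q / k%:R - 1 = - (q / k%:R) :> R by ring.
rewrite powRN [leRHS]mulrC ler_pdivlMr; [exact: S|exact: powR_gt0].
Qed.

Lemma sol_lambda_bounded : exists B : R, forall (lam : R) u, 0 < lam ->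
  classical_solution n k q rho lam u -> lam <= B.
Proof.
have h0 : (0 : R) < 1 / 2 by [].
have h1 : (1 / 2 : R) < 1 by rewrite ltr_pdivrMr // mul1r ltr1n.
have P0 : 0 < flux (fun=> 1) (1 / 2 / 2) by apply: flux_one_gt0; rewrite divr_gt0.
have c0 := c_gt0.
pose K := 1 / ((q / k%:R - 1) * (1 / 2 / 2)).
exists (K ^+ k * (c / flux (fun=> 1) (1 / 2 / 2))) => lam u l0 sol.
have H := sol_decay l0 sol h0 h1.
have W1 := one_minus_ge1 sol (ltW h0) (ltW h1).
have W : one_minus u (1 / 2) `^ (1 - q / k%:R) <= 1.
  have -> : 1 - q / k%:R = - (q / k%:R - 1) :> R by ring.
  rewrite powRN invf_le1 ?powR_gt0 ?(lt_le_trans ltr01 W1) //.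
  by apply: powR_ge1 => //; exact: ltW.
have {H W} := le_trans H W.
rewrite /decay mulrAC mulrC -ler_pdivlMr; last by rewrite mulr_gt0.
rewrite -/K => H.
have T0 : 0 <= lam / c * flux (fun=> 1) (1 / 2 / 2).
  by apply: ltW; rewrite mulr_gt0 // divr_gt0.
have {H} : lam / c * flux (fun=> 1) (1 / 2 / 2) <= K ^+ k.
  rewrite -[leLHS](root_powK hk T0) lerXn2r // nnegrE ?powR_ge0 //.
  exact: le_trans (powR_ge0 _ _) H.
move: P0; move: (flux _ _) => P P0 H.
have -> : lam = lam / c * P * (c / P) by field; rewrite !gt_eqF.
by apply: ler_wpM2r H; rewrite divr_ge0 // ltW.
Qed.

(** A bound at [r] that is uniform for [lam] away from [0]. *)
Lemma sol_bounded (lamm r : R) : 0 < lamm -> 0 < r -> r < 1 ->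
  exists B : R, forall (lam : R) u, lamm <= lam -> classical_solution n k q rho lam u -> one_minus u r <= B.
Proof.
move=> m0 r0 r1; pose p := q / k%:R - 1; exists ((decay lamm r)^-1 `^ p^-1) => lam u ml sol.
have l0 := lt_le_trans m0 ml.
have W1 := one_minus_ge1 sol (ltW r0) (ltW r1); have W0 := lt_le_trans ltr01 W1.
have H : decay lamm r <= one_minus u r `^ (1 - q / k%:R).
  apply: le_trans (sol_decay l0 sol r0 r1).
  have h0 : 0 < r / 2 by rewrite divr_gt0.
  have P0 := flux_one_gt0 h0.
  apply: ler_wpM2r; first exact: ltW.
  apply: ler_wpM2l; first exact: ltW.
  apply: root_le; first by rewrite mulr_ge0 ?(ltW P0) // divr_ge0 ?(ltW m0) // ltW // c_gt0.
  apply: ler_wpM2r; first exact: ltW.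
  by rewrite ler_pM2r // invr_gt0 c_gt0.
have d0 := decay_gt0 m0 r0.
have E : 1 - q / k%:R = - p by rewrite /p; ring.
rewrite E powRN in H.
have {}H : one_minus u r `^ p <= (decay lamm r)^-1.
  by rewrite -[leLHS]invrK lef_pV2 ?posrE ?invr_gt0 ?powR_gt0.
have p0 : p != 0 by rewrite gt_eqF.
have -> : one_minus u r = (one_minus u r `^ p) `^ p^-1 by rewrite -powRrM mulfV // powRr1 // ltW.
by apply: powR_le H; [rewrite invr_ge0 ltW|exact: powR_ge0].
Qed.

(** The barrier is [b = 1 + a (1 - r^2) / 2] with [a = 2k / (q - k)], so
    that [b <= 1 + a / 2 = q / (q - k)]; this [a] maximises
    [a^k / (1 + a / 2)^q]. *)
Lemma explicit_maximal_solution (C lam : R) : 0 < C ->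
  (forall r : R, 0 <= r -> r <= 1 -> rho r <= C) -> 0 < lam ->
  lam <= C^-1 * 'C(n, k)%:R * ((q - k%:R) / q) `^ q * (2 * k%:R / (q - k%:R)) ^+ k ->
  exists v, maximal_bounded_solution n k q rho lam v.
Proof.
move=> C0 rC l0 ll; have qk : 0 < q - k%:R by rewrite subr_gt0.
pose a := 2 * k%:R / (q - k%:R).
have a0 : 0 < a by rewrite divr_gt0 ?mulr_gt0.
pose b (r : R) := 1 + a / 2 - a / 2 * r ^+ 2.
have db (r : R) : is_derive r 1 b (- (a * r)).
  have D := dderB (dderC (1 + a / 2) r 1) (dderZ (a / 2) (dderX 2 (dder_id r))).
  by apply: (dder_eq D) => /=; field.
pose A := 1 + a / 2.
have AE : A = q / (q - k%:R) by rewrite /A /a; field; rewrite gt_eqF.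
have A1 : 1 <= A by rewrite /A lerDl divr_ge0 // ltW.
have A0 : 0 < A by exact: lt_le_trans ltr01 A1.
have n0 : (0 : R) < n%:R by rewrite ltr0n n_gt0.
have c0 := c_gt0.
have lamA : lam * (C * A `^ q) <= c * n%:R * a ^+ k.
  have -> : c * n%:R * a ^+ k = (C^-1 * 'C(n, k)%:R * ((q - k%:R) / q) `^ q * a ^+ k) * (C * A `^ q).
    have -> : (q - k%:R) / q = A^-1 by rewrite AE invf_div.
    have -> : A^-1 `^ q = (A `^ q)^-1 by rewrite -(powR_inv1 (ltW A0)) -powRrM mulN1r powRN.
    have := powR_gt0 q A0; rewrite /c_nk; move: (A `^ q) (a ^+ k) => x y x0.
    by field; rewrite !gt_eqF.
  by apply: ler_wpM2r ll; rewrite mulr_ge0 ?powR_ge0 // ltW.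
eexists; apply: (@barrier_maximal_solution lam b (fun r => a * r) l0).
- by move=> x; exact: dder_continuous (db x).
- move=> r r0 r1; rewrite /b -addrA lerDl -{1}(mulr1 (a / 2)) -mulrBr.
  apply: mulr_ge0; first exact: ltW (divr_gt0 a0 (ltr0Sn R 1)).
  by rewrite subr_ge0 exprn_ile1.
- move=> w r cw wb r0 r1.
  have wA (s : R) : 0 < s -> s < 1 -> w s <= A.
    move=> s0 s1; apply: le_trans (wb s s0 s1) _.
    rewrite /b gerBl; apply: mulr_ge0; first exact: ltW (divr_gt0 a0 (ltr0Sn R 1)).
    exact: exprn_ge0 (ltW s0).
  have F : flux w r <= C * A `^ q / n%:R * r ^+ n.
    have D (x : R) : 0 < x < r -> is_derive x 1 (fun s => C * A `^ q / n%:R * s ^+ n - flux w s)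
        (C * A `^ q * x ^+ (n - 1) - src w x).
      move=> _; apply: (dder_eq (dderB (dderZ (C * A `^ q / n%:R) (dderX n (dder_id x))) (flux_is_derive cw x))).
      by rewrite mulr1 subn1; field; rewrite gt_eqF.
    have H0 : C * A `^ q / n%:R * 0 ^+ n - flux w 0 = 0.
      by rewrite (flux_le0 w (lexx 0)) expr0n gtn_eqF ?n_gt0 // mulr0 subr0.
    rewrite -subr_ge0 -[leLHS]H0.
    apply: (@derive_ge0_le R (fun s => C * A `^ q / n%:R * s ^+ n - flux w s)
      (fun x => C * A `^ q * x ^+ (n - 1) - src w x) 0 r (ltW r0) _ D).
      move=> x _; apply: continuousB; last exact: flux_continuous.
      exact: dder_continuous (dderZ (C * A `^ q / n%:R) (dderX n (dder_id x))).
    move=> x /andP[x0 xr]; have x1 := lt_trans xr r1; have xw := ltW x0; have x1w := ltW x1.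
    rewrite subr_ge0 /src (max_l xw).
    have -> : C * A `^ q * x ^+ (n - 1) = x ^+ (n - 1) * C * A `^ q by ring.
    apply: ler_pM; [by rewrite mulr_ge0 ?exprn_ge0 ?rho_ge0|exact: powR_ge0| |].
      by apply: ler_wpM2l; [exact: exprn_ge0|exact: rC].
    apply: powR_le; [exact: ltW|exact: ltW (max1_gt0 _)|].
    by rewrite ge_max A1 wA.
  rewrite (slopeE lam w r0); have ar0 : 0 <= a * r by rewrite mulr_ge0 // ltW.
  rewrite -[leRHS](root_expr hk ar0); apply: root_le; first exact: ltW (T_gt0 l0 cw r0).
  rewrite ler_pdivrMr ?exprn_gt0 //.
  have -> : (a * r) ^+ k * r ^+ (n - k) = a ^+ k * r ^+ n.
    by rewrite exprMn -mulrA -exprD subnKC // ltnW // kn_lt.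
  apply: le_trans (ler_wpM2l _ F) _; first by rewrite divr_ge0 // ltW.
  have -> : lam / c * (C * A `^ q / n%:R * r ^+ n) = lam * (C * A `^ q) / (c * n%:R) * r ^+ n.
    by field; rewrite !gt_eqF.
  apply: ler_wpM2r; first by rewrite exprn_ge0 // ltW.
  by rewrite ler_pdivrMr; [rewrite [leRHS]mulrC|exact: mulr_gt0].
Qed.

End Superlinear.


(** * The extremal parameter *)

(** A solution for the larger parameter is a subsolution for the smaller one. *)
Lemma maximal_antitone (lam1 lam2 : R) u1 u2 (r : R) : lam1 <= lam2 ->
  maximal_bounded_solution n k q rho lam1 u1 -> maximal_bounded_solution n k q rho lam2 u2 ->
  0 <= r -> r <= 1 -> u2 r <= u1 r.
Proof.
move=> ll [_ _ _ [_ max1]] [_ _ _ [[adm2 _ eq2 bd2] _]] r0 r1.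
pose x : 'rV[R]_n := r *: basis_vec (Ordinal n_gt0).
have xr : enorm x = r by rewrite /x enorm_scale_basis ger0_norm.
have sub : subsolution_P k q rho lam1 (fun y : 'rV[R]_n => u2 (enorm y)).
  split; first exact: adm2.
  - move=> y y1; rewrite (eq2 y y1) -!mulrA; apply: ler_wpM2r => //.
    by apply: mulr_ge0 (powR_ge0 _ _); apply: rho_ge0; exact: enorm_ge0.
  - by move=> y /bd2 ->.
have x1 : closed_unit_ball x by rewrite /closed_unit_ball /= xr.
by have := max1 _ sub x x1; rewrite xr.
Qed.

Section ExtremalParameter.
Hypothesis hkq : k%:R < q.

(** Positive parameters for which a classical solution exists. *)
Definition solvable : set R := [set lam | 0 < lam /\ exists u, classical_solution n k q rho lam u].

Hypothesis solvable_nonempty : solvable !=set0.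

(** The extremal parameter. *)
Definition lambda_star : R := sup solvable.

Lemma solvable_le (lam : R) : solvable lam -> lam <= lambda_star.
Proof.
move=> sl; apply: ub_le_sup sl.
by have [B HB] := sol_lambda_bounded hkq; exists B => x [x0 [u su]]; exact: HB su.
Qed.

Lemma lambda_star_gt0 : 0 < lambda_star.
Proof. by have [lam sl] := solvable_nonempty; have [l0 _] := sl; exact: lt_le_trans l0 (solvable_le sl). Qed.

Lemma below_lambda_star (lam : R) : 0 < lam < lambda_star ->
  exists u, maximal_bounded_solution n k q rho lam u.
Proof.
move=> /andP[l0 ll]; have [lam' [l'0 [u su]] ll'] := sup_gt solvable_nonempty ll.
exact: (sol_maximal_le l'0 su l0 (ltW ll')).
Qed.

(** Maximal solutions for [lamj] increasing to [lambda_star] decrease, stay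
    bounded at every [r > 0], and converge to an integral solution. *)
Lemma at_lambda_star : exists u, integral_solution n k q rho lambda_star u.
Proof.
have ls0 := lambda_star_gt0; move: (lambda_star) ls0 below_lambda_star => ls ls0 below.
pose h (j : nat) : R := j.+1%:R^-1.
have h0 j : 0 < h j by rewrite invr_gt0 ltr0n.
have h1 j : h j <= 1 by rewrite invf_le1 ?ltr0n // ler1n.
pose lamj j := ls * (1 - h j / 2).
have lamj0 j : 0 < lamj j.
  by apply: mulr_gt0 => //; have := h1 j; move: (h j) => x; lra.
have lamj_mono i j : (i <= j)%N -> lamj i <= lamj j.
  move=> ij; apply: ler_wpM2l; first exact: ltW.
  have : h j <= h i by rewrite lef_pV2 ?posrE ?ltr0n // ler_nat ltnS.
  by move: (h i) (h j) => x y; lra.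
have lamj_lt j : 0 < lamj j < ls.
  rewrite lamj0 /= -[ltRHS]mulr1 ltr_pM2l //; have := h0 j; move: (h j) => x; lra.
have lamj_cvg : lamj j @[j --> \oo] --> ls.
  have H : ls * (1 - h j / 2) @[j --> \oo] --> ls * (1 - 0 / 2).
    apply: cvgM; first exact: cvg_cst.
    apply: cvgB; first exact: cvg_cst.
    by apply: cvgM; [exact: cvg_harmonic|exact: cvg_cst].
  by move: H; rewrite mul0r subr0 mulr1.
have [u Hu] := choice (fun j => below _ (lamj_lt j)).
have sol j : classical_solution n k q rho (lamj j) (u j) by have [] := Hu j.
pose w j := one_minus (u j).
have cw j : continuous (w j) := sol_continuous (sol j).
have wge1 j (s : R) : 0 < s -> s < 1 -> 1 <= w j s.
  by move=> s0 s1; exact: (one_minus_ge1 (sol j) (ltW s0) (ltW s1)).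
have wdecr j (s t : R) : 0 < s -> s <= t -> t < 1 -> w j t <= w j s.
  by move=> s0 st t1; exact: (one_minus_decr (sol j) (ltW s0) st (ltW t1)).
have wmono i j (s : R) : (i <= j)%N -> 0 < s -> s < 1 -> w i s <= w j s.
  move=> ij s0 s1; rewrite /w !one_minusE ?(ltW s0) ?(ltW s1) // lerB //.
  exact: (maximal_antitone (lamj_mono i j ij) (Hu i) (Hu j) (ltW s0) (ltW s1)).
pose wl (s : R) : R := sup (range (fun j => w j s)).
have wcvg (s : R) : 0 < s -> s < 1 -> w j s @[j --> \oo] --> wl s.
  move=> s0 s1; apply: nondecreasing_cvgn; first by move=> i j ij; exact: wmono.
  have [B HB] := sol_bounded hkq (lamj0 0) s0 s1; exists B => _ [j _ <-].
  exact: HB (lamj_mono 0 j (leq0n j)) (sol j).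
have zcvg (s : R) : 0 < s -> s < 1 -> Phi (lamj j) (w j) s @[j --> \oo] --> wl s.
  move=> s0 s1; have -> : (fun j => Phi (lamj j) (w j) s) = (fun j => w j s).
    by apply/funext => j; exact: (one_minus_fixpoint (lamj0 j) (sol j) (ltW s0) (ltW s1)).
  exact: wcvg.
have wl1 : wl 1 = 1.
  rewrite /wl; have -> : range (fun j => w j (1 : R)) = [set (1 : R)].
    rewrite -(_ : (fun=> 1) = (fun j => w j (1 : R))); last by apply/funext => j; rewrite /w (one_minus1 (sol j)).
    by apply/seteqP; split => [x [_ _ <-]|x ->] //; exists 0%N.
  by rewrite sup1.
exists (fun r => 1 - wl r).
exact: (limit_integral_solution lamj0 lamj_mono lamj_cvg cw wge1 wdecr wmono wcvg zcvg wl1).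
Qed.

Lemma above_lambda_star (lam : R) : lambda_star < lam ->
  ~ exists u, classical_solution n k q rho lam u.
Proof.
move=> ll [u su]; have l0 := lt_trans lambda_star_gt0 ll.
have sl : solvable lam by split => //; exists u.
by have := le_lt_trans (solvable_le sl) ll; rewrite ltxx.
Qed.

End ExtremalParameter.

End RadialOperator.


(** * The weight *)

Section Weight.
Context {R : realType}.
Variables (k : nat) (l0 L : R) (rho : R -> R).
Hypothesis k_gt0 : (0 < k)%N.
Hypothesis rho_C0 : {within `[0, +oo[, continuous rho}.
Hypothesis rho_gt0 : forall r : R, 0 < r -> 0 < rho r.

Lemma weight_eps (x e : R) : 0 <= x -> 0 < e ->
  exists2 d : R, 0 < d & forall y : R, 0 <= y -> `|y - x| < d -> `|rho y - rho x| <= e.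
Proof.
move=> x0 e0.
have xI : `[0, +oo[ x by rewrite /= in_itv /= x0.
have C := (subspace_continuousP _ _).1 rho_C0 x xI.
have /cvgrPdist_le/(_ e e0) H := C.
rewrite /within /= in H; move: H => /nbhs_ballP[d /= d0 Hd].
exists d => // y y0 yx; rewrite distrC; apply: Hd; first by rewrite -ball_normE /= distrC.
by rewrite in_itv /= y0.
Qed.

Lemma weight_continuous : continuous (fun s : R => rho (Num.max s 0)).
Proof.
move=> x; apply: eps_continuous => e e0.
have m0 (y : R) : 0 <= Num.max y 0 by rewrite le_max lexx orbT.
have [d d0 Hd] := weight_eps (m0 x) e0; exists d => // y yx.
apply: Hd (m0 y) _; apply: le_lt_trans yx.
exact: max0_lipschitz.
Qed.

Hypothesis l0k : 2 * k%:R <= l0.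
Hypothesis L0 : 0 < L.
Hypothesis rhoL : forall r : R, 0 < r -> r `^ (- l0) * rho r < L.

Lemma weight_le_pos (r : R) : 0 < r -> r <= 1 -> rho r <= L * r ^+ (2 * k).
Proof.
move=> r0 r1; have p0 := powR_gt0 l0 r0.
have h := ltW (rhoL r0); rewrite powRN mulrC ler_pdivrMr // in h.
apply: le_trans h _; apply: ler_wpM2l; first exact: ltW.
rewrite -powR_mulrn ?(ltW r0) // natrM; apply: ger_powR => //.
by rewrite r0.
Qed.

Lemma weight_le (r : R) : 0 <= r -> r <= 1 -> rho r <= L * r ^+ (2 * k).
Proof.
rewrite le_eqVlt => /orP[/eqP<-|r0]; last exact: weight_le_pos.
move=> _; clear r; rewrite expr0n muln_eq0 /= gtn_eqF // mulr0 leNgt; apply/negP => h.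
have e0 : 0 < rho 0 / 4 by rewrite divr_gt0.
have [d d0 Hd] := weight_eps (lexx 0) e0.
(* Small enough for continuity at 0 and for L r to be below rho 0 / 4. *)
pose r := Num.min (Num.min (d / 2) 1) (rho 0 / (4 * L)).
have r0 : 0 < r by rewrite !lt_min ltr01 !divr_gt0 // mulr_gt0.
have rd : r < d.
  by rewrite /r !gt_min ltr_pdivrMr // ltr_pMr // ltr1n.
have r1 : r <= 1 by rewrite /r !ge_min lexx orbT.
have rL : r <= rho 0 / (4 * L) by rewrite /r ge_min lexx orbT.
have := Hd r (ltW r0); rewrite subr0 gtr0_norm // => /(_ rd); rewrite ler_norml => /andP[h1 _].
have h2 := weight_le_pos r0 r1.
have h3 : r ^+ (2 * k) <= r.
  by rewrite -(prednK (_ : 0 < 2 * k)%N) ?muln_gt0 // exprS ger_pMr // exprn_ile1 // ltW.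
have h4 : L * r ^+ (2 * k) <= rho 0 / 4.
  apply: le_trans (ler_wpM2l (ltW L0) (le_trans h3 rL)) _.
  by apply: eq_imply_le; field; rewrite gt_eqF.
move: h1 h2 h4 h; move: (L * _) (rho r) (rho 0) => a b c'; lra.
Qed.

Hypothesis rho_C2 : C2_on `]0, +oo[ rho.
Hypothesis log_slope_le : forall r : R, 0 < r -> r * derive1 rho r / rho r <= l0.

(** The logarithmic derivative of [r^(-l0) rho] is
    [(r rho' / rho - l0) / r <= 0]. *)
Lemma weight_ratio_decr (s r : R) : 0 < s -> s <= r -> r `^ (- l0) * rho r <= s `^ (- l0) * rho s.
Proof.
move=> s0 sr; rewrite -lerN2 -[leLHS]sub0r -[leRHS]sub0r.
have D (x : R) : 0 < x -> is_derive x 1 (fun t => 0 - t `^ (- l0) * rho t)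
    (0 - (- l0 * x `^ (- l0 - 1) * rho x + x `^ (- l0) * derive1 rho x)).
  move=> x0; have xI : `]0, +oo[ x by rewrite /= in_itv /= x0.
  have [dr _ _] := rho_C2 xI.
  have Dr : is_derive x 1 rho (derive1 rho x) by rewrite derive1E; apply: DeriveDef.
  exact: dderB (dderC 0 x 1) (dderM (is_derive1_powR (- l0) x0) Dr).
apply: (@derive_ge0_le R (fun t => 0 - t `^ (- l0) * rho t)
  (fun x => 0 - (- l0 * x `^ (- l0 - 1) * rho x + x `^ (- l0) * derive1 rho x)) s r sr).
- by move=> x /andP[sx _]; exact: dder_continuous (D x (lt_le_trans s0 sx)).
- by move=> x /andP[sx _]; exact: D (lt_trans s0 sx).
- move=> x /andP[sx _]; have x0 := lt_trans s0 sx.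
  have rx := rho_gt0 x0; have h := log_slope_le x0.
  rewrite ler_pdivrMr // in h.
  rewrite (powR_step (- l0) x0).
  have p0 := powR_ge0 x (- l0 - 1).
  have -> : 0 - (- l0 * x `^ (- l0 - 1) * rho x + x * x `^ (- l0 - 1) * derive1 rho x) =
    x `^ (- l0 - 1) * (l0 * rho x - x * derive1 rho x) by ring.
  by rewrite mulr_ge0 // subr_ge0.
Qed.

Lemma weight_doubling (r s : R) : 0 < r -> r / 2 <= s -> s <= r -> (2 `^ l0)^-1 * rho r <= rho s.
Proof.
move=> r0 rs sr; have s0 : 0 < s by apply: lt_le_trans rs; rewrite divr_gt0.
have l00 : 0 <= l0 by apply: le_trans l0k; rewrite mulr_ge0.
have h := weight_ratio_decr s0 sr.
have pr := powR_gt0 l0 r0; have ps := powR_gt0 l0 s0; have p2 : 0 < 2 `^ l0 :> R by apply: powR_gt0.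
have rr := rho_gt0 s0.
rewrite !powRN mulrC ler_pdivrMr // in h.
rewrite mulrC ler_pdivrMr //; apply: le_trans h _.
rewrite mulrC mulrA; apply: (@le_trans _ _ ((2 * s) `^ l0 * (s `^ l0)^-1 * rho s)).
  apply: ler_wpM2r; first exact: ltW.
  apply: ler_wpM2r; first by rewrite invr_ge0 ltW.
  by apply: powR_le (ltW r0) _ => //; lra.
rewrite powRM ?(ltW s0) //; apply: eq_imply_le.
by move: (2 `^ l0) (s `^ l0) ps => a b b0; field; rewrite gt_eqF.
Qed.

End Weight.

(** * The theorem *)

Theorem theorem2p1 (R : realType) (n k : nat) (q l0 : R) (rho : R -> R)
  (hk : (0 < k)%N) (hn : (2 * k < n)%N) (hq : k%:R < q)
  (rho_C2 : C2_on `]0, +oo[ rho)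
  (rho_C0 : {within `[0, +oo[, continuous rho})
  (rho_gt0 : forall r : R, 0 < r -> 0 < rho r)
  (hl0 : r * derive1 rho r / rho r @[r --> 0^'+] --> l0)
  (hR : ((forall r : R, 0 < r -> r * derive1 rho r / rho r < l0) /\
           q_star n k l0 <= q) \/
        ((forall r : R, 0 < r -> r * derive1 rho r / rho r <= l0) /\
           q_star n k l0 < q))
  (hL : exists2 L : R, 0 < L &
          forall r : R, 0 < r -> 0 < r `^ (- l0) * rho r < L)
  (hl0k : 2 * k%:R < l0) :
  exists lambda_star : R,
    [/\ 0 < lambda_star,
        forall lambda : R, 0 < lambda < lambda_star ->
          exists u : R -> R, maximal_bounded_solution n k q rho lambda u,
        exists u : R -> R, integral_solution n k q rho lambda_star u,
        forall lambda : R, lambda_star < lambda ->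
          ~ exists u : R -> R, classical_solution n k q rho lambda u
      & exists C : R,
          [/\ (rho @` `[0, 1]) C,
              ubound (rho @` `[0, 1]) C,
              0 < C
            & C^-1 * 'C(n, k)%:R * ((q - k%:R) / q) `^ q
                * (2 * k%:R / (q - k%:R)) ^+ k <= lambda_star]].

Proof.
have k0 : (0 : R) < k%:R by rewrite ltr0n.
have q0 : 0 < q := lt_trans k0 hq.
have [L L0 rhoL'] := hL.
have rhoL (r : R) : 0 < r -> r `^ (- l0) * rho r < L by move=> r0; have /andP[] := rhoL' r r0.
have logle (r : R) : 0 < r -> r * derive1 rho r / rho r <= l0.
  by move=> r0; case: hR => -[H _]; [exact: ltW (H r r0)|exact: H].
have cr := weight_continuous rho_C0.
have rle := weight_le hk rho_C0 (ltW hl0k) L0 rhoL.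
have kap0 : 0 < (2 `^ l0)^-1 :> R by rewrite invr_gt0 powR_gt0.
have rge (r s : R) : 0 < r -> r <= 1 -> r / 2 <= s -> s <= r -> (2 `^ l0)^-1 * rho r <= rho s.
  by move=> r0 _; exact: (weight_doubling rho_gt0 (ltW hl0k) rho_C2 logle).
have cI : {within `[0, 1], continuous rho}.
  by apply: continuous_subspaceW rho_C0 => x /=; rewrite !in_itv /= => /andP[-> _].
have [c' c'I Hc] := EVT_max ler01 cI.
have rC (r : R) : 0 <= r -> r <= 1 -> rho r <= rho c' by move=> r0 r1; apply: Hc; rewrite in_itv /= r0.
have C0 : 0 < rho c' := lt_le_trans (rho_gt0 1 ltr01) (rC 1 ler01 (lexx 1)).
pose lam0 := (rho c')^-1 * 'C(n, k)%:R * ((q - k%:R) / q) `^ q * (2 * k%:R / (q - k%:R)) ^+ k.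
have kn := kn_lt hn.
have qk0 : 0 < q - k%:R by rewrite subr_gt0.
have lam00 : 0 < lam0.
  apply: mulr_gt0; last by rewrite exprn_gt0 // divr_gt0 // mulr_gt0.
  apply: mulr_gt0; last by rewrite powR_gt0 // divr_gt0.
  by rewrite mulr_gt0 ?invr_gt0 // ltr0n bin_gt0 ltnW.
have sl0 : solvable n k q rho lam0.
  split=> //.
  have [v [sv _ _ _]] := explicit_maximal_solution hk hn q0 cr rho_gt0 rle kap0 rge hq C0 rC lam00 (lexx _).
  by exists v.
have ne : solvable n k q rho !=set0 by exists lam0.
exists (lambda_star n k q rho); split.
- exact: (lambda_star_gt0 hk hn q0 cr rho_gt0 rle hq ne).
- exact: (below_lambda_star hk hn q0 cr rho_gt0 rle kap0 rge ne).
- exact: (at_lambda_star hk hn q0 cr rho_gt0 rle kap0 rge hq ne).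
- exact: (above_lambda_star hk hn q0 cr rho_gt0 rle hq ne).
- exists (rho c'); split => //.
  + by move=> _ [r /= rI <-]; exact: Hc.
  + exact: (solvable_le hk hn q0 cr rho_gt0 rle hq sl0).
Qed.
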